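(* Let ${}^{\mathcal C|}\mathcal M$ be an enriched braided monoidal category. Then its Müger center ${}^{\mathcal C|}\Gamma_2({}^{\mathcal C|}\mathcal M)$ is the $E_2$-center of ${}^{\mathcal C|}\mathcal M$ in $\mathbf{ECat}$.
   Context: Monoidal categories are written as if strict. **Enriched categories.** For a monoidal category $\mathcal A$, an $\mathcal A$-enriched category ${}^{\mathcal A|}\mathcal L$ has objects, hom objects ${}^{\mathcal A|}\mathcal L(x,y)\in\mathcal A$, identities and compositions satisfying the usual axioms; $\mathcal A$ is its background category. The underlying category $\mathcal L$ has the same objects and $\mathcal L(x,y)=\mathcal A(\mathbf 1_{\mathcal A},{}^{\mathcal A|}\mathcal L(x,y))$; $f\in\mathcal L(x,y)$ induces ${}^{\mathcal A|}\mathcal L(w,f)$ and ${}^{\mathcal A|}\mathcal L(f,w)$ by composing with $f$. An enriched functor ${}^|F:{}^{\mathcal A|}\mathcal L\to{}^{\mathcal B|}\mathcal M$ consists of a lax-monoidal functor $\hat F:\mathcal A\to\mathcal B$, a map $F$ on objects and morphisms ${}^|F_{x,y}:\hat F({}^{\mathcal A|}\mathcal L(x,y))\to{}^{\mathcal B|}\mathcal M(F(x),F(y))$ compatible with identities and compositions (via the lax structure of $\hat F$); it has an underlying functor $F:\mathcal L\to\mathcal M$. An enriched natural transformation ${}^|\xi:{}^|F\Rightarrow{}^|G$ is a lax-monoidal natural transformation $\hat\xi:\hat F\Rightarrow\hat G$ with morphisms $\xi_x:\mathbf 1_{\mathcal B}\to{}^{\mathcal B|}\mathcal M(F(x),G(x))$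 such that ${}^{\mathcal B|}\mathcal M(F(x),\xi_y)\circ{}^|F_{x,y}={}^{\mathcal B|}\mathcal M(\xi_x,G(y))\circ{}^|G_{x,y}\circ\hat\xi$. $\mathbf{ECat}$ is the 2-category of enriched categories, enriched functors with $\hat F$ (strong) monoidal, and enriched natural transformations; it is symmetric monoidal under the Cartesian product (background categories and hom objects are paired), with unit $*$. **Enriched (braided) monoidal categories.** For $\mathcal A$ braided with braiding $c$, an enriched monoidal category ${}^{\mathcal A|}\mathcal L$ has an enriched functor ${}^|\otimes:{}^{\mathcal A|}\mathcal L\times{}^{\mathcal A|}\mathcal L\to{}^{\mathcal A|}\mathcal L$ with $\hat\otimes=\otimes_{\mathcal A}$, monoidal via $1\otimes c_{b_1,a_2}\otimes1:a_1\otimes b_1\otimes a_2\otimes b_2\to a_1\otimes a_2\otimes b_1\otimes b_2$, a unit object, and enriched natural isomorphisms (associator, unitors) whose background parts are the associator and unitors of $\mathcal A$, such that $\mathcal L$ with the underlying data is a monoidal category. An enriched monoidal functor is an enriched functor ${}^|F$ with $\hat F$ braided monoidal and enriched natural isomorphisms ${}^|F^2,{}^|F^0$ (comparison of tensor products and of units) whose background parts are the monoidal structure of $\hat F$ and whose underlying parts make $F$ monoidal. An enriched monoidal natural transformation is an enriched natural transformation with $\xi$ monoidal. An enriched braided monoidal category is an enriched monoidal category ${}^{\mathcal A|}\mathcal L$ with $\mathcal A$ symmetric and an enriched natural isomorphism ${}^|c$ from $\otimes$ to the reversed $\otimes$ whose background part is the braiding of $\mathcal A$ and whose underlying part makes $\mathcal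 L$ a braided monoidal category; an enriched braided monoidal functor is an enriched monoidal functor whose underlying functor is braided. Enriched braided monoidal categories, enriched braided monoidal functors and enriched monoidal natural transformations form a symmetric monoidal 2-category $\mathbf{ECat}^{\mathrm{br}}$ under $\times$, which models $E_2$-algebras in $\mathbf{ECat}$. **Centers.** In a monoidal 2-category with product $\times$ and unit $*$, a left unital action on $x$ is a pair $(A,u:*\to A)$ with a 1-morphism $g:A\times x\to x$ and an invertible 2-morphism $\alpha:g(u\times1_x)\Rightarrow1_x$. A 1-morphism $((A_1,u_1),g_1,\alpha_1)\to((A_2,u_2),g_2,\alpha_2)$ is $(p:A_1\to A_2,\ \sigma:u_2\Rightarrow pu_1,\ \rho:g_2(p\times1_x)\Rightarrow g_1)$ with $\sigma,\rho$ invertible and $\alpha_1\cdot(\rho(u_1\times1))\cdot(g_2(\sigma\times1))=\alpha_2$; a 2-morphism $(p,\sigma,\rho)\Rightarrow(q,\beta,\varphi)$ is $\xi:p\Rightarrow q$ with $(\xi u_1)\cdot\sigma=\beta$ and $\varphi\cdot(g_2(\xi\times1))=\rho$. An $E_0$-center of $x$ is a terminal object of this 2-category (all hom categories into it are contractible groupoids: non-empty with exactly one morphism between any two objects). The $E_2$-center in $\mathbf{ECat}$ of an enriched braided monoidal category is its $E_0$-center in the 2-category of $E_2$-algebras in $\mathbf{ECat}$, i.e. in $\mathbf{ECat}^{\mathrm{br}}$. **Müger center.** ${}^{\mathcal C|}\Gamma_2({}^{\mathcal C|}\mathcal M):={}^{\mathcal C|}\mathfrak Z_2(\mathcal M)$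 is the enriched subcategory of ${}^{\mathcal C|}\mathcal M$ whose objects are the transparent objects of the underlying braided monoidal category $\mathcal M$ (those with trivial double braiding with all objects), with the same hom objects as ${}^{\mathcal C|}\mathcal M$ and the restricted braided monoidal structure. It acts on ${}^{\mathcal C|}\mathcal M$ by the tensor product ${}^|\otimes$ of ${}^{\mathcal C|}\mathcal M$, with unit 2-isomorphism given by the left unitors of $\mathcal C$ and $\mathcal M$. *)

(* Defs.v *)
(* Every structure is split into a record of raw data (named ...Data) and a
   predicate (named is_...) stating its axioms.  Composites, products and
   whiskerings are then defined on raw data alone.
   Monoidal categories are not assumed strict: associators and unitors are
   explicit everywhere. *)

Set Implicit Arguments.
Unset Strict Implicit.
Unset Printing Implicit Defensive.

Record catData := CatData {
  ob :> Type;
  hom : ob -> ob -> Type;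
  idm : forall x, hom x x;
  cmp : forall x y z, hom y z -> hom x y -> hom x z }.

Arguments hom {c} x y.
Arguments idm {c} x.
Arguments cmp {c x y z} g f.

Notation "g ∘ f" := (cmp g f) (at level 40, left associativity).

Record is_cat (C : catData) : Prop := {
  cat_idl : forall (x y : C) (f : hom x y), idm y ∘ f = f;
  cat_idr : forall (x y : C) (f : hom x y), f ∘ idm x = f;
  cat_assoc : forall (w x y z : C) (h : hom y z) (g : hom x y) (f : hom w x),
    h ∘ (g ∘ f) = h ∘ g ∘ f }.

Definition is_inverse (C : catData) (x y : C) (f : hom x y) (g : hom y x) : Prop :=
  g ∘ f = idm x /\ f ∘ g = idm y.

Definition is_iso (C : catData) (x y : C) (f : hom x y) : Prop :=
  exists g : hom y x, is_inverse f g.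

Arguments is_iso {C x y} f.

Record monData := MonData {
  mon_cat :> catData;
  mone : mon_cat;
  tob : mon_cat -> mon_cat -> mon_cat;
  tmor : forall a a' b b' : mon_cat,
    hom a a' -> hom b b' -> hom (tob a b) (tob a' b');
  massoc : forall a b c, hom (tob (tob a b) c) (tob a (tob b c));
  massocV : forall a b c, hom (tob a (tob b c)) (tob (tob a b) c);
  mlun : forall a, hom (tob mone a) a;
  mlunV : forall a, hom a (tob mone a);
  mrun : forall a, hom (tob a mone) a;
  mrunV : forall a, hom a (tob a mone) }.

Arguments mone {m}.
Arguments tob {m} a b.
Arguments tmor {m a a' b b'} f g.
Arguments massoc {m} a b c.
Arguments massocV {m} a b c.
Arguments mlun {m} a.
Arguments mlunV {m} a.
Arguments mrun {m} a.
Arguments mrunV {m} a.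

Notation "x ⊗ y" := (tob x y) (at level 36, left associativity).
Notation "f ⊠ g" := (tmor f g) (at level 36, left associativity).

Record is_monoidal (A : monData) : Prop := {
  mon_is_cat : is_cat A;
  mon_tid : forall a b : A, idm a ⊠ idm b = idm (a ⊗ b);
  mon_tcmp : forall (a a' a'' b b' b'' : A) (f' : hom a' a'') (f : hom a a')
      (g' : hom b' b'') (g : hom b b'),
    (f' ∘ f) ⊠ (g' ∘ g) = (f' ⊠ g') ∘ (f ⊠ g);
  mon_assoc_inv : forall a b c : A, is_inverse (massoc a b c) (massocV a b c);
  mon_lun_inv : forall a : A, is_inverse (mlun a) (mlunV a);
  mon_run_inv : forall a : A, is_inverse (mrun a) (mrunV a);
  mon_assoc_nat : forall (a a' b b' c c' : A) (f : hom a a') (g : hom b b') (h : hom c c'),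
    massoc a' b' c' ∘ (f ⊠ g ⊠ h) = (f ⊠ (g ⊠ h)) ∘ massoc a b c;
  mon_lun_nat : forall (a a' : A) (f : hom a a'),
    mlun a' ∘ (idm mone ⊠ f) = f ∘ mlun a;
  mon_run_nat : forall (a a' : A) (f : hom a a'),
    mrun a' ∘ (f ⊠ idm mone) = f ∘ mrun a;
  mon_pentagon : forall a b c d : A,
    massoc a b (c ⊗ d) ∘ massoc (a ⊗ b) c d
    = (idm a ⊠ massoc b c d) ∘ massoc a (b ⊗ c) d ∘ (massoc a b c ⊠ idm d);
  mon_triangle : forall a b : A,
    (idm a ⊠ mlun b) ∘ massoc a mone b = mrun a ⊠ idm b }.

Record brData := BrData {
  br_mon :> monData;
  braid : forall a b : br_mon, hom (a ⊗ b) (b ⊗ a) }.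

Arguments braid {b} a b0 : rename.

Record is_braided (A : brData) : Prop := {
  br_is_mon : is_monoidal A;
  br_iso : forall a b : A, is_iso (braid a b);
  br_nat : forall (a a' b b' : A) (f : hom a a') (g : hom b b'),
    braid a' b' ∘ (f ⊠ g) = (g ⊠ f) ∘ braid a b;
  br_hex1 : forall a b c : A,
    massoc b c a ∘ braid a (b ⊗ c) ∘ massoc a b c
    = (idm b ⊠ braid a c) ∘ massoc b a c ∘ (braid a b ⊠ idm c);
  br_hex2 : forall a b c : A,
    massocV c a b ∘ braid (a ⊗ b) c ∘ massocV a b c
    = (braid a c ⊠ idm b) ∘ massocV a c b ∘ (idm a ⊠ braid b c) }.

Record is_symmetric (A : brData) : Prop := {
  sym_is_br : is_braided A;
  sym_inv : forall a b : A, braid b a ∘ braid a b = idm (a ⊗ b) }.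

Definition transparent (A : brData) (x : A) : Prop :=
  forall y : A, braid y x ∘ braid x y = idm (x ⊗ y).

Arguments transparent A x : clear implicits.

(* The interchange 1 ⊗ c_{b1,a2} ⊗ 1. *)
Definition midswap (A : brData) (a1 b1 a2 b2 : A) :
    hom ((a1 ⊗ b1) ⊗ (a2 ⊗ b2)) ((a1 ⊗ a2) ⊗ (b1 ⊗ b2)) :=
  massocV a1 a2 (b1 ⊗ b2)
  ∘ (idm a1 ⊠ (massoc a2 b1 b2 ∘ (braid b1 a2 ⊠ idm b2) ∘ massocV b1 a2 b2))
  ∘ massoc a1 b1 (a2 ⊗ b2).

Arguments midswap {A} a1 b1 a2 b2.

Record monFunData (A B : monData) := MonFunData {
  fob :> A -> B;
  fmor : forall a a' : A, hom a a' -> hom (fob a) (fob a');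
  fmu : forall a b : A, hom (fob a ⊗ fob b) (fob (a ⊗ b));
  feps : hom mone (fob mone) }.

Arguments fmor {A B} m {a a'} f.
Arguments fmu {A B} m a b.
Arguments feps {A B} m.

Record is_lax (A B : monData) (F : monFunData A B) : Prop := {
  lax_id : forall a : A, fmor F (idm a) = idm (F a);
  lax_cmp : forall (a b c : A) (g : hom b c) (f : hom a b),
    fmor F (g ∘ f) = fmor F g ∘ fmor F f;
  lax_mu_nat : forall (a a' b b' : A) (f : hom a a') (g : hom b b'),
    fmu F a' b' ∘ (fmor F f ⊠ fmor F g) = fmor F (f ⊠ g) ∘ fmu F a b;
  lax_assoc : forall a b c : A,
    fmu F a (b ⊗ c) ∘ (idm (F a) ⊠ fmu F b c) ∘ massoc (F a) (F b) (F c)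
    = fmor F (massoc a b c) ∘ fmu F (a ⊗ b) c ∘ (fmu F a b ⊠ idm (F c));
  lax_lun : forall a : A,
    fmor F (mlun a) ∘ fmu F mone a ∘ (feps F ⊠ idm (F a)) = mlun (F a);
  lax_run : forall a : A,
    fmor F (mrun a) ∘ fmu F a mone ∘ (idm (F a) ⊠ feps F) = mrun (F a) }.

Record is_strong (A B : monData) (F : monFunData A B) : Prop := {
  strong_lax : is_lax F;
  strong_mu : forall a b : A, is_iso (fmu F a b);
  strong_eps : is_iso (feps F) }.

Record is_brfun (A B : brData) (F : monFunData A B) : Prop := {
  brfun_strong : is_strong F;
  brfun_braid : forall a b : A,
    fmor F (braid a b) ∘ fmu F a b = fmu F b a ∘ braid (F a) (F b) }.

Record is_monnat (A B : monData) (F G : monFunData A B)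
    (t : forall a : A, hom (F a) (G a)) : Prop := {
  monnat_nat : forall (a a' : A) (f : hom a a'), t a' ∘ fmor F f = fmor G f ∘ t a;
  monnat_mu : forall a b : A, t (a ⊗ b) ∘ fmu F a b = fmu G a b ∘ (t a ⊠ t b);
  monnat_eps : t mone ∘ feps F = feps G }.

Arguments is_monnat {A B} F G t.

Definition idMonFun (A : monData) : monFunData A A :=
  {| fob := fun a => a; fmor := fun _ _ f => f;
     fmu := fun a b => idm (a ⊗ b); feps := idm mone |}.

Definition compMonFun (A B C : monData) (G : monFunData B C) (F : monFunData A B) :
    monFunData A C :=
  {| fob := fun a => G (F a);
     fmor := fun _ _ f => fmor G (fmor F f);
     fmu := fun a b => fmor G (fmu F a b) ∘ fmu G (F a) (F b);
     feps := fmor G (feps F) ∘ feps G |}.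

Definition unitCat : catData :=
  {| ob := unit; hom := fun _ _ => unit; idm := fun _ => tt; cmp := fun _ _ _ _ _ => tt |}.

Definition unitMon : monData :=
  {| mon_cat := unitCat; mone := tt; tob := fun _ _ => tt; tmor := fun _ _ _ _ _ _ => tt;
     massoc := fun _ _ _ => tt; massocV := fun _ _ _ => tt;
     mlun := fun _ => tt; mlunV := fun _ => tt; mrun := fun _ => tt; mrunV := fun _ => tt |}.

Definition unitBr : brData := {| br_mon := unitMon; braid := fun _ _ => tt |}.

Definition prodCat (C D : catData) : catData :=
  {| ob := C * D;
     hom := fun x y => (hom (fst x) (fst y) * hom (snd x) (snd y))%type;
     idm := fun x => (idm (fst x), idm (snd x));
     cmp := fun _ _ _ g f => (fst g ∘ fst f, snd g ∘ snd f) |}.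

Definition prodMon (A B : monData) : monData :=
  {| mon_cat := prodCat A B;
     mone := (mone, mone);
     tob := fun x y => (fst x ⊗ fst y, snd x ⊗ snd y);
     tmor := fun _ _ _ _ f g => (fst f ⊠ fst g, snd f ⊠ snd g);
     massoc := fun x y z =>
       (massoc (fst x) (fst y) (fst z), massoc (snd x) (snd y) (snd z));
     massocV := fun x y z =>
       (massocV (fst x) (fst y) (fst z), massocV (snd x) (snd y) (snd z));
     mlun := fun x => (mlun (fst x), mlun (snd x));
     mlunV := fun x => (mlunV (fst x), mlunV (snd x));
     mrun := fun x => (mrun (fst x), mrun (snd x));
     mrunV := fun x => (mrunV (fst x), mrunV (snd x)) |}.

Definition prodBr (A B : brData) : brData :=
  {| br_mon := prodMon A B;
     braid := fun x y : prodMon A B =>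
       (braid (fst x) (fst y), braid (snd x) (snd y)) |}.

Definition prodMonFun (A A' B B' : monData) (F : monFunData A B) (G : monFunData A' B') :
    monFunData (prodMon A A') (prodMon B B') :=
  {| fob := fun x : prodMon A A' => (F (fst x), G (snd x)) : prodMon B B';
     fmor := fun _ _ f => (fmor F (fst f), fmor G (snd f));
     fmu := fun x y => (fmu F (fst x) (fst y), fmu G (snd x) (snd y));
     feps := (feps F, feps G) |}.

Definition assocMonFun (A B C : monData) :
    monFunData (prodMon (prodMon A B) C) (prodMon A (prodMon B C)) :=
  {| fob := fun x : prodMon (prodMon A B) C =>
       (fst (fst x), (snd (fst x), snd x)) : prodMon A (prodMon B C);
     fmor := fun _ _ f => (fst (fst f), (snd (fst f), snd f));
     fmu := fun x y => idm _;
     feps := idm _ |}.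

Definition swapMonFun (A B : monData) : monFunData (prodMon A B) (prodMon B A) :=
  {| fob := fun x : prodMon A B => (snd x, fst x) : prodMon B A;
     fmor := fun _ _ f => (snd f, fst f);
     fmu := fun x y => idm _;
     feps := idm _ |}.

Definition fstMonFun (A B : monData) : monFunData (prodMon A B) A :=
  {| fob := fun x : prodMon A B => fst x;
     fmor := fun _ _ f => fst f;
     fmu := fun x y => idm _;
     feps := idm _ |}.

Definition sndMonFun (A B : monData) : monFunData (prodMon A B) B :=
  {| fob := fun x : prodMon A B => snd x;
     fmor := fun _ _ f => snd f;
     fmu := fun x y => idm _;
     feps := idm _ |}.

Definition tensorMonFun (A : brData) : monFunData (prodMon A A) A :=
  {| fob := fun x : prodMon A A => fst x ⊗ snd x;
     fmor := fun _ _ f => fst f ⊠ snd f;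
     fmu := fun x y => midswap (fst x) (snd x) (fst y) (snd y);
     feps := mlunV mone |}.

Definition unitMonFun (A : monData) : monFunData unitMon A :=
  {| fob := fun _ : unitMon => mone;
     fmor := fun _ _ _ => idm mone;
     fmu := fun _ _ => mlun mone;
     feps := idm mone |}.

Record ecatData (A : monData) := EcatData {
  eob :> Type;
  ehom : eob -> eob -> A;
  eid : forall x, hom mone (ehom x x);
  ecmp : forall x y z, hom (ehom y z ⊗ ehom x y) (ehom x z) }.

Arguments ehom {A e} x y.
Arguments eid {A e} x.
Arguments ecmp {A e} x y z.

Record is_ecat (A : monData) (L : ecatData A) : Prop := {
  ecat_assoc : forall w x y z : L,
    ecmp w y z ∘ (idm (ehom y z) ⊠ ecmp w x y)
      ∘ massoc (ehom y z) (ehom x y) (ehom w x)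
    = ecmp w x z ∘ (ecmp x y z ⊠ idm (ehom w x));
  ecat_idl : forall x y : L,
    ecmp x y y ∘ (eid y ⊠ idm (ehom x y)) = mlun (ehom x y);
  ecat_idr : forall x y : L,
    ecmp x x y ∘ (idm (ehom x y) ⊠ eid x) = mrun (ehom x y) }.

Definition underCat (A : monData) (L : ecatData A) : catData :=
  {| ob := L;
     hom := fun x y => hom mone (ehom x y);
     idm := fun x => eid x;
     cmp := fun x y z g f => ecmp x y z ∘ (g ⊠ f) ∘ mlunV mone |}.

(* L(w,f) : L(w,x) -> L(w,y) and L(f,w) : L(y,w) -> L(x,w), for f : x -> y in
   the underlying category. *)
Definition postcomp (A : monData) (L : ecatData A) (w : L) (x y : underCat L)
    (f : hom x y) : hom (ehom w x) (ehom w y) :=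
  ecmp w x y ∘ (f ⊠ idm (ehom w x)) ∘ mlunV (ehom w x).

Definition precomp (A : monData) (L : ecatData A) (x y : underCat L)
    (f : hom x y) (w : L) : hom (ehom y w) (ehom x w) :=
  ecmp x y w ∘ (idm (ehom y w) ⊠ f) ∘ mrunV (ehom y w).

Arguments postcomp {A L} w {x y} f.
Arguments precomp {A L x y} f w.

Record efunData (A B : monData) (L : ecatData A) (M : ecatData B) := EfunData {
  ef_bg : monFunData A B;
  ef_ob :> L -> M;
  ef_hom : forall x y : L, hom (ef_bg (ehom x y)) (ehom (ef_ob x) (ef_ob y)) }.

Arguments ef_bg {A B L M} e.
Arguments ef_hom {A B L M} e x y.

Record is_efun (A B : monData) (L : ecatData A) (M : ecatData B) (F : efunData L M) :
    Prop := {
  efun_lax : is_lax (ef_bg F);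
  efun_id : forall x : L,
    ef_hom F x x ∘ fmor (ef_bg F) (eid x) ∘ feps (ef_bg F) = eid (F x);
  efun_cmp : forall x y z : L,
    ef_hom F x z ∘ fmor (ef_bg F) (ecmp x y z) ∘ fmu (ef_bg F) (ehom y z) (ehom x y)
    = ecmp (F x) (F y) (F z) ∘ (ef_hom F y z ⊠ ef_hom F x y) }.

Definition under_mor (A B : monData) (L : ecatData A) (M : ecatData B)
    (F : efunData L M) (x y : underCat L) (f : hom x y) :
    hom (c := underCat M) (F x) (F y) :=
  ef_hom F x y ∘ fmor (ef_bg F) f ∘ feps (ef_bg F).

Arguments under_mor {A B L M} F {x y} f.

Record enatData (A B : monData) (L : ecatData A) (M : ecatData B) (F G : efunData L M) :=
  EnatData {
    en_bg : forall a : A, hom (ef_bg F a) (ef_bg G a);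
    en_cmp : forall x : L, hom (c := underCat M) (F x) (G x) }.

Arguments EnatData {A B L M} F G en_bg en_cmp.
Arguments en_bg {A B L M F G} e a.
Arguments en_cmp {A B L M F G} e x.

Record is_enat (A B : monData) (L : ecatData A) (M : ecatData B) (F G : efunData L M)
    (t : enatData F G) : Prop := {
  enat_monnat : is_monnat (ef_bg F) (ef_bg G) (en_bg t);
  enat_law : forall x y : L,
    postcomp (F x) (en_cmp t y) ∘ ef_hom F x y
    = precomp (en_cmp t x) (G y) ∘ ef_hom G x y ∘ en_bg t (ehom x y) }.

Definition enat_eq (A B : monData) (L : ecatData A) (M : ecatData B) (F G : efunData L M)
    (s t : enatData F G) : Prop :=
  (forall a : A, en_bg s a = en_bg t a) /\ (forall x : L, en_cmp s x = en_cmp t x).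

Definition idEfun (A : monData) (L : ecatData A) : efunData L L :=
  {| ef_bg := idMonFun A; ef_ob := fun x => x; ef_hom := fun x y => idm (ehom x y) |}.

Definition compEfun (A B C : monData) (L : ecatData A) (M : ecatData B) (N : ecatData C)
    (G : efunData M N) (F : efunData L M) : efunData L N :=
  {| ef_bg := compMonFun (ef_bg G) (ef_bg F);
     ef_ob := fun x => G (F x);
     ef_hom := fun x y => ef_hom G (F x) (F y) ∘ fmor (ef_bg G) (ef_hom F x y) |}.

Definition idEnat (A B : monData) (L : ecatData A) (M : ecatData B) (F : efunData L M) :
    enatData F F :=
  EnatData F F (fun a => idm (ef_bg F a)) (fun x => eid (F x)).

Definition vcomp (A B : monData) (L : ecatData A) (M : ecatData B) (F G H : efunData L M)
    (t : enatData G H) (s : enatData F G) : enatData F H :=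
  EnatData F H (fun a => en_bg t a ∘ en_bg s a)
               (fun x => cmp (c := underCat M) (en_cmp t x) (en_cmp s x)).

Definition whiskerL (A B C : monData) (L : ecatData A) (M : ecatData B) (N : ecatData C)
    (H : efunData M N) (F G : efunData L M) (t : enatData F G) :
    enatData (compEfun H F) (compEfun H G) :=
  EnatData (compEfun H F) (compEfun H G)
    (fun a => fmor (ef_bg H) (en_bg t a)) (fun x => under_mor H (en_cmp t x)).

Definition whiskerR (A B C : monData) (L : ecatData A) (M : ecatData B) (N : ecatData C)
    (F G : efunData M N) (t : enatData F G) (H : efunData L M) :
    enatData (compEfun F H) (compEfun G H) :=
  EnatData (compEfun F H) (compEfun G H)
    (fun a => en_bg t (ef_bg H a)) (fun x => en_cmp t (H x)).

Arguments whiskerL {A B C L M N} H {F G} t.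
Arguments whiskerR {A B C L M N F G} t H.

Definition is_enatiso (A B : monData) (L : ecatData A) (M : ecatData B)
    (F G : efunData L M) (t : enatData F G) : Prop :=
  is_enat t /\ exists s : enatData G F,
    is_enat s /\ enat_eq (vcomp s t) (idEnat F) /\ enat_eq (vcomp t s) (idEnat G).

Definition unitEcat : ecatData unitMon :=
  @EcatData unitMon unit (fun _ _ => tt) (fun _ => tt) (fun _ _ _ => tt).

Definition prodEcat (A B : monData) (L : ecatData A) (M : ecatData B) :
    ecatData (prodMon A B) :=
  @EcatData (prodMon A B) (L * M)
    (fun x y => (ehom (fst x) (fst y), ehom (snd x) (snd y)))
    (fun x => (eid (fst x), eid (snd x)))
    (fun x y z => (ecmp (fst x) (fst y) (fst z), ecmp (snd x) (snd y) (snd z))).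

Definition prodEfun (A A' B B' : monData) (L : ecatData A) (L' : ecatData A')
    (M : ecatData B) (M' : ecatData B') (F : efunData L M) (G : efunData L' M') :
    efunData (prodEcat L L') (prodEcat M M') :=
  @EfunData _ _ (prodEcat L L') (prodEcat M M') (prodMonFun (ef_bg F) (ef_bg G))
    (fun x => (F (fst x), G (snd x)))
    (fun x y => (ef_hom F (fst x) (fst y), ef_hom G (snd x) (snd y))).

Definition prodEnat (A A' B B' : monData) (L : ecatData A) (L' : ecatData A')
    (M : ecatData B) (M' : ecatData B') (F G : efunData L M) (F' G' : efunData L' M')
    (t : enatData F G) (t' : enatData F' G') : enatData (prodEfun F F') (prodEfun G G') :=
  EnatData (prodEfun F F') (prodEfun G G')
    (fun a => (en_bg t (fst a), en_bg t' (snd a)))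
    (fun x => (en_cmp t (fst x), en_cmp t' (snd x))).

Definition assocEfun (A B C : monData) (L : ecatData A) (M : ecatData B) (N : ecatData C) :
    efunData (prodEcat (prodEcat L M) N) (prodEcat L (prodEcat M N)) :=
  @EfunData _ _ (prodEcat (prodEcat L M) N) (prodEcat L (prodEcat M N))
    (assocMonFun A B C)
    (fun x => (fst (fst x), (snd (fst x), snd x)))
    (fun x y => idm _).

Definition swapEfun (A B : monData) (L : ecatData A) (M : ecatData B) :
    efunData (prodEcat L M) (prodEcat M L) :=
  @EfunData _ _ (prodEcat L M) (prodEcat M L) (swapMonFun A B)
    (fun x => (snd x, fst x)) (fun x y => idm _).

Definition fstEfun (A B : monData) (L : ecatData A) (M : ecatData B) :
    efunData (prodEcat L M) L :=
  @EfunData _ _ (prodEcat L M) L (fstMonFun A B) (fun x => fst x) (fun x y => idm _).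

Definition sndEfun (A B : monData) (L : ecatData A) (M : ecatData B) :
    efunData (prodEcat L M) M :=
  @EfunData _ _ (prodEcat L M) M (sndMonFun A B) (fun x => snd x) (fun x y => idm _).

Arguments fstEfun {A B} L M.
Arguments sndEfun {A B} L M.
Arguments swapEfun {A B} L M.
Arguments assocEfun {A B C} L M N.
Arguments idEfun {A} L.
Arguments idEnat {A B L M} F.

(* The components of the associator and unitors (and their inverses) are
   morphisms 1 -> L(-,-), i.e. morphisms of the underlying category. *)
Record emonData (A : brData) := EmonData {
  em_ecat :> ecatData A;
  em_one : em_ecat;
  em_tob : em_ecat -> em_ecat -> em_ecat;
  em_thom : forall x x' y y' : em_ecat,
    hom (ehom x x' ⊗ ehom y y') (ehom (em_tob x y) (em_tob x' y'));
  em_assoc : forall x y z,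
    hom mone (ehom (em_tob (em_tob x y) z) (em_tob x (em_tob y z)));
  em_assocV : forall x y z,
    hom mone (ehom (em_tob x (em_tob y z)) (em_tob (em_tob x y) z));
  em_lun : forall x, hom mone (ehom (em_tob em_one x) x);
  em_lunV : forall x, hom mone (ehom x (em_tob em_one x));
  em_run : forall x, hom mone (ehom (em_tob x em_one) x);
  em_runV : forall x, hom mone (ehom x (em_tob x em_one)) }.

Arguments em_one {A e}.
Arguments em_tob {A e} x y.
Arguments em_thom {A e} x x' y y'.
Arguments em_assoc {A e} x y z.
Arguments em_assocV {A e} x y z.
Arguments em_lun {A e} x.
Arguments em_lunV {A e} x.
Arguments em_run {A e} x.
Arguments em_runV {A e} x.

Definition tensorEfun (A : brData) (L : emonData A) : efunData (prodEcat L L) L :=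
  @EfunData _ _ (prodEcat L L) L (tensorMonFun A)
    (fun x => em_tob (fst x) (snd x))
    (fun x y => em_thom (fst x) (fst y) (snd x) (snd y)).

Definition unitEfun (A : brData) (L : emonData A) : efunData unitEcat L :=
  @EfunData _ _ unitEcat L (unitMonFun A) (fun _ => em_one) (fun _ _ => eid em_one).

Arguments tensorEfun {A} L.
Arguments unitEfun {A} L.

Definition underMon (A : brData) (L : emonData A) : monData :=
  {| mon_cat := underCat L;
     mone := em_one : underCat L;
     tob := em_tob;
     tmor := fun x x' y y' f g =>
       under_mor (tensorEfun L) (x := (x, y)) (y := (x', y')) (f, g);
     massoc := em_assoc;
     massocV := em_assocV;
     mlun := em_lun;
     mlunV := em_lunV;
     mrun := em_run;
     mrunV := em_runV |}.

Definition assocEnat (A : brData) (L : emonData A) :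
    enatData (compEfun (tensorEfun L) (prodEfun (tensorEfun L) (idEfun L)))
             (compEfun (compEfun (tensorEfun L) (prodEfun (idEfun L) (tensorEfun L)))
                       (assocEfun L L L)) :=
  EnatData (compEfun (tensorEfun L) (prodEfun (tensorEfun L) (idEfun L)))
           (compEfun (compEfun (tensorEfun L) (prodEfun (idEfun L) (tensorEfun L)))
                     (assocEfun L L L))
    (fun a => massoc (fst (fst a)) (snd (fst a)) (snd a))
    (fun x => em_assoc (fst (fst x)) (snd (fst x)) (snd x)).

Definition lunEnat (A : brData) (L : emonData A) :
    enatData (compEfun (tensorEfun L) (prodEfun (unitEfun L) (idEfun L)))
             (sndEfun unitEcat L) :=
  EnatData (compEfun (tensorEfun L) (prodEfun (unitEfun L) (idEfun L)))
           (sndEfun unitEcat L)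
    (fun a => mlun (snd a)) (fun x => em_lun (snd x)).

Definition runEnat (A : brData) (L : emonData A) :
    enatData (compEfun (tensorEfun L) (prodEfun (idEfun L) (unitEfun L)))
             (fstEfun L unitEcat) :=
  EnatData (compEfun (tensorEfun L) (prodEfun (idEfun L) (unitEfun L)))
           (fstEfun L unitEcat)
    (fun a => mrun (fst a)) (fun x => em_run (fst x)).

Arguments assocEnat {A} L.
Arguments lunEnat {A} L.
Arguments runEnat {A} L.

Record is_emon (A : brData) (L : emonData A) : Prop := {
  emon_bg : is_braided A;
  emon_ecat : is_ecat L;
  emon_tensor : is_efun (tensorEfun L);
  emon_assoc : is_enatiso (assocEnat L);
  emon_lun : is_enatiso (lunEnat L);
  emon_run : is_enatiso (runEnat L);
  emon_under : is_monoidal (underMon L) }.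

Record emonFunData (A B : brData) (L : emonData A) (M : emonData B) := EmonFunData {
  emf_efun :> efunData L M;
  emf_two : forall x y : L,
    hom (c := underCat M) (em_tob (emf_efun x) (emf_efun y)) (emf_efun (em_tob x y));
  emf_zero : hom (c := underCat M) em_one (emf_efun em_one) }.

Arguments emf_two {A B L M} e x y.
Arguments emf_zero {A B L M} e.

Definition underMonFun (A B : brData) (L : emonData A) (M : emonData B)
    (F : emonFunData L M) : monFunData (underMon L) (underMon M) :=
  @MonFunData (underMon L) (underMon M) F (@under_mor _ _ _ _ F)
    (emf_two F) (emf_zero F).

Definition twoEnat (A B : brData) (L : emonData A) (M : emonData B) (F : emonFunData L M) :
    enatData (compEfun (tensorEfun M) (prodEfun F F)) (compEfun F (tensorEfun L)) :=
  EnatData (compEfun (tensorEfun M) (prodEfun F F)) (compEfun F (tensorEfun L))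
    (fun a => fmu (ef_bg F) (fst a) (snd a)) (fun x => emf_two F (fst x) (snd x)).

Definition zeroEnat (A B : brData) (L : emonData A) (M : emonData B) (F : emonFunData L M) :
    enatData (unitEfun M) (compEfun F (unitEfun L)) :=
  EnatData (unitEfun M) (compEfun F (unitEfun L))
    (fun _ => feps (ef_bg F)) (fun _ => emf_zero F).

Record is_emonfun (A B : brData) (L : emonData A) (M : emonData B) (F : emonFunData L M) :
    Prop := {
  emonfun_efun : is_efun F;
  emonfun_bg : is_brfun (ef_bg F);
  emonfun_two : is_enatiso (twoEnat F);
  emonfun_zero : is_enatiso (zeroEnat F);
  emonfun_under : is_strong (underMonFun F) }.

Record is_emonnat (A B : brData) (L : emonData A) (M : emonData B) (F G : emonFunData L M)
    (t : enatData F G) : Prop := {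
  emonnat_enat : is_enat t;
  emonnat_under : is_monnat (underMonFun F) (underMonFun G) (en_cmp t) }.

Arguments is_emonnat {A B L M} F G t.

Definition is_emonnatiso (A B : brData) (L : emonData A) (M : emonData B)
    (F G : emonFunData L M) (t : enatData F G) : Prop :=
  is_emonnat F G t /\ exists s : enatData G F,
    is_emonnat G F s /\ enat_eq (vcomp s t) (idEnat F) /\ enat_eq (vcomp t s) (idEnat G).

Arguments is_emonnatiso {A B L M} F G t.

Definition idEmonFun (A : brData) (L : emonData A) : emonFunData L L :=
  @EmonFunData _ _ L L (idEfun L)
    (fun x y => eid (em_tob x y)) (eid em_one).

Definition compEmonFun (A B C : brData) (L : emonData A) (M : emonData B) (N : emonData C)
    (G : emonFunData M N) (F : emonFunData L M) : emonFunData L N :=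
  @EmonFunData _ _ L N (compEfun G F)
    (fun x y => cmp (c := underCat N) (under_mor G (emf_two F x y)) (emf_two G (F x) (F y)))
    (cmp (c := underCat N) (under_mor G (emf_zero F)) (emf_zero G)).

Arguments idEmonFun {A} L.

Record ebrData := EbrData {
  ebr_bg : brData;
  ebr_emon :> emonData ebr_bg;
  ebr_braid : forall x y : ebr_emon, hom mone (ehom (em_tob x y) (em_tob y x)) }.

Arguments ebr_braid {e} x y.

Definition underBr (L : ebrData) : brData :=
  {| br_mon := underMon L; braid := ebr_braid |}.

Definition braidEnat (L : ebrData) :
    enatData (tensorEfun L) (compEfun (tensorEfun L) (swapEfun L L)) :=
  EnatData (tensorEfun L) (compEfun (tensorEfun L) (swapEfun L L))
    (fun a => braid (fst a) (snd a)) (fun x => ebr_braid (fst x) (snd x)).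

Record is_ebr (L : ebrData) : Prop := {
  ebr_bg_sym : is_symmetric (ebr_bg L);
  ebr_is_emon : is_emon L;
  ebr_braid_enat : is_enatiso (braidEnat L);
  ebr_under : is_braided (underBr L) }.

(* Enriched braided monoidal categories form a 2-category with 1-morphisms
   [is_ebrfun] and 2-morphisms [is_emonnat]. *)
Record is_ebrfun (L M : ebrData) (F : emonFunData L M) : Prop := {
  ebrfun_emon : is_emonfun F;
  ebrfun_under : is_brfun (A := underBr L) (B := underBr M) (underMonFun F) }.

Arguments is_ebrfun {L M} F.

Definition unitEmon : emonData unitBr :=
  @EmonData unitBr unitEcat tt (fun _ _ => tt) (fun _ _ _ _ => tt)
    (fun _ _ _ => tt) (fun _ _ _ => tt) (fun _ => tt) (fun _ => tt)
    (fun _ => tt) (fun _ => tt).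

Definition unitEbr : ebrData := @EbrData unitBr unitEmon (fun _ _ => tt).

Definition prodEmon (A B : brData) (L : emonData A) (M : emonData B) :
    emonData (prodBr A B) :=
  @EmonData (prodBr A B) (prodEcat L M)
    (em_one, em_one)
    (fun x y => (em_tob (fst x) (fst y), em_tob (snd x) (snd y)))
    (fun x x' y y' => (em_thom (fst x) (fst x') (fst y) (fst y'),
                       em_thom (snd x) (snd x') (snd y) (snd y')))
    (fun x y z => (em_assoc (fst x) (fst y) (fst z), em_assoc (snd x) (snd y) (snd z)))
    (fun x y z => (em_assocV (fst x) (fst y) (fst z), em_assocV (snd x) (snd y) (snd z)))
    (fun x => (em_lun (fst x), em_lun (snd x)))
    (fun x => (em_lunV (fst x), em_lunV (snd x)))
    (fun x => (em_run (fst x), em_run (snd x)))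
    (fun x => (em_runV (fst x), em_runV (snd x))).

Definition prodEbr (L M : ebrData) : ebrData :=
  @EbrData (prodBr (ebr_bg L) (ebr_bg M)) (prodEmon L M)
    (fun x y => (ebr_braid (fst x) (fst y), ebr_braid (snd x) (snd y))).

Definition prodEmonFun (A A' B B' : brData) (L : emonData A) (L' : emonData A')
    (M : emonData B) (M' : emonData B') (F : emonFunData L M) (G : emonFunData L' M') :
    emonFunData (prodEmon L L') (prodEmon M M') :=
  @EmonFunData _ _ (prodEmon L L') (prodEmon M M') (prodEfun F G)
    (fun x y => (emf_two F (fst x) (fst y), emf_two G (snd x) (snd y)))
    (emf_zero F, emf_zero G).

Definition lunitor (A : brData) (L : emonData A) : emonFunData (prodEmon unitEmon L) L :=
  @EmonFunData _ _ (prodEmon unitEmon L) L (sndEfun unitEcat L)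
    (fun x y => eid (em_tob (snd x) (snd y))) (eid em_one).

Arguments lunitor {A} L.

Record actData (X : ebrData) := ActData {
  act_A : ebrData;
  act_u : emonFunData unitEbr act_A;
  act_g : emonFunData (prodEbr act_A X) X;
  act_alpha : enatData (compEmonFun act_g (prodEmonFun act_u (idEmonFun X))) (lunitor X) }.

Arguments act_A {X} a.
Arguments act_u {X} a.
Arguments act_g {X} a.
Arguments act_alpha {X} a.

Record is_act (X : ebrData) (S : actData X) : Prop := {
  act_A_ebr : is_ebr (act_A S);
  act_u_ebr : is_ebrfun (act_u S);
  act_g_ebr : is_ebrfun (act_g S);
  act_alpha_iso :
    is_emonnatiso (compEmonFun (act_g S) (prodEmonFun (act_u S) (idEmonFun X)))
                  (lunitor X) (act_alpha S) }.

Record act1Data (X : ebrData) (S T : actData X) := Act1Data {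
  act1_p : emonFunData (act_A S) (act_A T);
  act1_sigma : enatData (act_u T) (compEmonFun act1_p (act_u S));
  act1_rho :
    enatData (compEmonFun (act_g T) (prodEmonFun act1_p (idEmonFun X))) (act_g S) }.

Arguments act1_p {X S T} a.
Arguments act1_sigma {X S T} a.
Arguments act1_rho {X S T} a.

(* The two bracketings of the composite g2 (p × 1) (u1 × 1) agree on objects, so
   the coherence isomorphism between them has identity components. *)
Definition act_coh (X : ebrData) (S T : actData X) (p : emonFunData (act_A S) (act_A T)) :
    enatData
      (compEfun (act_g T) (prodEfun (compEmonFun p (act_u S)) (idEfun X)))
      (compEfun (compEfun (act_g T) (prodEfun p (idEfun X)))
                (prodEfun (act_u S) (idEfun X))) :=
  EnatData
    (compEfun (act_g T) (prodEfun (compEmonFun p (act_u S)) (idEfun X)))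
    (compEfun (compEfun (act_g T) (prodEfun p (idEfun X)))
              (prodEfun (act_u S) (idEfun X)))
    (fun a => idm _)
    (fun x => idm (c := underCat X) _).

Record is_act1 (X : ebrData) (S T : actData X) (f : act1Data S T) : Prop := {
  act1_p_ebr : is_ebrfun (act1_p f);
  act1_sigma_iso :
    is_emonnatiso (act_u T) (compEmonFun (act1_p f) (act_u S)) (act1_sigma f);
  act1_rho_iso :
    is_emonnatiso (compEmonFun (act_g T) (prodEmonFun (act1_p f) (idEmonFun X)))
                  (act_g S) (act1_rho f);
  act1_law :
    enat_eq
      (vcomp (act_alpha S)
        (vcomp (whiskerR (act1_rho f) (prodEfun (act_u S) (idEfun X)))
          (vcomp (act_coh (act1_p f))
            (whiskerL (act_g T) (prodEnat (act1_sigma f) (idEnat (idEfun X)))))))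
      (act_alpha T) }.

Record is_act2 (X : ebrData) (S T : actData X) (f h : act1Data S T)
    (xi : enatData (act1_p f) (act1_p h)) : Prop := {
  act2_nat : is_emonnat (act1_p f) (act1_p h) xi;
  act2_sigma : enat_eq (vcomp (whiskerR xi (act_u S)) (act1_sigma f)) (act1_sigma h);
  act2_rho :
    enat_eq
      (vcomp (act1_rho h)
        (whiskerL (act_g T) (prodEnat xi (idEnat (idEfun X)))))
      (act1_rho f) }.

Arguments is_act2 {X S T} f h xi.

(* T is terminal in the 2-category of left unital actions on X, taken in the
   monoidal 2-category of enriched braided monoidal categories: every hom category
   into T is a contractible groupoid. *)
Definition is_E0_center (X : ebrData) (T : actData X) : Prop :=
  is_act T /\
  forall S : actData X, is_act S ->
    (exists f : act1Data S T, is_act1 f) /\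
    (forall f h : act1Data S T, is_act1 f -> is_act1 h ->
       (exists xi : enatData (act1_p f) (act1_p h), is_act2 f h xi) /\
       (forall xi zeta : enatData (act1_p f) (act1_p h),
          is_act2 f h xi -> is_act2 f h zeta -> enat_eq xi zeta)).

(* Enriched braided monoidal categories are the E_2-algebras in enriched
   categories. *)
Definition is_E2_center (X : ebrData) (T : actData X) : Prop := is_E0_center T.

Lemma cmp_assoc_eq (A : monData) (HA : is_monoidal A) (w x y z : A)
    (h : hom y z) (g : hom x y) (f : hom w x) : h ∘ (g ∘ f) = h ∘ g ∘ f.
Proof. apply (cat_assoc (mon_is_cat HA)). Qed.

Lemma lun_cancel (A : monData) (HA : is_monoidal A) (a b : A) (f g : hom a b) :
  idm mone ⊠ f = idm mone ⊠ g -> f = g.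
Proof.
  intro H.
  assert (E : f ∘ mlun a = g ∘ mlun a).
  { rewrite <- !(mon_lun_nat HA), H. reflexivity. }
  apply (f_equal (fun k => k ∘ mlunV a)) in E.
  rewrite <- !(cmp_assoc_eq HA), !(proj2 (mon_lun_inv HA a)),
    !(cat_idr (mon_is_cat HA)) in E.
  exact E.
Qed.

Lemma run_cancel (A : monData) (HA : is_monoidal A) (a b : A) (f g : hom a b) :
  f ⊠ idm mone = g ⊠ idm mone -> f = g.
Proof.
  intro H.
  assert (E : f ∘ mrun a = g ∘ mrun a).
  { rewrite <- !(mon_run_nat HA), H. reflexivity. }
  apply (f_equal (fun k => k ∘ mrunV a)) in E.
  rewrite <- !(cmp_assoc_eq HA), !(proj2 (mon_run_inv HA a)),
    !(cat_idr (mon_is_cat HA)) in E.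
  exact E.
Qed.

Lemma iso_cancel_l (A : monData) (HA : is_monoidal A) (a b c : A) (i : hom b c)
    (f g : hom a b) : is_iso i -> i ∘ f = i ∘ g -> f = g.
Proof.
  intros [j [Hj _]] H. apply (f_equal (fun k => j ∘ k)) in H.
  rewrite !(cmp_assoc_eq HA), Hj, !(cat_idl (mon_is_cat HA)) in H. exact H.
Qed.

Lemma iso_cancel_r (A : monData) (HA : is_monoidal A) (a b c : A) (i : hom a b)
    (f g : hom b c) : is_iso i -> f ∘ i = g ∘ i -> f = g.
Proof.
  intros [j [_ Hj]] H. apply (f_equal (fun k => k ∘ j)) in H.
  rewrite <- !(cmp_assoc_eq HA), Hj, !(cat_idr (mon_is_cat HA)) in H. exact H.
Qed.

Lemma assoc_is_iso (A : monData) (HA : is_monoidal A) (a b c : A) :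
  is_iso (massoc a b c).
Proof. exists (massocV a b c). apply (mon_assoc_inv HA). Qed.

Lemma kelly_run (A : monData) (HA : is_monoidal A) (a b : A) :
  (idm a ⊠ mrun b) ∘ massoc a b mone = mrun (a ⊗ b).
Proof.
  apply (run_cancel HA).
  apply (iso_cancel_l HA (assoc_is_iso HA a b mone)).
  rewrite <- (mon_triangle HA (a ⊗ b) mone).
  rewrite <- (mon_tid HA a b).
  rewrite (cmp_assoc_eq HA), (mon_assoc_nat HA).
  rewrite <- (cmp_assoc_eq HA), (mon_pentagon HA a b mone mone).
  rewrite !(cmp_assoc_eq HA), <- (mon_tcmp HA), (cat_idl (mon_is_cat HA)).
  rewrite (mon_triangle HA b mone), <- (mon_assoc_nat HA), <- (cmp_assoc_eq HA).
  rewrite <- (mon_tcmp HA), (cat_idl (mon_is_cat HA)). reflexivity.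
Qed.

Lemma kelly_lun (A : monData) (HA : is_monoidal A) (a b : A) :
  mlun (a ⊗ b) ∘ massoc mone a b = mlun a ⊠ idm b.
Proof.
  apply (lun_cancel HA).
  apply (iso_cancel_r HA (assoc_is_iso HA mone (mone ⊗ a) b)).
  assert (Hi : is_iso (massoc mone mone a ⊠ idm b)).
  { exists (massocV mone mone a ⊠ idm b).
    destruct (mon_assoc_inv HA mone mone a) as [H1 H2].
    split; rewrite <- (mon_tcmp HA), ?H1, ?H2, (cat_idl (mon_is_cat HA));
      apply (mon_tid HA). }
  apply (iso_cancel_r HA Hi).
  transitivity (massoc mone a b ∘ (mrun mone ⊠ idm a ⊠ idm b)).
  - rewrite (mon_assoc_nat HA), (mon_tid HA), <- (mon_triangle HA).
    assert (E : idm mone ⊠ (mlun (a ⊗ b) ∘ massoc mone a b)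
                = (idm mone ⊠ mlun (a ⊗ b)) ∘ (idm mone ⊠ massoc mone a b)).
    { rewrite <- (mon_tcmp HA), (cat_idl (mon_is_cat HA)). reflexivity. }
    rewrite E, <- !(cmp_assoc_eq HA).
    rewrite (mon_pentagon HA mone mone a b), <- !(cmp_assoc_eq HA). reflexivity.
  - rewrite <- (mon_assoc_nat HA), <- (cmp_assoc_eq HA), <- (mon_tcmp HA),
      (cat_idl (mon_is_cat HA)), (mon_triangle HA). reflexivity.
Qed.

Lemma run_braid (A : brData) (HA : is_braided A) (c : A) :
  mrun c ∘ braid mone c = mlun c.
Proof.
  pose proof (br_is_mon HA) as HM.
  apply (lun_cancel HM).
  apply (iso_cancel_l HM (br_iso HA mone c)).
  pose proof (f_equal (fun k => mrun (c ⊗ mone) ∘ k) (br_hex2 HA mone mone c)) as H.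
  cbv beta in H.
  assert (K : forall a b : A, mrun (a ⊗ b) ∘ massocV a b mone = idm a ⊠ mrun b).
  { intros a b. rewrite <- (kelly_run HM), <- (cmp_assoc_eq HM).
    rewrite (proj2 (mon_assoc_inv HM a b mone)). apply (cat_idr (mon_is_cat HM)). }
  rewrite !(cmp_assoc_eq HM), K, <- (br_nat HA) in H.
  rewrite (mon_run_nat HM) in H.
  rewrite <- (mon_triangle HM mone c) in H.
  rewrite <- !(cmp_assoc_eq HM) in H.
  rewrite (proj2 (mon_assoc_inv HM mone mone c)), (cat_idr (mon_is_cat HM)) in H.
  rewrite (cmp_assoc_eq HM _ (massocV mone c mone)), K, <- (mon_tcmp HM),
    (cat_idl (mon_is_cat HM)) in H.
  symmetry; exact H.
Qed.

Lemma lun_braid (A : brData) (HA : is_braided A) (a : A) :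
  mlun a ∘ braid a mone = mrun a.
Proof.
  pose proof (br_is_mon HA) as HM.
  apply (run_cancel HM).
  apply (iso_cancel_l HM (br_iso HA a mone)).
  pose proof (f_equal (fun k => mlun (mone ⊗ a) ∘ k) (br_hex1 HA a mone mone)) as H.
  cbv beta in H.
  rewrite !(cmp_assoc_eq HM), (kelly_lun HM), <- (br_nat HA) in H.
  rewrite <- (cmp_assoc_eq HM), (mon_triangle HM) in H.
  rewrite (mon_lun_nat HM) in H.
  rewrite <- !(cmp_assoc_eq HM), (cmp_assoc_eq HM (mlun _)), (kelly_lun HM) in H.
  rewrite <- (mon_tcmp HM), (cat_idl (mon_is_cat HM)) in H.
  symmetry; exact H.
Qed.

Lemma transparent_one (A : brData) (HA : is_braided A) : transparent A mone.
Proof.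
  intro y. pose proof (br_is_mon HA) as HM.
  assert (Hi : is_iso (mlun y)) by (exists (mlunV y); apply (mon_lun_inv HM)).
  apply (iso_cancel_l HM Hi).
  rewrite (cmp_assoc_eq HM), (lun_braid HA), (run_braid HA).
  symmetry; apply (cat_idr (mon_is_cat HM)).
Qed.

Lemma transparent_tob (A : brData) (HA : is_braided A) (x y : A) :
  transparent A x -> transparent A y -> transparent A (x ⊗ y).
Proof.
  intros Hx Hy z. pose proof (br_is_mon HA) as HM.
  assert (HiV : forall a b c : A, is_iso (massocV a b c)).
  { intros a b c. exists (massoc a b c).
    destruct (mon_assoc_inv HM a b c); split; assumption. }
  apply (iso_cancel_l HM (assoc_is_iso HM x y z)).
  apply (iso_cancel_r HM (HiV x y z)).
  assert (E : braid z (x ⊗ y) = braid z (x ⊗ y) ∘ (massoc z x y ∘ massocV z x y)).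
  { rewrite (proj2 (mon_assoc_inv HM z x y)). symmetry; apply (cat_idr (mon_is_cat HM)). }
  rewrite E, !(cmp_assoc_eq HM), (br_hex1 HA z x y).
  rewrite <- (cmp_assoc_eq HM _ (massocV z x y)), <- (cmp_assoc_eq HM _ (massocV z x y ∘ _)).
  rewrite (br_hex2 HA x y z).
  rewrite <- !(cmp_assoc_eq HM), (cmp_assoc_eq HM (braid z x ⊠ _)), <- (mon_tcmp HM).
  rewrite (Hx z), (cat_idl (mon_is_cat HM)), (mon_tid HM), (cat_idl (mon_is_cat HM)).
  rewrite (cmp_assoc_eq HM (massoc x z y)), (proj2 (mon_assoc_inv HM x z y)),
    (cat_idl (mon_is_cat HM)).
  rewrite <- (mon_tcmp HM), (Hy z), (cat_idl (mon_is_cat HM)), (mon_tid HM).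
  rewrite (cat_idl (mon_is_cat HM)). symmetry; apply (mon_assoc_inv HM).
Qed.

Definition mugerOb (M : ebrData) : Type := { x : M | transparent (underBr M) x }.

Definition mugerOne (M : ebrData) (HM : is_ebr M) : mugerOb M :=
  exist _ em_one (transparent_one (ebr_under HM)).

Definition mugerTob (M : ebrData) (HM : is_ebr M) (x y : mugerOb M) : mugerOb M :=
  exist _ (em_tob (proj1_sig x) (proj1_sig y))
    (transparent_tob (ebr_under HM) (proj2_sig x) (proj2_sig y)).

Definition mugerEcat (M : ebrData) : ecatData (ebr_bg M) :=
  @EcatData (ebr_bg M) (mugerOb M)
    (fun x y => ehom (proj1_sig x) (proj1_sig y))
    (fun x => eid (proj1_sig x))
    (fun x y z => ecmp (proj1_sig x) (proj1_sig y) (proj1_sig z)).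

Definition mugerEmon (M : ebrData) (HM : is_ebr M) : emonData (ebr_bg M) :=
  @EmonData (ebr_bg M) (mugerEcat M) (mugerOne HM) (mugerTob HM)
    (fun x x' y y' =>
       em_thom (proj1_sig x) (proj1_sig x') (proj1_sig y) (proj1_sig y'))
    (fun x y z => em_assoc (proj1_sig x) (proj1_sig y) (proj1_sig z))
    (fun x y z => em_assocV (proj1_sig x) (proj1_sig y) (proj1_sig z))
    (fun x => em_lun (proj1_sig x))
    (fun x => em_lunV (proj1_sig x))
    (fun x => em_run (proj1_sig x))
    (fun x => em_runV (proj1_sig x)).

Definition mugerCenter (M : ebrData) (HM : is_ebr M) : ebrData :=
  @EbrData (ebr_bg M) (mugerEmon HM)
    (fun x y => ebr_braid (proj1_sig x) (proj1_sig y)).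

Definition unitEmonFun (L : ebrData) : emonFunData unitEbr L :=
  @EmonFunData _ _ unitEbr L (unitEfun L) (fun _ _ => em_lun em_one) (eid em_one).

(* The tensor product of M restricted to transparent objects on the left; its
   monoidal structure is the interchange built from the braiding of M. *)
Definition mugerTensorEfun (M : ebrData) (HM : is_ebr M) :
    efunData (prodEbr (mugerCenter HM) M) M :=
  @EfunData _ _ (prodEbr (mugerCenter HM) M) M (tensorMonFun (ebr_bg M))
    (fun x => em_tob (proj1_sig (fst x)) (snd x))
    (fun x y => em_thom (proj1_sig (fst x)) (proj1_sig (fst y)) (snd x) (snd y)).

Definition mugerTensor (M : ebrData) (HM : is_ebr M) :
    emonFunData (prodEbr (mugerCenter HM) M) M :=
  @EmonFunData _ _ (prodEbr (mugerCenter HM) M) M (mugerTensorEfun HM)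
    (fun x y => midswap (A := underBr M)
       (proj1_sig (fst x)) (snd x) (proj1_sig (fst y)) (snd y))
    (em_lunV em_one).

Definition mugerAction (M : ebrData) (HM : is_ebr M) : actData M :=
  @ActData M (mugerCenter HM) (unitEmonFun (mugerCenter HM)) (mugerTensor HM)
    (EnatData
       (compEmonFun (mugerTensor HM)
          (prodEmonFun (unitEmonFun (mugerCenter HM)) (idEmonFun M)))
       (lunitor M)
       (fun a => mlun (snd a)) (fun x => em_lun (snd x))).

(* Main.v *)
From Stdlib Require Import ssreflect IndefiniteDescription.
Require Import Defs.

Set Implicit Arguments.
Unset Strict Implicit.
Unset Printing Implicit Defensive.

(** Why the Müger center is terminal among the left unital actions on M.

    Let A act on M by a braided monoidal functor g : A × M -> M, with unit
    u : * -> A and alpha : g (u, m) -> m.  Since u is isomorphic to the unit of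
    A, there is an isomorphism g (1, m) -> m.  Put P a = g (a, 1).  In A × M the
    objects (a, 1) and (1, m) have trivial double braiding, and g is braided,
    so P a has trivial double braiding with g (1, m), that is, with m: the
    functor P lands in the transparent objects ([transparent_actOn1]).
    Multiplying (a, 1) and (1, m) gives an isomorphism
      rho : P a ⊗ m -> g (a, 1) ⊗ g (1, m) -> g (a ⊗ 1, 1 ⊗ m) -> g (a, m),
    which is monoidal because the comparison of a braided functor with tensor
    products is a monoidal transformation ([fmu_monnat]).  So P, the inverse of
    alpha and rho form a 1-morphism to the Müger center ([act1_canon]).

    Let (p, sigma, r) be any 1-morphism to the Müger center, and let
      theta : p a -> p a ⊗ 1 -> g (a, 1) = P a
    be given by r at (a, 1).  As (a, m) is the product of (a, 1) and (1, m) and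
    r is monoidal, r is known from its values at these two; at (1, m) it is
    forced by the unit law of a 1-morphism.  The result is
    r = rho (theta ⊗ 1) ([theta_rho]), and similarly theta sigma is the inverse
    of alpha ([theta_sigma]).  So theta is an isomorphism from (p, sigma, r) to
    the canonical 1-morphism, and any two 1-morphisms are isomorphic
    ([act2_compare]).  A 2-morphism xi to (p', sigma', r') satisfies
    r' (xi ⊗ 1) = r, which at (a, 1) determines xi ([act2_unique]).

    This argument concerns ordinary braided monoidal categories, and it is used
    twice: for the background categories and for the underlying categories.
    What the enrichment adds is one naturality law for each transformation.
    Read on morphisms a -> M(x, y) with an arbitrary background object a as
    source, such a law says that a square commutes ([wsquare]).  These squares
    can be pasted, inverted and transported along enriched functors, so the law
    of a composite transformation is obtained by pasting the squares of its
    factors.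

    Equations between associators, unitors and braidings are proved by passing
    from X to the functor X ⊗ -, written as iterated multiplication by the
    letters of X.  Composition of functors is strictly associative, so
    associators and unitors become identities there ([flattens]); what remains
    is a computation with braidings of adjacent letters. *)

(** * Calculus in a monoidal category *)

Section Category.
Context {A : monData} (HA : is_monoidal A).

Lemma cmpA (w x y z : A) (h : hom y z) (g : hom x y) (f : hom w x) :
  h ∘ (g ∘ f) = h ∘ g ∘ f.
Proof. exact: cmp_assoc_eq. Qed.

Lemma cmp1m (x y : A) (f : hom x y) : idm y ∘ f = f.
Proof. exact: (cat_idl (mon_is_cat HA)). Qed.

Lemma cmpm1 (x y : A) (f : hom x y) : f ∘ idm x = f.
Proof. exact: (cat_idr (mon_is_cat HA)). Qed.

Lemma tmorM (a a' a'' b b' b'' : A) (f' : hom a' a'') (f : hom a a')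
    (g' : hom b' b'') (g : hom b b') :
  (f' ⊠ g') ∘ (f ⊠ g) = (f' ∘ f) ⊠ (g' ∘ g).
Proof. by rewrite (mon_tcmp HA). Qed.

Lemma tmor1 (a b : A) : idm a ⊠ idm b = idm (a ⊗ b).
Proof. exact: mon_tid. Qed.

(** Lets an equation be used inside a composite that is bracketed to the left. *)
Lemma under_left (w x y z : A) (k : hom y z) (g : hom x y) (f : hom w x) (e : hom w y) :
  g ∘ f = e -> k ∘ g ∘ f = k ∘ e.
Proof. by rewrite -cmpA => ->. Qed.

Lemma tmor_cmpl (a b c d e : A) (g : hom b c) (f : hom a b) (h : hom d e) :
  (g ∘ f) ⊠ h = (g ⊠ idm e) ∘ (f ⊠ h).
Proof. by rewrite tmorM cmp1m. Qed.

Lemma tmor_cmpr (a b c d e : A) (g : hom b c) (f : hom a b) (h : hom d e) :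
  h ⊠ (g ∘ f) = (idm e ⊠ g) ∘ (h ⊠ f).
Proof. by rewrite tmorM cmp1m. Qed.

Lemma idm_tmor_cmp (a b c d : A) (g : hom c d) (f : hom b c) :
  idm a ⊠ (g ∘ f) = (idm a ⊠ g) ∘ (idm a ⊠ f).
Proof. exact: tmor_cmpr. Qed.

Lemma massocK (a b c : A) : massocV a b c ∘ massoc a b c = idm _.
Proof. by case: (mon_assoc_inv HA a b c). Qed.
Lemma massocVK (a b c : A) : massoc a b c ∘ massocV a b c = idm _.
Proof. by case: (mon_assoc_inv HA a b c). Qed.
Lemma mlunK (a : A) : mlunV a ∘ mlun a = idm _.
Proof. by case: (mon_lun_inv HA a). Qed.
Lemma mlunVK (a : A) : mlun a ∘ mlunV a = idm _.
Proof. by case: (mon_lun_inv HA a). Qed.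
Lemma mrunK (a : A) : mrunV a ∘ mrun a = idm _.
Proof. by case: (mon_run_inv HA a). Qed.
Lemma mrunVK (a : A) : mrun a ∘ mrunV a = idm _.
Proof. by case: (mon_run_inv HA a). Qed.

Lemma inverse_sym (x y : A) (f : hom x y) g : is_inverse f g -> is_inverse g f.
Proof. by case. Qed.

Lemma inverse_cmp (x y z : A) (f : hom x y) f' (g : hom y z) g' :
  is_inverse f f' -> is_inverse g g' -> is_inverse (g ∘ f) (f' ∘ g').
Proof.
move=> [H1 H2] [K1 K2]; split.
- by rewrite cmpA (under_left _ K1) cmpm1.
- by rewrite cmpA (under_left _ H2) cmpm1.
Qed.

Lemma inverse_tmor (x y x' y' : A) (f : hom x y) f' (g : hom x' y') g' :
  is_inverse f f' -> is_inverse g g' -> is_inverse (f ⊠ g) (f' ⊠ g').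
Proof. by move=> [H1 H2] [K1 K2]; split; rewrite tmorM ?H1 ?H2 ?K1 ?K2 tmor1. Qed.

Lemma inverse_id (x : A) : is_inverse (idm x) (idm x).
Proof. by split; rewrite cmp1m. Qed.

Lemma iso_inv (x y : A) (f : hom x y) g : is_inverse f g -> is_iso f.
Proof. by exists g. Qed.

Lemma iso_cmp (x y z : A) (f : hom x y) (g : hom y z) :
  is_iso f -> is_iso g -> is_iso (g ∘ f).
Proof. by move=> [f' Hf] [g' Hg]; exists (f' ∘ g'); apply: inverse_cmp. Qed.

Lemma iso_tmor (x y x' y' : A) (f : hom x y) (g : hom x' y') :
  is_iso f -> is_iso g -> is_iso (f ⊠ g).
Proof. by move=> [f' Hf] [g' Hg]; exists (f' ⊠ g'); apply: inverse_tmor. Qed.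

Lemma iso_id (x : A) : is_iso (idm x).
Proof. exists (idm x); exact: inverse_id. Qed.

Lemma iso_massoc (a b c : A) : is_iso (massoc a b c).
Proof. exists (massocV a b c); exact: mon_assoc_inv. Qed.
Lemma iso_massocV (a b c : A) : is_iso (massocV a b c).
Proof. exists (massoc a b c); apply: inverse_sym; exact: mon_assoc_inv. Qed.
Lemma iso_mlun (a : A) : is_iso (mlun a).
Proof. exists (mlunV a); exact: mon_lun_inv. Qed.
Lemma iso_mlunV (a : A) : is_iso (mlunV a).
Proof. exists (mlun a); apply: inverse_sym; exact: mon_lun_inv. Qed.
Lemma iso_mrun (a : A) : is_iso (mrun a).
Proof. exists (mrunV a); exact: mon_run_inv. Qed.

Lemma massocV_nat (a a' b b' c c' : A) (f : hom a a') (g : hom b b') (h : hom c c') :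
  massocV a' b' c' ∘ (f ⊠ (g ⊠ h)) = (f ⊠ g ⊠ h) ∘ massocV a b c.
Proof.
apply: (iso_cancel_l HA (iso_massoc a' b' c')).
by rewrite !cmpA massocVK cmp1m mon_assoc_nat // (under_left _ (massocVK a b c)) cmpm1.
Qed.

Lemma mlunV_nat (a a' : A) (f : hom a a') :
  mlunV a' ∘ f = (idm mone ⊠ f) ∘ mlunV a.
Proof.
apply: (iso_cancel_l HA (iso_mlun a')).
by rewrite !cmpA mlunVK cmp1m mon_lun_nat // (under_left _ (mlunVK a)) cmpm1.
Qed.

Lemma mrunV_nat (a a' : A) (f : hom a a') :
  mrunV a' ∘ f = (f ⊠ idm mone) ∘ mrunV a.
Proof.
apply: (iso_cancel_l HA (iso_mrun a')).
by rewrite !cmpA mrunVK cmp1m mon_run_nat // (under_left _ (mrunVK a)) cmpm1.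
Qed.

End Category.

(** Bracketed tensor products, as syntax.  Multiplication by a word, carried out
    letter by letter ([word_act]), does not see the brackets and units of the word. *)
Inductive word (T : Type) := Var (a : T) | One | Ten (s t : word T).
Arguments One {T}.

Fixpoint word_ob (A : monData) (s : word A) : A :=
  match s with Var a => a | One => mone | Ten s t => word_ob s ⊗ word_ob t end.

Fixpoint word_act (A : monData) (s : word A) (z : A) : A :=
  match s with Var a => a ⊗ z | One => z | Ten s t => word_act s (word_act t z) end.

Fixpoint word_actm (A : monData) (s : word A) (z z' : A) (h : hom z z') :
    hom (word_act s z) (word_act s z') :=
  match s with
  | Var a => idm a ⊠ h
  | One => h
  | Ten s t => word_actm s (word_actm t h)
  end.

Fixpoint flatten (A : monData) (s : word A) (z : A) : hom (word_ob s ⊗ z) (word_act s z) :=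
  match s with
  | Var a => idm (a ⊗ z)
  | One => mlun z
  | Ten s t =>
      flatten s (word_act t z) ∘ (idm (word_ob s) ⊠ flatten t z) ∘ massoc (word_ob s) (word_ob t) z
  end.

(** [F] is [f ⊠ idm z] transported along [flatten].  All [z] are kept, since a tensor
    product of words uses the family of its left factor at [word_act t z]. *)
Definition flattens (A : monData) (s t : word A) (f : hom (word_ob s) (word_ob t))
    (F : forall z, hom (word_act s z) (word_act t z)) : Prop :=
  forall z, flatten t z ∘ (f ⊠ idm z) = F z ∘ flatten s z.

Arguments flattens {A s t} f F.

Section Words.
Context {A : monData} (HA : is_monoidal A).

Lemma iso_flatten (s : word A) z : is_iso (flatten s z).
Proof.
elim: s z => [a|| s IHs t IHt] z /=.
- exact: iso_id.
- exact: iso_mlun.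
- apply: (iso_cmp HA); first exact: iso_massoc.
  apply: (iso_cmp HA) => //; apply: (iso_tmor HA) => //; exact: iso_id.
Qed.

Lemma flatten_nat (s : word A) z z' (h : hom z z') :
  flatten s z' ∘ (idm (word_ob s) ⊠ h) = word_actm s h ∘ flatten s z.
Proof.
elim: s z z' h => [a|| s IHs t IHt] z z' h /=.
- by rewrite (cmp1m HA) (cmpm1 HA).
- exact: mon_lun_nat.
- rewrite -(tmor1 HA) (under_left HA _ (mon_assoc_nat HA _ _ _)) !(cmpA HA).
  rewrite (under_left HA _ (tmorM HA _ _ _ _)) (cmp1m HA) IHt.
  rewrite -(IHs _ _ (word_actm t h)) (under_left HA _ (tmorM HA _ _ _ _)).
  by rewrite (cmp1m HA).
Qed.

Lemma word_actm1 (s : word A) (z : A) : word_actm s (idm z) = idm (word_act s z).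
Proof.
elim: s z => [a|| s IHs t IHt] z //=; first exact: (tmor1 HA).
by rewrite IHt IHs.
Qed.

(** At the unit object the two families determine [f ⊠ idm mone], and tensoring with
    the unit is faithful. *)
Lemma flattens_faithful (s t : word A) (f g : hom (word_ob s) (word_ob t)) F G :
  flattens f F -> flattens g G -> (forall z, F z = G z) -> f = g.
Proof.
move=> Hf Hg E; apply: (run_cancel HA).
by apply: (iso_cancel_l HA (iso_flatten t mone)); rewrite Hf Hg E.
Qed.

Lemma flattens_id (s : word A) : flattens (idm (word_ob s)) (fun z => idm (word_act s z)).
Proof. by move=> z; rewrite (tmor1 HA) (cmp1m HA) (cmpm1 HA). Qed.

Lemma flattens_cmp (s t r : word A) (g : hom (word_ob t) (word_ob r))
    (f : hom (word_ob s) (word_ob t)) G F :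
  flattens g G -> flattens f F -> flattens (g ∘ f) (fun z => G z ∘ F z).
Proof.
move=> Hg Hf z.
rewrite -(cmp1m HA (idm z)) -(tmorM HA) (cmpA HA) Hg -(cmpA HA) Hf.
by rewrite (cmpA HA).
Qed.

(** Of the two orders in which [f] and [g] can be applied, the one with [g] first is
    chosen; the interchange law makes the choice immaterial. *)
Lemma flattens_tmor (s s' t t' : word A) (f : hom (word_ob s) (word_ob s'))
    (g : hom (word_ob t) (word_ob t')) F G :
  flattens f F -> flattens g G ->
  @flattens A (Ten s t) (Ten s' t') (f ⊠ g) (fun z => F (word_act t' z) ∘ word_actm s (G z)).
Proof.
move=> Hf Hg z /=.
rewrite (under_left HA _ (mon_assoc_nat HA _ _ _)) !(cmpA HA).
rewrite (under_left HA _ (tmorM HA _ _ _ _)) (cmp1m HA) Hg.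
have E : f ⊠ (G z ∘ flatten t z)
         = (f ⊠ idm _) ∘ (idm _ ⊠ G z) ∘ (idm _ ⊠ flatten t z).
  by rewrite !(tmorM HA) !(cmpm1 HA) (cmp1m HA).
by rewrite E !(cmpA HA) Hf (under_left HA _ (flatten_nat _ _)) !(cmpA HA).
Qed.

Lemma flattens_inv (s t : word A) (f : hom (word_ob s) (word_ob t)) g F G :
  is_inverse f g -> flattens f F -> (forall z, G z ∘ F z = idm _) -> flattens g G.
Proof.
move=> [H1 H2] Hf HG z.
have Hi : is_iso (f ⊠ idm z).
  by apply: (iso_tmor HA); [exists g | exact: iso_id].
apply: (iso_cancel_r HA Hi).
rewrite -!(cmpA HA) (tmorM HA) H1 (cmp1m HA) (tmor1 HA) Hf (cmpA HA) HG.
by rewrite (cmp1m HA) (cmpm1 HA).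
Qed.

(** Both bracketings act by the same functor.  That the associator becomes its
    identity is the pentagon. *)
Lemma flattens_massoc (s t r : word A) :
  @flattens A (Ten (Ten s t) r) (Ten s (Ten t r)) (massoc (word_ob s) (word_ob t) (word_ob r))
    (fun z => idm _).
Proof.
move=> z /=; rewrite (cmp1m HA).
have E : idm (word_ob s) ⊠ (flatten t (word_act r z) ∘ (idm (word_ob t) ⊠ flatten r z)
             ∘ massoc (word_ob t) (word_ob r) z)
         = (idm (word_ob s) ⊠ flatten t (word_act r z))
           ∘ (idm (word_ob s) ⊠ (idm (word_ob t) ⊠ flatten r z))
           ∘ (idm (word_ob s) ⊠ massoc (word_ob t) (word_ob r) z).
  by rewrite !(tmorM HA) !(cmp1m HA).
rewrite E -!(cmpA HA) (cmpA HA (idm (word_ob s) ⊠ massoc _ _ z)) -(mon_pentagon HA).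
rewrite !(cmpA HA) -(tmor1 HA (word_ob s) (word_ob t)); congr (_ ∘ _).
rewrite -!(cmpA HA); congr (_ ∘ (_ ∘ _)).
by rewrite (mon_assoc_nat HA).
Qed.

Lemma flattens_massocV (s t r : word A) :
  @flattens A (Ten s (Ten t r)) (Ten (Ten s t) r) (massocV (word_ob s) (word_ob t) (word_ob r))
    (fun z => idm _).
Proof.
apply: (flattens_inv (s := Ten (Ten s t) r) (t := Ten s (Ten t r))
  (mon_assoc_inv HA _ _ _) (flattens_massoc s t r)) => z.
exact: (cmp1m HA).
Qed.

(** Kelly's consequence of the pentagon and the triangle. *)
Lemma flattens_mlun (s : word A) : @flattens A (Ten One s) s (mlun (word_ob s)) (fun z => idm _).
Proof.
move=> z /=; rewrite (cmp1m HA) (mon_lun_nat HA) -(cmpA HA).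
by rewrite kelly_lun.
Qed.

Lemma flattens_mlunV (s : word A) : @flattens A s (Ten One s) (mlunV (word_ob s)) (fun z => idm _).
Proof.
apply: (flattens_inv (s := Ten One s) (t := s) (mon_lun_inv HA _) (flattens_mlun s)) => z.
exact: (cmp1m HA).
Qed.

Lemma flattens_mrun (s : word A) : @flattens A (Ten s One) s (mrun (word_ob s)) (fun z => idm _).
Proof.
by move=> z /=; rewrite (cmp1m HA) -(cmpA HA) (mon_triangle HA).
Qed.

Lemma flattens_mrunV (s : word A) : @flattens A s (Ten s One) (mrunV (word_ob s)) (fun z => idm _).
Proof.
apply: (flattens_inv (s := Ten s One) (t := s) (mon_run_inv HA _) (flattens_mrun s)) => z.
exact: (cmp1m HA).
Qed.

Lemma flattens_atom (a b : A) (f : hom a b) :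
  @flattens A (Var a) (Var b) f (fun z => f ⊠ idm z).
Proof. by move=> z /=; rewrite (cmp1m HA) (cmpm1 HA). Qed.

End Words.

(** * Braidings and the interchange *)

(** The braiding of the first two factors of a right-nested product.  It is locked
    so that rewriting with associativity of composition does not open it. *)
Definition swap (B : brData) (a b z : B) : hom (a ⊗ (b ⊗ z)) (b ⊗ (a ⊗ z)) :=
  locked (massoc b a z ∘ (braid a b ⊠ idm z) ∘ massocV a b z).

Lemma swapE (B : brData) (a b z : B) :
  massoc b a z ∘ (braid a b ⊠ idm z) ∘ massocV a b z = swap a b z.
Proof. by rewrite /swap -lock. Qed.

Section Braided.
Context {B : brData} (HB : is_braided B).
Let HM := br_is_mon HB.

Lemma swap_nat (a a' b b' z z' : B) (f : hom a a') (g : hom b b') (h : hom z z') :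
  swap a' b' z' ∘ (f ⊠ (g ⊠ h)) = (g ⊠ (f ⊠ h)) ∘ swap a b z.
Proof.
rewrite -!swapE (under_left HM _ (massocV_nat HM _ _ _)) !(cmpA HM).
rewrite (under_left HM _ (tmorM HM _ _ _ _)) (br_nat HB) (cmp1m HM).
rewrite -(cmpm1 HM h) -(tmorM HM) !(cmpA HM) (mon_assoc_nat HM).
by rewrite (cmpm1 HM).
Qed.

Lemma swapK (a b z : B) : transparent B a -> swap b a z ∘ swap a b z = idm _.
Proof.
move=> Ha; rewrite -!swapE !(cmpA HM) (under_left HM _ (massocK HM _ _ _)) (cmpm1 HM).
rewrite (under_left HM _ (tmorM HM _ _ _ _)) Ha (cmp1m HM) (tmor1 HM) (cmpm1 HM).
exact: massocVK.
Qed.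

Lemma flattens_braid_atom (a b : B) :
  @flattens B (Ten (Var a) (Var b)) (Ten (Var b) (Var a)) (braid a b) (swap a b).
Proof.
move=> z /=; rewrite !(cmp1m HM) !(tmor1 HM) !(cmp1m HM) -swapE.
by rewrite (under_left HM _ (massocK HM _ _ _)) (cmpm1 HM).
Qed.

Lemma braid_one_r (a : B) : braid a mone = mlunV a ∘ mrun a.
Proof.
by rewrite -(lun_braid HB) (cmpA HM) (mlunK HM) (cmp1m HM).
Qed.

Lemma braid_one_l (a : B) : braid mone a = mrunV a ∘ mlun a.
Proof.
by rewrite -(run_braid HB) (cmpA HM) (mrunK HM) (cmp1m HM).
Qed.

(** Braiding with the unit is a composite of unitors. *)
Lemma flattens_braid_one_r (s : word B) :
  @flattens B (Ten s One) (Ten One s) (braid (word_ob s) mone) (fun z => idm _).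
Proof.
rewrite braid_one_r => z.
rewrite (flattens_cmp HM (s := Ten s One) (t := s) (r := Ten One s)
  (flattens_mlunV HM s) (flattens_mrun HM s)).
by rewrite (cmp1m HM).
Qed.

Lemma flattens_braid_one_l (s : word B) :
  @flattens B (Ten One s) (Ten s One) (braid mone (word_ob s)) (fun z => idm _).
Proof.
rewrite braid_one_l => z.
rewrite (flattens_cmp HM (s := Ten One s) (t := s) (r := Ten s One)
  (flattens_mrunV HM s) (flattens_mlun HM s)).
by rewrite (cmp1m HM).
Qed.

(** The first hexagon, without its associators. *)
Lemma flattens_braid_ten_r (s t r : word B) F G :
  @flattens B (Ten s t) (Ten t s) (braid (word_ob s) (word_ob t)) F ->
  @flattens B (Ten s r) (Ten r s) (braid (word_ob s) (word_ob r)) G ->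
  @flattens B (Ten s (Ten t r)) (Ten (Ten t r) s) (braid (word_ob s) (word_ob t ⊗ word_ob r))
    (fun z => word_actm t (G z) ∘ F (word_act r z)).
Proof.
move=> HF HG.
have -> : braid (word_ob s) (word_ob t ⊗ word_ob r)
  = massocV (word_ob t) (word_ob r) (word_ob s) ∘ ((idm (word_ob t) ⊠ braid (word_ob s) (word_ob r))
     ∘ massoc (word_ob t) (word_ob s) (word_ob r)
     ∘ (braid (word_ob s) (word_ob t) ⊠ idm (word_ob r)))
    ∘ massocV (word_ob s) (word_ob t) (word_ob r).
  rewrite -(br_hex1 HB) !(cmpA HM) (massocK HM) (cmp1m HM) -(cmpA HM).
  by rewrite (massocVK HM) (cmpm1 HM).
move=> z.
rewrite (flattens_cmp HM (t := Ten (Ten s t) r) (r := Ten (Ten t r) s)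
 (flattens_cmp HM (t := Ten t (Ten r s)) (r := Ten (Ten t r) s)
  (flattens_massocV HM _ _ _)
  (flattens_cmp HM (t := Ten (Ten t s) r) (r := Ten t (Ten r s))
   (flattens_cmp HM (t := Ten t (Ten s r)) (r := Ten t (Ten r s))
     (flattens_tmor HM (flattens_id HM t) HG)
     (flattens_massoc HM _ _ _))
   (flattens_tmor HM HF (flattens_id HM r)))) (flattens_massocV HM _ _ _)).
by rewrite /= !(word_actm1 HM) !(cmp1m HM) !(cmpm1 HM).
Qed.

(** The second hexagon, without its associators. *)
Lemma flattens_braid_ten_l (s t r : word B) F G :
  @flattens B (Ten s r) (Ten r s) (braid (word_ob s) (word_ob r)) F ->
  @flattens B (Ten t r) (Ten r t) (braid (word_ob t) (word_ob r)) G ->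
  @flattens B (Ten (Ten s t) r) (Ten r (Ten s t)) (braid (word_ob s ⊗ word_ob t) (word_ob r))
    (fun z => F (word_act t z) ∘ word_actm s (G z)).
Proof.
move=> HF HG.
have -> : braid (word_ob s ⊗ word_ob t) (word_ob r)
  = massoc (word_ob r) (word_ob s) (word_ob t) ∘ ((braid (word_ob s) (word_ob r) ⊠ idm (word_ob t))
     ∘ massocV (word_ob s) (word_ob r) (word_ob t)
     ∘ (idm (word_ob s) ⊠ braid (word_ob t) (word_ob r)))
    ∘ massoc (word_ob s) (word_ob t) (word_ob r).
  rewrite -(br_hex2 HB) !(cmpA HM) (massocVK HM) (cmp1m HM) -(cmpA HM).
  by rewrite (massocK HM) (cmpm1 HM).
move=> z.
rewrite (flattens_cmp HM (t := Ten s (Ten t r)) (r := Ten r (Ten s t))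
 (flattens_cmp HM (t := Ten (Ten r s) t) (r := Ten r (Ten s t))
  (flattens_massoc HM _ _ _)
  (flattens_cmp HM (t := Ten s (Ten r t)) (r := Ten (Ten r s) t)
   (flattens_cmp HM (t := Ten (Ten s r) t) (r := Ten (Ten r s) t)
     (flattens_tmor HM HF (flattens_id HM t))
     (flattens_massocV HM _ _ _))
   (flattens_tmor HM (flattens_id HM s) HG))) (flattens_massoc HM _ _ _)).
by rewrite /= !(word_actm1 HM) !(cmp1m HM) !(cmpm1 HM).
Qed.

End Braided.

Ltac word_of A x :=
  lazymatch x with
  | @tob _ ?a ?b => let s := word_of A a in let t := word_of A b in constr:(@Ten A s t)
  | @mone _ => constr:(@One A)
  | _ => constr:(@Var A x)
  end.

Ltac flattens_braid HB :=
  lazymatch goal with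
  | |- @flattens ?A (Ten One ?s) _ _ _ => exact (@flattens_braid_one_l _ HB s)
  | |- @flattens ?A (Ten ?s One) _ _ _ => exact (@flattens_braid_one_r _ HB s)
  | |- @flattens ?A (Ten (Ten ?s ?t) ?r) _ _ _ =>
      refine (@flattens_braid_ten_l _ HB s t r _ _ _ _); flattens_braid HB
  | |- @flattens ?A (Ten ?s (Ten ?t ?r)) _ _ _ =>
      refine (@flattens_braid_ten_r _ HB s t r _ _ _ _); flattens_braid HB
  | |- @flattens ?A (Ten (Var ?a) (Var ?b)) _ _ _ => exact (@flattens_braid_atom _ HB a b)
  end.

Ltac flattens_rec A HM HB :=
  lazymatch goal with
  | |- @flattens _ ?s ?r (@cmp _ _ ?y _ ?g ?f) _ =>
      let w := word_of (ob (mon_cat A)) y in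
      refine (@flattens_cmp _ HM s w r g f _ _ _ _); flattens_rec A HM HB
  | |- @flattens _ (Ten ?s ?t) (Ten ?s' ?t') (@tmor _ _ _ _ _ ?f ?g) _ =>
      refine (@flattens_tmor _ HM s s' t t' f g _ _ _ _); flattens_rec A HM HB
  | |- @flattens _ (Ten (Ten ?s ?t) ?r) _ (@massoc _ _ _ _) _ => exact (@flattens_massoc _ HM s t r)
  | |- @flattens _ (Ten ?s (Ten ?t ?r)) _ (@massocV _ _ _ _) _ =>
      exact (@flattens_massocV _ HM s t r)
  | |- @flattens _ _ ?s (@mlun _ _) _ => exact (@flattens_mlun _ HM s)
  | |- @flattens _ ?s _ (@mlunV _ _) _ => exact (@flattens_mlunV _ HM s)
  | |- @flattens _ _ ?s (@mrun _ _) _ => exact (@flattens_mrun _ HM s)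
  | |- @flattens _ ?s _ (@mrunV _ _) _ => exact (@flattens_mrunV _ HM s)
  | |- @flattens _ _ _ (@braid _ _ _) _ => flattens_braid HB
  | |- @flattens _ ?s _ (@idm _ _) _ => exact (@flattens_id _ HM s)
  | |- @flattens _ _ _ ?f _ => exact (@flattens_atom _ HM _ _ f)
  end.

Ltac words_gen A HM HB :=
  lazymatch goal with
  | |- @eq (@hom _ ?x ?y) ?f ?g =>
      let s := word_of (ob (mon_cat A)) x in
      let t := word_of (ob (mon_cat A)) y in
      refine (@flattens_faithful _ HM s t f g _ _ _ _ _);
      [ flattens_rec A HM HB | flattens_rec A HM HB
      | let z := fresh "z" in intro z; cbn [word_act word_actm] ]
  end.

(** Replaces an equation of morphisms by the equation of their flattened families. *)
Ltac words HB :=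
  lazymatch type of HB with
  | is_braided ?B => let HM := constr:(br_is_mon HB) in words_gen (br_mon B) HM HB
  | is_monoidal ?A => words_gen A HB HB
  end.

Ltac words_simpl HM :=
  rewrite ?(tmor1 HM, cmp1m HM, cmpm1 HM) ?(idm_tmor_cmp HM) ?(cmpA HM).

Lemma mlun_mrun_one (A : monData) (HA : is_monoidal A) : mlun (mone : A) = mrun mone.
Proof. by words HA. Qed.

Section Interchange.
Context {B : brData} (HB : is_braided B).
Let HM := br_is_mon HB.

(** Flattened, both sides consist of the same three swaps.  They differ in whether
    [b2] passes [a3] before or after [b1] passes [a2], and these commute. *)
Lemma midswap_assoc (a1 b1 a2 b2 a3 b3 : B) :
  midswap a1 b1 (a2 ⊗ a3) (b2 ⊗ b3) ∘ (idm (a1 ⊗ b1) ⊠ midswap a2 b2 a3 b3)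
    ∘ massoc (a1 ⊗ b1) (a2 ⊗ b2) (a3 ⊗ b3)
  = (massoc a1 a2 a3 ⊠ massoc b1 b2 b3) ∘ midswap (a1 ⊗ a2) (b1 ⊗ b2) a3 b3
    ∘ (midswap a1 b1 a2 b2 ⊠ idm (a3 ⊗ b3)).
Proof.
rewrite /midswap; words HB; words_simpl HM.
rewrite -!(cmpA HM) -!(idm_tmor_cmp HM); congr (_ ⊠ _).
by rewrite (swap_nat HB).
Qed.

Lemma midswap_lun (a b : B) :
  (mlun a ⊠ mlun b) ∘ midswap mone mone a b ∘ (mlunV mone ⊠ idm (a ⊗ b))
  = mlun (a ⊗ b).
Proof. by rewrite /midswap; words HB; words_simpl HM. Qed.

Lemma midswap_run (a b : B) :
  (mrun a ⊠ mrun b) ∘ midswap a b mone mone ∘ (idm (a ⊗ b) ⊠ mlunV mone)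
  = mrun (a ⊗ b).
Proof. by rewrite /midswap; words HB; words_simpl HM. Qed.

(** Makes the left unitor monoidal for the structure that the interchange puts on
    tensoring; the interchange is trivial as it moves [a] past the unit. *)
Lemma mlun_tmor (a b : B) :
  mlun (a ⊗ b) ∘ ((mlun mone ⊠ idm (a ⊗ b)) ∘ midswap mone a mone b)
  = mlun a ⊠ mlun b.
Proof. by rewrite /midswap; words HB; words_simpl HM. Qed.

Lemma mrun_tmor (a b : B) :
  mrun (a ⊗ b) ∘ ((idm (a ⊗ b) ⊠ mlun mone) ∘ midswap a mone b mone)
  = mrun a ⊠ mrun b.
Proof. by rewrite /midswap; words HB; words_simpl HM. Qed.

Lemma midswap_one (a b : B) : midswap a mone mone b = idm _.
Proof. by rewrite /midswap; words HB; words_simpl HM. Qed.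

(** The braiding on the right moves [a1] past [b2], and the interchange that follows
    moves [b2] back past [a1].  This double braiding is absent on the left. *)
Lemma midswap_braid (a1 b1 a2 b2 : B) :
  transparent B a1 ->
  (braid a1 a2 ⊠ braid b1 b2) ∘ midswap a1 b1 a2 b2
  = midswap a2 b2 a1 b1 ∘ braid (a1 ⊗ b1) (a2 ⊗ b2).
Proof.
move=> Ha; rewrite /midswap; words HB; words_simpl HM.
by rewrite -(idm_tmor_cmp HM a2 (swap b2 a1 _)) (swapK HB _ _ Ha) (tmor1 HM) (cmp1m HM).
Qed.

Lemma midswap_nat (a1 b1 a2 b2 a1' b1' a2' b2' : B)
    (f1 : hom a1 a1') (g1 : hom b1 b1') (f2 : hom a2 a2') (g2 : hom b2 b2') :
  midswap a1' b1' a2' b2' ∘ ((f1 ⊠ g1) ⊠ (f2 ⊠ g2))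
  = ((f1 ⊠ f2) ⊠ (g1 ⊠ g2)) ∘ midswap a1 b1 a2 b2.
Proof.
rewrite /midswap (under_left HM _ (mon_assoc_nat HM _ _ _)) !(cmpA HM).
rewrite (under_left HM _ (tmorM HM _ _ _ _)) !swapE (swap_nat HB).
rewrite (cmp1m HM) -{1}(cmpm1 HM f1) -(tmorM HM) !(cmpA HM).
by rewrite (massocV_nat HM).
Qed.

Lemma iso_swap (a b z : B) : is_iso (swap a b z).
Proof.
rewrite -swapE; apply: (iso_cmp HM); first exact: iso_massocV.
apply: (iso_cmp HM); last exact: iso_massoc.
by apply: (iso_tmor HM); [exact: br_iso | exact: iso_id].
Qed.

Lemma iso_midswap (a1 b1 a2 b2 : B) : is_iso (midswap a1 b1 a2 b2).
Proof.
apply: (iso_cmp HM); first exact: iso_massoc.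
apply: (iso_cmp HM); last exact: iso_massocV.
rewrite swapE; apply: (iso_tmor HM); [exact: iso_id | exact: iso_swap].
Qed.
End Interchange.

(** * Monoidal functors and transformations *)

Lemma monoidal_prod (A B : monData) :
  is_monoidal A -> is_monoidal B -> is_monoidal (prodMon A B).
Proof.
move=> HA HB; split.
- by split=> [x y [f g]|x y [f g]|w x y z [h h'] [g g'] [f f']];
    rewrite /= ?(cmp1m HA) ?(cmp1m HB) ?(cmpm1 HA) ?(cmpm1 HB) ?(cmpA HA) ?(cmpA HB).
- by move=> a b /=; rewrite !tmor1.
- by move=> *; rewrite /= (mon_tcmp HA) (mon_tcmp HB).
- by move=> a b c; split; rewrite /= ?massocK ?massocVK.
- by move=> a; split; rewrite /= ?mlunK ?mlunVK.
- by move=> a; split; rewrite /= ?mrunK ?mrunVK.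
- by move=> *; rewrite /= (mon_assoc_nat HA) (mon_assoc_nat HB).
- by move=> *; rewrite /= (mon_lun_nat HA) (mon_lun_nat HB).
- by move=> *; rewrite /= (mon_run_nat HA) (mon_run_nat HB).
- by move=> *; rewrite /= (mon_pentagon HA) (mon_pentagon HB).
- by move=> *; rewrite /= (mon_triangle HA) (mon_triangle HB).
Qed.

Lemma iso_pair (A B : monData) (x y : prodMon A B) (f : hom x y) :
  is_iso (fst f) -> is_iso (snd f) -> is_iso f.
Proof.
move=> [f1 [E1 E1']] [f2 [E2 E2']]; exists (f1, f2); split; rewrite /= ?E1 ?E2 //.
by rewrite E1' E2'.
Qed.

Lemma braided_prod (A B : brData) :
  is_braided A -> is_braided B -> is_braided (prodBr A B).
Proof.
move=> HA HB; split.
- by apply: monoidal_prod; exact: br_is_mon.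
- by move=> a b; apply: iso_pair; exact: br_iso.
- by move=> *; rewrite /= (br_nat HA) (br_nat HB).
- by move=> *; rewrite /= (br_hex1 HA) (br_hex1 HB).
- by move=> *; rewrite /= (br_hex2 HA) (br_hex2 HB).
Qed.

Section Functor.
Context {A B : monData} (HA : is_monoidal A) (HB : is_monoidal B).
Context {F : monFunData A B} (HF : is_lax F).

Lemma fmorM (a b c : A) (g : hom b c) (f : hom a b) :
  fmor F g ∘ fmor F f = fmor F (g ∘ f).
Proof. by rewrite lax_cmp. Qed.

Lemma fmor1 (a : A) : fmor F (idm a) = idm (F a).
Proof. exact: lax_id. Qed.

Lemma inverse_fmor (a b : A) (f : hom a b) g :
  is_inverse f g -> is_inverse (fmor F f) (fmor F g).
Proof. by move=> [E E']; split; rewrite fmorM ?E ?E' fmor1. Qed.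

Lemma iso_fmor (a b : A) (f : hom a b) : is_iso f -> is_iso (fmor F f).
Proof. by move=> [g Hg]; exists (fmor F g); exact: inverse_fmor. Qed.

(** The associator moved through a comparison of four factors.  With [lax_swap] this
    carries the interchange, step by step, through a braided functor. *)
Lemma lax_assoc4 (a b c d : A) :
  fmor F (massoc a b (c ⊗ d)) ∘ fmu F (a ⊗ b) (c ⊗ d) ∘ (fmu F a b ⊠ fmu F c d)
  = fmu F a (b ⊗ (c ⊗ d))
    ∘ (idm (F a) ⊠ (fmu F b (c ⊗ d) ∘ (idm (F b) ⊠ fmu F c d)))
    ∘ massoc (F a) (F b) (F c ⊗ F d).
Proof.
rewrite -{1}(cmpm1 HB (fmu F a b)) -(cmp1m HB (fmu F c d)) -(tmorM HB) !(cmpA HB).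
rewrite -(lax_assoc HF) -!(cmpA HB); congr (_ ∘ _).
by rewrite -(tmor1 HB) (mon_assoc_nat HB) !(cmpA HB) (tmorM HB) !(cmp1m HB).
Qed.

Lemma lax_assocV4 (a b c d : A) :
  fmor F (massocV a b (c ⊗ d)) ∘ fmu F a (b ⊗ (c ⊗ d))
    ∘ (idm (F a) ⊠ (fmu F b (c ⊗ d) ∘ (idm (F b) ⊠ fmu F c d)))
  = fmu F (a ⊗ b) (c ⊗ d) ∘ (fmu F a b ⊠ fmu F c d)
    ∘ massocV (F a) (F b) (F c ⊗ F d).
Proof.
apply: (iso_cancel_r HB (iso_massoc HB (F a) (F b) (F c ⊗ F d))).
rewrite -2!(cmpA HB) (cmpA HB (fmu _ _ _)) -lax_assoc4 !(cmpA HB) fmorM (massocK HA).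
by rewrite fmor1 (cmp1m HB) (under_left HB _ (massocK HB _ _ _)) (cmpm1 HB).
Qed.

End Functor.

Section BraidedFunctor.
Context {A B : brData} (HA : is_braided A) (HB : is_braided B).
Context {F : monFunData A B} (HF : is_brfun F).
Let MA := br_is_mon HA.
Let MB := br_is_mon HB.
Let LF := strong_lax (brfun_strong HF).

Lemma lax_swap (b c d : A) :
  fmor F (massoc c b d ∘ (braid b c ⊠ idm d) ∘ massocV b c d)
    ∘ (fmu F b (c ⊗ d) ∘ (idm (F b) ⊠ fmu F c d))
  = fmu F c (b ⊗ d) ∘ (idm (F c) ⊠ fmu F b d)
    ∘ (massoc (F c) (F b) (F d) ∘ (braid (F b) (F c) ⊠ idm (F d))
       ∘ massocV (F b) (F c) (F d)).
Proof.
apply: (iso_cancel_r MB (iso_massoc MB (F b) (F c) (F d))).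
rewrite -!(cmpA MB) (massocK MB) (cmpm1 MB) -!(fmorM LF).
rewrite !(cmpA MB) -(cmpA MB (_ ∘ _) (fmu F b _)) -(cmpA MB _ (_ ∘ _) (massoc _ _ _)).
rewrite (lax_assoc LF) !(cmpA MB) (under_left MB _ (fmorM LF _ _)) (massocK MA).
rewrite (fmor1 LF) (cmpm1 MB) -(fmor1 LF d) (under_left MB _ (eq_sym (lax_mu_nat LF _ _))).
rewrite (lax_assoc LF) (fmor1 LF) !(cmpA MB).
rewrite -!(cmpA MB) !(tmorM MB) (brfun_braid HF) (cmp1m MB).
by [].
Qed.

Lemma fmu_midswap (a b c d : A) :
  fmu F (a ⊗ c) (b ⊗ d) ∘ ((fmu F a c ⊠ fmu F b d) ∘ midswap (F a) (F b) (F c) (F d))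
  = fmor F (midswap a b c d) ∘ fmu F (a ⊗ b) (c ⊗ d) ∘ (fmu F a b ⊠ fmu F c d).
Proof.
rewrite /midswap -!(fmorM LF) -!(cmpA MB) (cmpA MB (fmor F (massoc _ _ _))).
rewrite (lax_assoc4 MB LF) !(cmpA MB).
rewrite (under_left MB _ (eq_sym (lax_mu_nat LF _ _))) !(cmpA MB).
rewrite -(lax_assocV4 MA MB LF) (fmor1 LF) !(under_left MB _ (tmorM MB _ _ _ _)).
by rewrite (cmp1m MB) lax_swap.
Qed.

(** The comparison of a braided functor with tensor products is itself a monoidal
    transformation; the braiding enters through the interchange. *)
Lemma fmu_monnat :
  is_monnat (compMonFun (tensorMonFun B) (prodMonFun F F))
            (compMonFun F (tensorMonFun A)) (fun x => fmu F (fst x) (snd x)).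
Proof.
split.
- by move=> [a b] [a' b'] [f g]; exact: (lax_mu_nat LF).
- by move=> [a b] [c d]; exact: fmu_midswap.
- apply: (iso_cancel_l MB (iso_fmor LF (iso_mlun MA mone))) => /=.
  rewrite !(cmpA MB) (fmorM LF) (mlunVK MA) (fmor1 LF) (cmp1m MB).
  have -> : feps F ⊠ feps F = (feps F ⊠ idm _) ∘ (idm _ ⊠ feps F).
    by rewrite (tmorM MB) (cmp1m MB) (cmpm1 MB).
  rewrite !(cmpA MB) (lax_lun LF) (mon_lun_nat MB) -(cmpA MB) (mlunVK MB).
  exact: cmpm1.
Qed.
End BraidedFunctor.

Lemma lax_comp (A B C : monData) (G : monFunData B C) (F : monFunData A B) :
  is_monoidal C -> is_lax F -> is_lax G -> is_lax (compMonFun G F).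
Proof.
move=> HC HF HG; split=> /=.
- by move=> a; rewrite (fmor1 HF) (fmor1 HG).
- by move=> a b c g f; rewrite (lax_cmp HF) (lax_cmp HG).
- move=> a a' b b' f g; rewrite -(cmpA HC) (lax_mu_nat HG) !(cmpA HC).
  by rewrite !(fmorM HG) (lax_mu_nat HF).
- move=> a b c.
  have E1 : idm (G (F a)) ⊠ (fmor G (fmu F b c) ∘ fmu G (F b) (F c))
    = (fmor G (idm _) ⊠ fmor G (fmu F b c)) ∘ (idm _ ⊠ fmu G (F b) (F c)).
    by rewrite (tmorM HC) (fmor1 HG) (cmp1m HC).
  have E2 : (fmor G (fmu F a b) ∘ fmu G (F a) (F b)) ⊠ idm (G (F c))
    = (fmor G (fmu F a b) ⊠ fmor G (idm _)) ∘ (fmu G (F a) (F b) ⊠ idm _).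
    by rewrite (tmorM HC) (fmor1 HG) (cmp1m HC).
  rewrite E1 E2 !(cmpA HC) (under_left HC _ (lax_mu_nat HG _ _)) !(cmpA HC).
  rewrite (fmorM HG) -2!(cmpA HC) (cmpA HC (fmu _ _ _)) (lax_assoc HG) !(cmpA HC).
  rewrite (fmorM HG) (lax_assoc HF) -!(fmorM HG).
  by rewrite (under_left HC _ (lax_mu_nat HG _ _)) !(cmpA HC).
- move=> a.
  have E1 : (fmor G (feps F) ∘ feps G) ⊠ idm (G (F a))
    = (fmor G (feps F) ⊠ fmor G (idm _)) ∘ (feps G ⊠ idm _).
    by rewrite (tmorM HC) (fmor1 HG) (cmp1m HC).
  rewrite E1 !(cmpA HC) (under_left HC _ (lax_mu_nat HG _ _)) !(cmpA HC).
  by rewrite !(fmorM HG) (lax_lun HF) (lax_lun HG).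
- move=> a.
  have E1 : idm (G (F a)) ⊠ (fmor G (feps F) ∘ feps G)
    = (fmor G (idm _) ⊠ fmor G (feps F)) ∘ (idm _ ⊠ feps G).
    by rewrite (tmorM HC) (fmor1 HG) (cmp1m HC).
  rewrite E1 !(cmpA HC) (under_left HC _ (lax_mu_nat HG _ _)) !(cmpA HC).
  by rewrite !(fmorM HG) (lax_run HF) (lax_run HG).
Qed.

Lemma brfun_comp (A B C : brData) (G : monFunData B C) (F : monFunData A B) :
  is_monoidal C -> is_brfun F -> is_brfun G -> is_brfun (compMonFun G F).
Proof.
move=> HC [[LF MF EF] BF] [[LG MG EG] BG]; split; [split|] => /=.
- exact: lax_comp.
- by move=> a b; apply: (iso_cmp HC) => //; apply: (iso_fmor LG).
- by apply: (iso_cmp HC) => //; apply: (iso_fmor LG).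
- by move=> a b; rewrite (cmpA HC) (fmorM LG) BF -(fmorM LG) -!(cmpA HC) BG.
Qed.

Section Transformation.
Context {A B : monData} (HB : is_monoidal B).

Lemma monnat_inv (F G : monFunData A B) (t : forall a, hom (F a) (G a))
    (s : forall a, hom (G a) (F a)) :
  (forall a, is_inverse (t a) (s a)) -> is_monnat F G t -> is_monnat G F s.
Proof.
move=> Hs Ht.
have Hi a : is_iso (t a) by exists (s a).
split.
- move=> a a' f; apply: (iso_cancel_l HB (Hi a')); apply: (iso_cancel_r HB (Hi a)).
  rewrite !(cmpA HB) (proj2 (Hs a')) (cmp1m HB) (monnat_nat Ht) -!(cmpA HB).
  by rewrite (proj1 (Hs a)) (cmpm1 HB).
- move=> a b; apply: (iso_cancel_l HB (Hi (a ⊗ b))).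
  rewrite !(cmpA HB) (proj2 (Hs _)) (cmp1m HB) (monnat_mu Ht) -(cmpA HB) (tmorM HB).
  by rewrite !(proj2 (Hs _)) (tmor1 HB) (cmpm1 HB).
- apply: (iso_cancel_l HB (Hi mone)).
  by rewrite (cmpA HB) (proj2 (Hs _)) (cmp1m HB) (monnat_eps Ht).
Qed.

Lemma monnat_cmp (F G H : monFunData A B) (t : forall a, hom (G a) (H a))
    (s : forall a, hom (F a) (G a)) :
  is_monnat F G s -> is_monnat G H t -> is_monnat F H (fun a => t a ∘ s a).
Proof.
move=> Hs Ht; split.
- move=> a a' f; rewrite -(cmpA HB) (monnat_nat Hs) !(cmpA HB).
  by rewrite (monnat_nat Ht).
- move=> a b; rewrite -(cmpA HB) (monnat_mu Hs) !(cmpA HB) (monnat_mu Ht) -(cmpA HB).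
  by rewrite (tmorM HB).
- by rewrite -(cmpA HB) (monnat_eps Hs) (monnat_eps Ht).
Qed.

End Transformation.

Section Insert.
Context {A X : brData}.

Definition insMonFun : monFunData A (prodMon A X) :=
  @MonFunData A (prodMon A X) (fun a => (a, mone)) (fun _ _ f => (f, idm mone))
    (fun a b => (idm (a ⊗ b), mlun mone)) (idm mone, idm mone).

(** In the second factor this is the constant functor at the unit, with a unitor as
    comparison; it is braided because the unit braids trivially with itself. *)
Lemma brfun_ins : is_braided A -> is_braided X ->
  is_brfun (A := A) (B := prodBr A X) insMonFun.
Proof.
move=> HA HX; have MA := br_is_mon HA; have MX := br_is_mon HX.
split; last first.
  move=> a b /=; rewrite (cmp1m MA) (cmpm1 MA); congr pair.
  by words HX; words_simpl MX.
split.
- split=> /=.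
  + by [].
  + by move=> *; rewrite (cmp1m MX).
  + by move=> *; rewrite (cmp1m MA) (cmpm1 MA) (tmor1 MX) (cmp1m MX) (cmpm1 MX).
  + move=> a b c; congr pair; last by words MX; words_simpl MX.
    by rewrite !(tmor1 MA) !(cmp1m MA) !(cmpm1 MA).
  + by move=> a; rewrite !(tmor1 MA) (tmor1 MX) !(cmpm1 MA) (cmp1m MX) (cmpm1 MX).
  + move=> a; rewrite !(tmor1 MA) (tmor1 MX) !(cmpm1 MA) (cmp1m MX) (cmpm1 MX).
    by rewrite (mlun_mrun_one MX).
- by move=> a b; apply: iso_pair; [exact: iso_id | exact: iso_mlun].
- by apply: iso_pair; exact: iso_id.
Qed.

End Insert.

(** * Weighted morphisms of an enriched category *)

(** A morphism [a -> L(x, y)] is seen as a morphism from [x] to [y] of weight [a];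
    weights multiply under composition.  Underlying morphisms are those of weight 1. *)
Definition wcmp (A : monData) (L : ecatData A) (x y z : L) (a b : A)
    (g : hom b (ehom y z)) (f : hom a (ehom x y)) : hom (b ⊗ a) (ehom x z) :=
  locked (ecmp x y z ∘ (g ⊠ f)).

Lemma wcmpE (A : monData) (L : ecatData A) (x y z : L) (a b : A)
    (g : hom b (ehom y z)) (f : hom a (ehom x y)) : wcmp g f = ecmp x y z ∘ (g ⊠ f).
Proof. by rewrite /wcmp -lock. Qed.

(** The shape of [enat_law], with weighted edges in place of the hom components of the
    two functors. *)
Definition wsquare (A : monData) (L : ecatData A) (x x' y y' : underCat L)
    (s : hom x x') (t : hom y y') (a : A) (f : hom a (ehom (e := L) x y))
    (f' : hom a (ehom (e := L) x' y')) : Prop :=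
  postcomp (L := L) x t ∘ f = precomp (L := L) s y' ∘ f'.

Section Weighted.
Context {A : monData} (HA : is_monoidal A) {L : ecatData A} (HL : is_ecat L).

Lemma wcmp_assoc (w x y z : L) (a b c : A) (h : hom c (ehom y z)) (g : hom b (ehom x y))
    (f : hom a (ehom w x)) :
  wcmp h (wcmp g f) ∘ massoc c b a = wcmp (wcmp h g) f.
Proof.
rewrite !wcmpE -{1}(cmp1m HA h) -(tmorM HA) -!(cmpA HA) -(mon_assoc_nat HA).
rewrite !(cmpA HA) (ecat_assoc HL) -(cmpA HA) (tmorM HA).
by rewrite (cmp1m HA).
Qed.

Lemma wcmp_cmp (x y z : L) (a a' b b' : A) (g : hom b (ehom y z)) (g' : hom b' b)
    (f : hom a (ehom x y)) (f' : hom a' a) :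
  wcmp (g ∘ g') (f ∘ f') = wcmp g f ∘ (g' ⊠ f').
Proof. by rewrite !wcmpE -(tmorM HA) (cmpA HA). Qed.

Lemma wcmp_cmpl (x y z : L) (a b b' : A) (g : hom b (ehom y z)) (g' : hom b' b)
    (f : hom a (ehom x y)) :
  wcmp (g ∘ g') f = wcmp g f ∘ (g' ⊠ idm a).
Proof. by rewrite -wcmp_cmp (cmpm1 HA). Qed.

Lemma wcmp_cmpr (x y z : L) (a a' b : A) (g : hom b (ehom y z))
    (f : hom a (ehom x y)) (f' : hom a' a) :
  wcmp g (f ∘ f') = wcmp g f ∘ (idm b ⊠ f').
Proof. by rewrite -wcmp_cmp (cmpm1 HA). Qed.

Lemma wcmp_idl (x y : L) (a : A) (f : hom a (ehom x y)) :
  wcmp (eid y) f = f ∘ mlun a.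
Proof.
rewrite -(mon_lun_nat HA) -(ecat_idl HL) !wcmpE -(cmpA HA) (tmorM HA).
by rewrite (cmp1m HA) (cmpm1 HA).
Qed.

Lemma wcmp_idr (x y : L) (a : A) (f : hom a (ehom x y)) :
  wcmp f (eid x) = f ∘ mrun a.
Proof.
rewrite -(mon_run_nat HA) -(ecat_idr HL) !wcmpE -(cmpA HA) (tmorM HA).
by rewrite (cmp1m HA) (cmpm1 HA).
Qed.

Lemma postcompE (w x y : underCat L) (t : hom x y) (a : A)
    (f : hom a (ehom (e := L) w x)) :
  postcomp (L := L) w t ∘ f = wcmp t f ∘ mlunV a.
Proof.
rewrite /postcomp !wcmpE -(cmpA HA) (mlunV_nat HA) (cmpA HA) -(cmpA HA _ (t ⊠ _)).
by rewrite (tmorM HA) (cmp1m HA) (cmpm1 HA).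
Qed.

Lemma precompE (x y w : underCat L) (s : hom x y) (a : A)
    (f : hom a (ehom (e := L) y w)) :
  precomp (L := L) s w ∘ f = wcmp f s ∘ mrunV a.
Proof.
rewrite /precomp !wcmpE -(cmpA HA) (mrunV_nat HA) (cmpA HA) -(cmpA HA _ (_ ⊠ s)).
by rewrite (tmorM HA) (cmp1m HA) (cmpm1 HA).
Qed.

Lemma wsquareE (x x' y y' : underCat L) (s : hom x x') (t : hom y y') (a : A)
    (f : hom a (ehom (e := L) x y)) (f' : hom a (ehom (e := L) x' y')) :
  wsquare s t f f' <-> wcmp t f ∘ mlunV a = wcmp f' s ∘ mrunV a.
Proof. by rewrite /wsquare postcompE precompE. Qed.

Lemma underE (x y z : underCat L) (g : hom y z) (f : hom x y) :
  g ∘ f = wcmp (L := L) g f ∘ mlunV mone.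
Proof. by rewrite wcmpE. Qed.

Lemma postcomp_cmp (w x y z : underCat L) (g : hom y z) (f : hom x y) (a : A)
    (h : hom a (ehom (e := L) w x)) :
  postcomp (L := L) w (g ∘ f) ∘ h = postcomp (L := L) w g ∘ (postcomp (L := L) w f ∘ h).
Proof.
rewrite !postcompE underE.
rewrite wcmp_cmpl wcmp_cmpr -wcmp_assoc -!(cmpA HA).
congr (_ ∘ _); rewrite !(cmpA HA); by words HA; words_simpl HA.
Qed.

Lemma precomp_cmp (w x y z : underCat L) (g : hom y z) (f : hom x y) (a : A)
    (h : hom a (ehom (e := L) z w)) :
  precomp (L := L) (g ∘ f) w ∘ h = precomp (L := L) f w ∘ (precomp (L := L) g w ∘ h).
Proof.
rewrite !precompE underE.
rewrite wcmp_cmpl wcmp_cmpr -wcmp_assoc -!(cmpA HA).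
congr (_ ∘ _); rewrite !(cmpA HA); by words HA; words_simpl HA.
Qed.

Lemma post_pre (x x' y y' : underCat L) (g : hom y y') (f : hom x x') (a : A)
    (h : hom a (ehom (e := L) x' y)) :
  postcomp (L := L) x g ∘ (precomp (L := L) f y ∘ h)
  = precomp (L := L) f y' ∘ (postcomp (L := L) x' g ∘ h).
Proof.
rewrite !precompE !postcompE.
rewrite wcmp_cmpl wcmp_cmpr -wcmp_assoc -!(cmpA HA).
congr (_ ∘ _); rewrite !(cmpA HA); by words HA; words_simpl HA.
Qed.

Lemma postcomp_id (w x : underCat L) (a : A) (h : hom a (ehom (e := L) w x)) :
  postcomp (L := L) w (idm x) ∘ h = h.
Proof. by rewrite postcompE wcmp_idl -(cmpA HA) (mlunVK HA) (cmpm1 HA). Qed.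

Lemma precomp_id (w x : underCat L) (a : A) (h : hom a (ehom (e := L) x w)) :
  precomp (L := L) (idm x) w ∘ h = h.
Proof. by rewrite precompE wcmp_idr -(cmpA HA) (mrunVK HA) (cmpm1 HA). Qed.

Lemma mlunV_mrunV1 : mlunV (mone : A) = mrunV mone.
Proof. by words HA. Qed.

Lemma postcomp_under (w x y : underCat L) (g : hom x y) (f : hom w x) :
  postcomp (L := L) w g ∘ f = g ∘ f.
Proof. by rewrite postcompE underE. Qed.

Lemma precomp_under (w x y : underCat L) (g : hom x y) (f : hom w x) :
  precomp (L := L) f y ∘ g = g ∘ f.
Proof. by rewrite precompE underE mlunV_mrunV1. Qed.

Lemma wsquare_vert (x x' x'' y y' y'' : underCat L) (s : hom x x') (s' : hom x' x'')
    (t : hom y y') (t' : hom y' y'') (a : A) (f : hom a (ehom (e := L) x y))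
    (f' : hom a (ehom (e := L) x' y')) (f'' : hom a (ehom (e := L) x'' y'')) :
  wsquare s t f f' -> wsquare s' t' f' f'' -> wsquare (s' ∘ s) (t' ∘ t) f f''.
Proof. by rewrite /wsquare postcomp_cmp precomp_cmp => -> E; rewrite post_pre E. Qed.

Lemma wsquare_precmp (x x' y y' : underCat L) (s : hom x x') (t : hom y y') (a b : A)
    (f : hom a (ehom (e := L) x y)) (f' : hom a (ehom (e := L) x' y')) (h : hom b a) :
  wsquare s t f f' -> wsquare s t (f ∘ h) (f' ∘ h).
Proof. by rewrite /wsquare !(cmpA HA) => ->. Qed.

Lemma wsquare_id (x y : underCat L) (a : A) (f : hom a (ehom (e := L) x y)) :
  wsquare (idm x) (idm y) f f.
Proof. by rewrite /wsquare postcomp_id precomp_id. Qed.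

(** Both composites are [s] itself. *)
Lemma wsquare_eid (x x' : underCat L) (s : hom x x') :
  wsquare s s (eid (e := L) x) (eid (e := L) x').
Proof.
rewrite wsquareE wcmp_idl wcmp_idr -!(cmpA HA) -mlunV_mrunV1 -(mlun_mrun_one HA).
by rewrite (mlunVK HA).
Qed.

Lemma wsquare_inv (x x' y y' : underCat L) (s : hom x x') (s' : hom x' x) (t : hom y y')
    (t' : hom y' y) (a : A) (f : hom a (ehom (e := L) x y))
    (f' : hom a (ehom (e := L) x' y')) :
  is_inverse s s' -> is_inverse t t' -> wsquare s t f f' -> wsquare s' t' f' f.
Proof.
move=> [Es Es'] [Et Et']; rewrite /wsquare => E.
rewrite -{1}(precomp_id f') -Es' precomp_cmp -E post_pre -postcomp_cmp Et.
by rewrite postcomp_id.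
Qed.

End Weighted.

Section EnrichedFunctor.
Context {A B : monData} (HA : is_monoidal A) (HB : is_monoidal B).
Context {L : ecatData A} {M : ecatData B}.

Definition wapp (F : efunData L M) (x y : L) (a : A) (f : hom a (ehom x y)) :
    hom (ef_bg F a) (ehom (F x) (F y)) :=
  ef_hom F x y ∘ fmor (ef_bg F) f.

Section One.
Context {F : efunData L M} (HF : is_efun F).
Let LF := efun_lax HF.

Lemma wapp_cmp (x y : L) (a b : A) (f : hom a (ehom x y)) (h : hom b a) :
  wapp F (f ∘ h) = wapp F f ∘ fmor (ef_bg F) h.
Proof. by rewrite /wapp -(cmpA HB) (fmorM LF). Qed.

Lemma wapp_wcmp (x y z : L) (a b : A) (g : hom b (ehom y z)) (f : hom a (ehom x y)) :
  wapp F (wcmp g f) ∘ fmu (ef_bg F) b a = wcmp (wapp F g) (wapp F f).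
Proof.
rewrite /wapp !wcmpE -(fmorM LF) -!(cmpA HB) -(lax_mu_nat LF).
rewrite (cmpA HB (fmor _ _)) (cmpA HB (ef_hom _ _ _)) (cmpA HB (ef_hom _ _ _)).
by rewrite (efun_cmp HF) -!(cmpA HB) (tmorM HB).
Qed.

Lemma fmor_mlunV (a : A) :
  fmor (ef_bg F) (mlunV a)
  = fmu (ef_bg F) mone a ∘ (feps (ef_bg F) ⊠ idm _) ∘ mlunV (ef_bg F a).
Proof.
apply: (iso_cancel_l HB (iso_fmor LF (iso_mlun HA a))).
by rewrite !(cmpA HB) (lax_lun LF) (mlunVK HB) (fmorM LF) (mlunVK HA) (fmor1 LF).
Qed.

Lemma fmor_mrunV (a : A) :
  fmor (ef_bg F) (mrunV a)
  = fmu (ef_bg F) a mone ∘ (idm _ ⊠ feps (ef_bg F)) ∘ mrunV (ef_bg F a).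
Proof.
apply: (iso_cancel_l HB (iso_fmor LF (iso_mrun HA a))).
by rewrite !(cmpA HB) (lax_run LF) (mrunVK HB) (fmorM LF) (mrunVK HA) (fmor1 LF).
Qed.

Lemma wsquare_wapp (x x' y y' : underCat L) (s : hom x x') (t : hom y y')
    (a : A) (f : hom a (ehom (e := L) x y)) (f' : hom a (ehom (e := L) x' y')) :
  wsquare s t f f' ->
  wsquare (L := M) (under_mor F s) (under_mor F t) (wapp F f) (wapp F f').
Proof.
rewrite !wsquareE // => E.
have {E} := f_equal (@wapp F _ _ _) E; rewrite !wapp_cmp fmor_mlunV fmor_mrunV.
rewrite !(cmpA HB) !wapp_wcmp -!wcmp_cmp // !(cmpm1 HB).
by [].
Qed.

End One.

(** The law for hom components gives it for every weighted morphism, each being a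
    pullback of the identity of its hom object. *)
Lemma wsquare_enat (F G : efunData L M) (t : enatData F G) (x y : L) (a : A)
    (f : hom a (ehom x y)) :
  is_enat t ->
  wsquare (L := M) (en_cmp t x) (en_cmp t y) (wapp F f) (wapp G f ∘ en_bg t a).
Proof.
move=> Ht; rewrite /wsquare /wapp.
rewrite -!(cmpA HB) -(monnat_nat (enat_monnat Ht)).
by rewrite !(cmpA HB) (enat_law Ht).
Qed.

Lemma enat_intro (F G : efunData L M) (t : enatData F G) :
  is_monnat (ef_bg F) (ef_bg G) (en_bg t) ->
  (forall x y : L, wsquare (L := M) (en_cmp t x) (en_cmp t y) (ef_hom F x y)
                       (ef_hom G x y ∘ en_bg t (ehom x y))) ->
  is_enat t.
Proof.
move=> Ht Hsq; split=> // x y; rewrite -(cmpA HB); exact: Hsq.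
Qed.

End EnrichedFunctor.

Arguments wapp {A B L M} F {x y a} f.

Section Transformation.
Context {A B : monData} (HB : is_monoidal B).

Lemma enat_inv (L : ecatData A) (M : ecatData B) (HM : is_ecat M) (F G : efunData L M)
    (t : enatData F G) (s : enatData G F) :
  (forall a, is_inverse (en_bg t a) (en_bg s a)) ->
  (forall x, is_inverse (en_cmp t x) (en_cmp s x)) ->
  is_enat t -> is_enat s.
Proof.
move=> Hb Hc Ht; apply: (enat_intro HB); first exact: monnat_inv Hb (enat_monnat Ht).
move=> x y; apply: (wsquare_inv HB HM (Hc x) (Hc y)).
have E := enat_law Ht x y; rewrite /wsquare (cmpA HB) E -!(cmpA HB).
by rewrite (proj2 (Hb _)) (cmpm1 HB).
Qed.

(** The pointwise inverses are collected into one transformation by choice. *)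
Lemma enatiso_intro (L : ecatData A) (M : ecatData B) (HM : is_ecat M)
    (F G : efunData L M) (t : enatData F G) :
  is_enat t -> (forall a, is_iso (en_bg t a)) -> (forall x, is_iso (en_cmp t x)) ->
  is_enatiso t.
Proof.
move=> Ht Hb Hc; split=> //.
pose sb a := constructive_indefinite_description _ (Hb a).
pose sc x := constructive_indefinite_description _ (Hc x).
pose s := EnatData G F (fun a => proj1_sig (sb a)) (fun x => proj1_sig (sc x)).
exists s; split.
  apply: (enat_inv HM (t := t) _ _ Ht) => i; exact: proj2_sig.
split; split=> i; by [case: (proj2_sig (sb i)) | case: (proj2_sig (sc i))].
Qed.

End Transformation.

Lemma emonnatiso_intro (A B : brData) (HB : is_braided B) (L : emonData A)
    (M : emonData B) (HM : is_emon M) (F G : emonFunData L M) (t : enatData F G) :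
  is_emonnat F G t -> (forall a, is_iso (en_bg t a)) -> (forall x, is_iso (en_cmp t x)) ->
  is_emonnatiso F G t.
Proof.
move=> Ht Hb Hc; split=> //.
have [_ [s [Hs [E E']]]] :=
  enatiso_intro (br_is_mon HB) (emon_ecat HM) (emonnat_enat Ht) Hb Hc.
exists s; split; last by [].
split=> //; apply: (monnat_inv (emon_under HM) _ (emonnat_under Ht)).
by move=> x; split; [exact: (proj2 E) | exact: (proj2 E')].
Qed.

(** * Enriched braided monoidal functors and the enriched Müger center *)

(** The enriched law at weight 1. *)
Lemma enat_under (A B : monData) (HB : is_monoidal B) (L : ecatData A) (M : ecatData B)
    (F G : efunData L M) (t : enatData F G) (x y : underCat L) (f : hom x y) :
  is_enat t ->
  cmp (c := underCat M) (en_cmp t y) (under_mor F f)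
  = cmp (c := underCat M) (under_mor G f) (en_cmp t x).
Proof.
move=> Ht; have H := @wsquare_enat _ _ HB _ _ F G t x y _ f Ht.
have := wsquare_precmp HB (feps (ef_bg F)) H; rewrite /wsquare -(cmpA HB).
rewrite (monnat_eps (enat_monnat Ht)) -[_ ∘ feps _]/(under_mor F f).
rewrite -[_ ∘ feps _]/(under_mor G f).
by rewrite (postcomp_under HB) (precomp_under HB).
Qed.

Lemma emonnat_intro (A B : brData) (L : emonData A) (M : emonData B) (HM : is_emon M)
    (F G : emonFunData L M) (t : enatData F G) :
  is_monnat (ef_bg F) (ef_bg G) (en_bg t) ->
  (forall x y : L, wsquare (L := M) (en_cmp t x) (en_cmp t y) (ef_hom F x y)
                       (ef_hom G x y ∘ en_bg t (ehom x y))) ->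
  (forall x y : L, cmp (c := underCat M) (en_cmp t (em_tob x y)) (emf_two F x y)
     = cmp (c := underCat M) (emf_two G x y)
         (tmor (m := underMon M) (en_cmp t x) (en_cmp t y))) ->
  cmp (c := underCat M) (en_cmp t em_one) (emf_zero F) = emf_zero G ->
  is_emonnat F G t.
Proof.
move=> Hb Hsq H2 H0.
have HB := br_is_mon (emon_bg HM).
have Ht : is_enat t by exact: enat_intro.
split=> //; split=> [x y f|//|//].
exact: (enat_under HB f Ht).
Qed.

Lemma monnat_feps (A B : monData) (HA : is_monoidal A) (HB : is_monoidal B)
    (F : monFunData A B) :
  is_lax F ->
  is_monnat (unitMonFun B) (compMonFun F (unitMonFun A)) (fun _ => feps F).
Proof.
move=> LF; split=> /=.
- by move=> _ _ _; rewrite (fmor1 LF) (cmp1m HB) (cmpm1 HB).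
- move=> _ _.
  have -> : feps F ⊠ feps F = (feps F ⊠ idm _) ∘ (idm _ ⊠ feps F).
    by rewrite (tmorM HB) (cmp1m HB) (cmpm1 HB).
  by rewrite (cmpA HB) (lax_lun LF) (mon_lun_nat HB).
- by rewrite (fmor1 LF) (cmp1m HB) (cmpm1 HB).
Qed.

(** The background comparisons are monoidal by [fmu_monnat], and the law of the unit
    comparison is the compatibility of the functor with identities.  What is left to
    check for a given functor is the law of its tensor comparison. *)
Lemma ebrfun_intro (L M : ebrData) (BA : is_braided (ebr_bg L)) (HM : is_ebr M)
    (F : emonFunData L M) :
  is_efun F -> is_brfun (ef_bg F) ->
  is_brfun (A := underBr L) (B := underBr M) (underMonFun F) ->
  (forall x y : prodEcat L L,
     wsquare (L := M) (emf_two F (fst x) (snd x)) (emf_two F (fst y) (snd y))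
       (ef_hom (compEfun (tensorEfun M) (prodEfun F F)) x y)
       (ef_hom (compEfun F (tensorEfun L)) x y
        ∘ fmu (ef_bg F) (ehom (fst x) (fst y)) (ehom (snd x) (snd y)))) ->
  is_ebrfun F.
Proof.
move=> HF Hb Hu Hsq.
have EM := ebr_is_emon HM; have BB := emon_bg EM.
have MA := br_is_mon BA; have MB := br_is_mon BB.
have LF := strong_lax (brfun_strong Hb).
split=> //; split=> //.
- apply: (enatiso_intro MB (emon_ecat EM)).
  + by apply: (enat_intro MB); [exact: fmu_monnat | exact: Hsq].
  + by move=> a; exact: (strong_mu (brfun_strong Hb)).
  + by move=> x; exact: (strong_mu (brfun_strong Hu)).
- apply: (enatiso_intro MB (emon_ecat EM)).
  + apply: (enat_intro MB); first exact: monnat_feps.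
    move=> x y /=; rewrite (efun_id HF); exact: (wsquare_eid MB (emon_ecat EM)).
  + by move=> a; exact: (strong_eps (brfun_strong Hb)).
  + by move=> x; exact: (strong_eps (brfun_strong Hu)).
- exact: brfun_strong Hu.
Qed.

(** The morphism part of an underlying functor is often a known one only up to a
    provable equation; this lemma absorbs it. *)
Lemma brfun_mor_ext (A B : brData) (F : monFunData A B)
    (m : forall a a' : A, hom a a' -> hom (F a) (F a')) :
  (forall a a' (f : hom a a'), m a a' f = fmor F f) ->
  is_brfun F -> is_brfun (MonFunData m (fmu F) (feps F)).
Proof.
move=> E [[[H1 H2 H3 H4 H5 H6] H7 H8] H9].
by split; [split=> //; split|] => *; rewrite /= !E; auto.
Qed.

Lemma lax_tensor (B : brData) : is_braided B -> is_lax (tensorMonFun B).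
Proof.
move=> HB; have HM := br_is_mon HB; split=> /=.
- by move=> a; rewrite (tmor1 HM).
- by move=> *; rewrite (tmorM HM).
- by move=> *; exact: midswap_nat.
- by move=> *; exact: midswap_assoc.
- by move=> *; exact: midswap_lun.
- by move=> *; exact: midswap_run.
Qed.

Section WeightedTensor.
Context {M : ebrData} (HM : is_ebr M).
Let EM := ebr_is_emon HM.
Let HC := br_is_mon (emon_bg EM).
Let HL := emon_ecat EM.
Local Notation C := (ebr_bg M).
Local Notation U := (underBr M).

(** The tensor product of weighted morphisms, locked for the same reason as [swap]. *)
Definition wtensor (x x' y y' : M) (a b : C) (f : hom a (ehom x y)) (g : hom b (ehom x' y')) :
    hom (a ⊗ b) (ehom (em_tob x x') (em_tob y y')) :=
  locked (em_thom x y x' y' ∘ (f ⊠ g)).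

Lemma wtensorE (x x' y y' : M) (a b : C) (f : hom a (ehom x y)) (g : hom b (ehom x' y')) :
  wtensor f g = em_thom x y x' y' ∘ (f ⊠ g).
Proof. by rewrite /wtensor -lock. Qed.

Lemma wtensor_cmp (x x' y y' : M) (a a' b b' : C) (f : hom a (ehom x y))
    (g : hom b (ehom x' y')) (h : hom a' a) (k : hom b' b) :
  wtensor (f ∘ h) (g ∘ k) = wtensor f g ∘ (h ⊠ k).
Proof. by rewrite !wtensorE -(tmorM HC) (cmpA HC). Qed.

Lemma wtensor1 (x x' y y' : M) :
  wtensor (idm (ehom x y)) (idm (ehom x' y')) = em_thom x y x' y'.
Proof. by rewrite wtensorE (tmor1 HC) (cmpm1 HC). Qed.

Lemma wsquare_wtensor (x x' y y' z z' w w' : U) (s : hom x x') (t : hom y y') (k : hom z z')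
    (l : hom w w') (a b : C) (f : hom a (ehom (e := M) x y))
    (f' : hom a (ehom (e := M) x' y')) (g : hom b (ehom (e := M) z w))
    (g' : hom b (ehom (e := M) z' w')) :
  wsquare (L := M) s t f f' -> wsquare (L := M) k l g g' ->
  wsquare (L := M) (s ⊠ k : hom (c := U) (x ⊗ z) (x' ⊗ z'))
    (t ⊠ l : hom (c := U) (y ⊗ w) (y' ⊗ w')) (wtensor f g) (wtensor f' g').
Proof.
move=> H K; rewrite !wtensorE.
have Hp : wsquare (L := prodEcat M M) (x := (x, z)) (x' := (x', z')) (y := (y, w))
    (y' := (y', w')) (s, k) (t, l) (a := (a, b)) (f, g) (f', g').
  by rewrite /wsquare /= -[_ ∘ f]/(postcomp (L := M) x t ∘ f) H; congr pair; exact: K.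
exact: (@wsquare_wapp _ _ (monoidal_prod HC HC) HC _ _ _ (emon_tensor EM)
  (x, z) (x', z') (y, w) (y', w') (s, k) (t, l) (a, b) (f, g) (f', g') Hp).
Qed.

(** The enriched associator, read on weighted morphisms. *)
Lemma wsquare_massoc (x y z x' y' z' : U) (a b c : C) (f : hom a (ehom (e := M) x x'))
    (g : hom b (ehom (e := M) y y')) (h : hom c (ehom (e := M) z z')) :
  wsquare (L := M) (massoc x y z) (massoc x' y' z')
    (wtensor (wtensor f g) h) (wtensor f (wtensor g h) ∘ massoc a b c).
Proof.
have := @wsquare_enat _ _ HC _ _ _ _ (assocEnat M) ((x, y), z) ((x', y'), z')
  ((a, b), c) ((f, g), h) (proj1 (emon_assoc EM)).
by rewrite /wapp /= !(tmor1 HC) (cmpm1 HC) !wtensorE (tmor_cmpl HC) (tmor_cmpr HC) !(cmpA HC).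
Qed.

Lemma wsquare_braid (x y x' y' : U) (a b : C) (f : hom a (ehom (e := M) x x'))
    (g : hom b (ehom (e := M) y y')) :
  wsquare (L := M) (braid x y) (braid x' y') (wtensor f g) (wtensor g f ∘ braid a b).
Proof.
have := @wsquare_enat _ _ HC _ _ _ _ (braidEnat M) (x, y) (x', y') (a, b) (f, g)
  (proj1 (ebr_braid_enat HM)).
by rewrite /wapp /= (tmor1 HC) (cmpm1 HC) !wtensorE.
Qed.

Lemma wsquare_mlun (x x' : U) (a : C) (f : hom a (ehom (e := M) x x')) :
  wsquare (L := M) (mlun x) (mlun x') (wtensor (eid em_one) f) (f ∘ mlun a).
Proof.
have := @wsquare_enat _ _ HC _ _ _ _ (lunEnat M) (tt, x) (tt, x') (tt, a) (tt, f)
  (proj1 (emon_lun EM)).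
by rewrite /wapp /= (cmp1m HC) !wtensorE -(cmpA HC) (tmorM HC) (cmp1m HC) (cmpm1 HC).
Qed.

Lemma wsquare_mrun (x x' : U) (a : C) (f : hom a (ehom (e := M) x x')) :
  wsquare (L := M) (mrun x) (mrun x') (wtensor f (eid em_one)) (f ∘ mrun a).
Proof.
have := @wsquare_enat _ _ HC _ _ _ _ (runEnat M) (x, tt) (x', tt) (a, tt) (f, tt)
  (proj1 (emon_run EM)).
by rewrite /wapp /= (cmp1m HC) !wtensorE -(cmpA HC) (tmorM HC) (cmp1m HC) (cmpm1 HC).
Qed.

Lemma wsquare_massocV (x y z x' y' z' : U) (a b c : C) (f : hom a (ehom (e := M) x x'))
    (g : hom b (ehom (e := M) y y')) (h : hom c (ehom (e := M) z z')) :
  wsquare (L := M) (massocV x y z) (massocV x' y' z')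
    (wtensor f (wtensor g h)) (wtensor (wtensor f g) h ∘ massocV a b c).
Proof.
have HU := emon_under EM.
have := wsquare_inv HC HL (mon_assoc_inv HU x y z) (mon_assoc_inv HU x' y' z')
  (wsquare_massoc f g h).
move/(wsquare_precmp HC (massocV a b c)).
by rewrite -(cmpA HC) (massocVK HC) (cmpm1 HC).
Qed.

Lemma wtensor_cmpr (x x' y y' : M) (a b b' : C) (f : hom a (ehom x y))
    (g : hom b (ehom x' y')) (k : hom b' b) :
  wtensor f (g ∘ k) = wtensor f g ∘ (idm a ⊠ k).
Proof. by rewrite -wtensor_cmp (cmpm1 HC). Qed.

Lemma wtensor_cmpl (x x' y y' : M) (a b a' : C) (f : hom a (ehom x y))
    (g : hom b (ehom x' y')) (k : hom a' a) :
  wtensor (f ∘ k) g = wtensor f g ∘ (k ⊠ idm b).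
Proof. by rewrite -wtensor_cmp (cmpm1 HC). Qed.

(** The interchange is composed of associators and one braiding; the squares of these
    are pasted, those for the inner factors after tensoring with an identity. *)
Lemma wsquare_midswap (x y z w x' y' z' w' : U) (a b c d : C)
    (f : hom a (ehom (e := M) x x')) (g : hom b (ehom (e := M) y y'))
    (h : hom c (ehom (e := M) z z')) (k : hom d (ehom (e := M) w w')) :
  wsquare (L := M) (midswap (A := U) x y z w) (midswap (A := U) x' y' z' w')
    (wtensor (wtensor f g) (wtensor h k)) (wtensor (wtensor f h) (wtensor g k) ∘ midswap a b c d).
Proof.
have S1 := wsquare_massocV g h k.
have S2 := wsquare_wtensor (wsquare_braid g h) (wsquare_id HC HL k).
have S3 := wsquare_massoc h g k.
rewrite wtensor_cmpl in S2.
have S23 := wsquare_vert HC HL S2 (wsquare_precmp HC _ S3).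
have S123 := wsquare_vert HC HL S1 (wsquare_precmp HC _ S23).
rewrite -!(cmpA HC) in S123.
have T := wsquare_wtensor (wsquare_id HC HL f) S123.
rewrite [wtensor f (_ ∘ _)]wtensor_cmpr in T.
have V := wsquare_vert HC HL T (wsquare_precmp HC _ (wsquare_massocV f h (wtensor g k))).
have W := wsquare_vert HC HL (wsquare_massoc f g (wtensor h k)) (wsquare_precmp HC _ V).
by rewrite !(cmpA HC) in W; rewrite /midswap !(cmpA HC).
Qed.

End WeightedTensor.

Section MugerCenter.
Context {M : ebrData} (HM : is_ebr M).
Let EM := ebr_is_emon HM.
Let HC := br_is_mon (emon_bg EM).
Let HU := ebr_under HM.
Let HUM := br_is_mon HU.
Local Notation Z := (mugerCenter HM).
Local Notation pr := (@proj1_sig M _).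

Lemma ecat_muger : is_ecat (mugerEcat M).
Proof.
split=> *; [exact: (ecat_assoc (emon_ecat EM)) | exact: (ecat_idl (emon_ecat EM))
  | exact: (ecat_idr (emon_ecat EM))].
Qed.

Lemma monoidal_muger : is_monoidal (underMon Z).
Proof.
split.
- split=> *; [exact: (cmp1m HUM) | exact: (cmpm1 HUM) | exact: (cmpA HUM)].
- by move=> a b; exact: (mon_tid HUM (pr a) (pr b)).
- by move=> a a' a'' b b' b'' f' f g' g;
    exact: (@mon_tcmp _ HUM (pr a) (pr a') (pr a'') (pr b) (pr b') (pr b'') f' f g' g).
- by move=> a b c; exact: (mon_assoc_inv HUM (pr a) (pr b) (pr c)).
- by move=> a; exact: (mon_lun_inv HUM (pr a)).
- by move=> a; exact: (mon_run_inv HUM (pr a)).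
- by move=> a a' b b' c c' f g h;
    exact: (@mon_assoc_nat _ HUM (pr a) (pr a') (pr b) (pr b') (pr c) (pr c') f g h).
- by move=> a a' f; exact: (@mon_lun_nat _ HUM (pr a) (pr a') f).
- by move=> a a' f; exact: (@mon_run_nat _ HUM (pr a) (pr a') f).
- by move=> a b c d; exact: (mon_pentagon HUM (pr a) (pr b) (pr c) (pr d)).
- by move=> a b; exact: (mon_triangle HUM (pr a) (pr b)).
Qed.

Lemma braided_muger : is_braided (underBr Z).
Proof.
split.
- exact: monoidal_muger.
- by move=> a b; exact: (br_iso HU (pr a) (pr b)).
- by move=> a a' b b' f g; exact: (@br_nat _ HU (pr a) (pr a') (pr b) (pr b') f g).
- by move=> a b c; exact: (br_hex1 HU (pr a) (pr b) (pr c)).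
- by move=> a b c; exact: (br_hex2 HU (pr a) (pr b) (pr c)).
Qed.

Lemma efun_muger_tensor : is_efun (tensorEfun Z).
Proof.
have HT := emon_tensor EM; split.
- exact: (efun_lax HT).
- by move=> x; exact: (efun_id HT (pr (fst x), pr (snd x))).
- by move=> x y z; exact: (efun_cmp HT (pr (fst x), pr (snd x))
    (pr (fst y), pr (snd y)) (pr (fst z), pr (snd z))).
Qed.

Lemma ebr_muger : is_ebr Z.
Proof.
have R := ecat_muger.
split.
- exact: (ebr_bg_sym HM).
- split.
  + exact: emon_bg EM.
  + exact: ecat_muger.
  + exact: efun_muger_tensor.
  + have Ha := proj1 (emon_assoc EM).
    apply: (enatiso_intro HC R).
    * split; first exact: (enat_monnat Ha).
      move=> [[x y] z] [[x' y'] z'].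
      exact: (enat_law Ha ((pr x, pr y), pr z) ((pr x', pr y'), pr z')).
    * by move=> a; exact: (iso_massoc HC).
    * by move=> [[x y] z]; exact: (iso_massoc monoidal_muger x y z).
  + have Ha := proj1 (emon_lun EM).
    apply: (enatiso_intro HC R).
    * split; first exact: (enat_monnat Ha).
      by move=> [[] x] [[] x']; exact: (enat_law Ha (tt, pr x) (tt, pr x')).
    * by move=> a; exact: (iso_mlun HC).
    * by move=> [[] x]; exact: (iso_mlun monoidal_muger x).
  + have Ha := proj1 (emon_run EM).
    apply: (enatiso_intro HC R).
    * split; first exact: (enat_monnat Ha).
      by move=> [x []] [x' []]; exact: (enat_law Ha (pr x, tt) (pr x', tt)).
    * by move=> a; exact: (iso_mrun HC).
    * by move=> [x []]; exact: (iso_mrun monoidal_muger x).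
  + exact: monoidal_muger.
- have Ha := proj1 (ebr_braid_enat HM).
  apply: (enatiso_intro HC R).
  + split; first exact: (enat_monnat Ha).
    move=> [x y] [x' y']; exact: (enat_law Ha (pr x, pr y) (pr x', pr y')).
  + by move=> [a b]; exact: (br_iso (emon_bg EM)).
  + by move=> [x y]; exact: (br_iso braided_muger x y).
- exact: braided_muger.
Qed.

End MugerCenter.

(** * The action of the Müger center *)

Lemma unit_eq (a b : unit) : a = b.
Proof. by case: a; case: b. Qed.

Lemma braided_unit : is_braided unitBr.
Proof.
have I (x y : unitCat) (f : hom x y) : is_iso f.
  by exists tt; split; exact: unit_eq.
by split; [split; [split|..]|..]; try (by move=> *; exact: I);
  try (by move=> *; split; exact: unit_eq); move=> *; exact: unit_eq.
Qed.

Lemma brfun_unit (X : brData) :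
  is_braided X -> is_brfun (A := unitBr) (B := X) (unitMonFun X).
Proof.
move=> HX; have MX := br_is_mon HX.
split; [split; [split|..]|] => /=.
- by [].
- by move=> *; rewrite (cmp1m MX).
- by move=> *; rewrite (tmor1 MX) (cmp1m MX) (cmpm1 MX).
- by move=> *; words MX; words_simpl MX.
- by move=> *; words MX; words_simpl MX.
- by move=> *; words MX; words_simpl MX.
- by move=> *; exact: iso_mlun.
- exact: iso_id.
- by move=> *; words HX; words_simpl MX.
Qed.

Lemma ebrfun_unit (L : ebrData) : is_ebr L -> is_ebrfun (unitEmonFun L).
Proof.
move=> HL; have EL := ebr_is_emon HL; have HC := br_is_mon (emon_bg EL).
apply: (ebrfun_intro (L := unitEbr) braided_unit HL).
- split.
  + exact: strong_lax (brfun_strong (brfun_unit (emon_bg EL))).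
  + by move=> x /=; rewrite !(cmpm1 HC).
  + move=> x y z /=; rewrite (cmpm1 HC) -[RHS]wcmpE.
    by rewrite (wcmp_idl HC (emon_ecat EL)).
- exact: brfun_unit (emon_bg EL).
- apply: (brfun_mor_ext (A := unitBr) (B := underBr L) (F := unitMonFun (underMon L)) _
    (brfun_unit (ebr_under HL))) => a a' f.
  by rewrite /under_mor /= !(cmpm1 HC).
- move=> x y /=; rewrite !(cmpm1 HC) -wtensorE; exact: (wsquare_mlun HL).
Qed.

(** Transparent objects form a full braided subcategory, so that being braided
    monoidal can be tested in the ambient category. *)
Lemma brfun_corestrict (M : ebrData) (HM : is_ebr M) (A : brData)
    (F : monFunData A (underBr (mugerCenter HM))) :
  is_brfun (A := A) (B := underBr M)
    (@MonFunData A (underBr M) (fun a => proj1_sig (F a)) (@fmor _ _ F) (fmu F) (feps F)) ->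
  is_brfun (A := A) (B := underBr (mugerCenter HM)) F.
Proof.
move=> HF; have [[HL Hmu He] Hb] := HF.
split; [split; [split|..]|].
- exact: (lax_id HL).
- exact: (lax_cmp HL).
- exact: (lax_mu_nat HL).
- exact: (lax_assoc HL).
- exact: (lax_lun HL).
- exact: (lax_run HL).
- exact: Hmu.
- exact: He.
- exact: Hb.
Qed.

Section MugerAction.
Context {M : ebrData} (HM : is_ebr M).
Let EM := ebr_is_emon HM.
Let BC := emon_bg EM.
Let HC := br_is_mon BC.
Let HU := ebr_under HM.
Let HUM := br_is_mon HU.
Local Notation Z := (mugerCenter HM).
Local Notation pr := (@proj1_sig M _).
Local Notation U := (underBr M).

(** In a symmetric category every object is transparent. *)
Lemma brfun_tensor_sym (B : brData) :
  is_symmetric B -> is_brfun (A := prodBr B B) (tensorMonFun B).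
Proof.
move=> [HB Hs]; split; [split|].
- exact: lax_tensor.
- by move=> a b; exact: iso_midswap.
- exact: iso_mlunV (br_is_mon HB) _.
- by move=> [a b] [c d] /=; apply: (midswap_braid HB) => z; exact: Hs.
Qed.

Lemma efun_mugerTensor : is_efun (mugerTensorEfun HM).
Proof.
have HT := emon_tensor EM; split.
- exact: (efun_lax HT).
- by move=> x; exact: (efun_id HT (pr (fst x), snd x)).
- by move=> x y z; exact: (efun_cmp HT (pr (fst x), snd x)
    (pr (fst y), snd y) (pr (fst z), snd z)).
Qed.

(** Tensoring is always monoidal for the interchange; it respects the braidings
    because the left factors are transparent. *)
Lemma brfun_mugerTensor :
  is_brfun (A := underBr (prodEbr Z M)) (B := U) (underMonFun (mugerTensor HM)).
Proof.
have LT := lax_tensor HU.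
split; [split; [split|..]|].
- by move=> [a b]; exact: (lax_id LT (pr a, b)).
- move=> [a b] [a' b'] [a'' b''] g f.
  exact: (@lax_cmp _ _ _ LT (pr a, b) (pr a', b') (pr a'', b'') g f).
- move=> [a b] [a' b'] [c d] [c' d'] f g.
  exact: (@lax_mu_nat _ _ _ LT (pr a, b) (pr a', b') (pr c, d) (pr c', d') f g).
- by move=> [a b] [a' b'] [c d]; exact: (lax_assoc LT (pr a, b) (pr a', b') (pr c, d)).
- by move=> [a b]; exact: (lax_lun LT (pr a, b)).
- by move=> [a b]; exact: (lax_run LT (pr a, b)).
- by move=> [a b] [c d]; exact: (iso_midswap HU (pr a) b (pr c) d).
- exact: (iso_mlunV HUM).
- by move=> [[a Ha] b] [c d]; exact: (midswap_braid HU (a1 := a)).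
Qed.

Lemma ebrfun_mugerTensor : is_ebrfun (mugerTensor HM).
Proof.
apply: (ebrfun_intro (L := prodEbr Z M) (braided_prod BC BC) HM).
- exact: efun_mugerTensor.
- exact: brfun_tensor_sym (ebr_bg_sym HM).
- exact: brfun_mugerTensor.
- move=> [[x x'] [y y']] [[z z'] [w w']].
  have := wsquare_midswap HM (idm (ehom (pr x) (pr z))) (idm (ehom x' z'))
    (idm (ehom (pr y) (pr w))) (idm (ehom y' w')).
  by rewrite !(wtensor1 HM) !wtensorE.
Qed.

Lemma act_muger : is_act (mugerAction HM).
Proof.
have Hz := ebr_muger HM.
split.
- exact: Hz.
- exact: ebrfun_unit Hz.
- exact: ebrfun_mugerTensor.
- have Hl := proj1 (emon_lun EM).
  apply: (emonnatiso_intro BC EM).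
  + apply: (emonnat_intro EM).
    * exact: (enat_monnat Hl).
    * move=> x y; have E := enat_law Hl x y; rewrite /wsquare (cmpA HC); exact: E.
    * move=> [[] x] [[] y]; rewrite -[RHS]/(cmp (c := underCat M) (idm _) _) (cmp1m HUM).
      exact: (mlun_tmor HU).
    * rewrite -[LHS]/(mlun (mone : U) ∘ ((idm (mone : U) ⊠ idm (mone : U)) ∘ mlunV (mone : U))).
      by rewrite (tmor1 HUM) (cmp1m HUM); exact: (mlunVK HUM).
  + by move=> a; exact: (iso_mlun HC).
  + by move=> x; exact: (iso_mlun HUM).
Qed.

End MugerAction.

(** * Actions of ordinary braided monoidal categories *)

Section Bifunctor.
Context {A X Y : brData} (G : monFunData (prodBr A X) Y).

Definition bmor (a a' : A) (x x' : X) (f : hom a a') (g : hom x x') :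
    hom (G (a, x)) (G (a', x')) :=
  @fmor (prodBr A X) Y G (a, x) (a', x') (f, g).

Definition bmu (a b : A) (x y : X) : hom (G (a, x) ⊗ G (b, y)) (G (a ⊗ b, x ⊗ y)) :=
  fmu G (a, x) (b, y).

Context (HG : is_lax G).

Lemma bmorM (a a' a'' : A) (x x' x'' : X) (f' : hom a' a'') (g' : hom x' x'')
    (f : hom a a') (g : hom x x') :
  bmor f' g' ∘ bmor f g = bmor (f' ∘ f) (g' ∘ g).
Proof. exact: (fmorM HG). Qed.

Lemma bmor1 (a : A) (x : X) : bmor (idm a) (idm x) = idm _.
Proof. exact: (fmor1 HG). Qed.

Lemma bmu_nat (a a' b b' : A) (x x' y y' : X) (f : hom a a') (g : hom x x')
    (f' : hom b b') (g' : hom y y') :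
  bmu a' b' x' y' ∘ (bmor f g ⊠ bmor f' g')
  = bmor (f ⊠ f') (g ⊠ g') ∘ bmu a b x y.
Proof.
exact: (@lax_mu_nat _ _ _ HG (a, x) (a', x') (b, y) (b', y') (f, g) (f', g')).
Qed.

Lemma iso_bmor (a a' : A) (x x' : X) (f : hom a a') (g : hom x x') :
  is_iso f -> is_iso g -> is_iso (bmor f g).
Proof. by move=> Hf Hg; apply: (iso_fmor HG); exact: iso_pair. Qed.

End Bifunctor.

Section Action.
Context {A X : brData} (HA : is_braided A) (HX : is_braided X).
Context {G : monFunData (prodBr A X) X} (HG : is_brfun G).
Context {u : monFunData unitMon A} (Hu : is_strong u).
Context {alpha : forall x : prodMon unitMon X,
  hom (compMonFun G (prodMonFun u (idMonFun X)) x) (sndMonFun unitMon X x)}.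
Context (Halpha : is_monnat (compMonFun G (prodMonFun u (idMonFun X)))
                            (sndMonFun unitMon X) alpha).
Context {alphaV : forall x : prodMon unitMon X,
  hom (sndMonFun unitMon X x) (compMonFun G (prodMonFun u (idMonFun X)) x)}.
Context (HalphaV : forall x, is_inverse (alpha x) (alphaV x)).
Context {v : hom (u tt) mone} (Hv : is_inverse (feps u) v).
Let MA := br_is_mon HA.
Let MX := br_is_mon HX.
Let LG := strong_lax (brfun_strong HG).
Let Lu := strong_lax Hu.

(** The action of the unit object.  The given unitor [alpha] lives at [u tt], which
    [feps u] identifies with the unit.  Locked for the same reason as [swap]. *)
Definition unitAct (m : X) : hom (G (mone, m)) m :=
  locked (alpha (tt, m) ∘ bmor G (feps u) (idm m)).

Lemma unitActE (m : X) : unitAct m = alpha (tt, m) ∘ bmor G (feps u) (idm m).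
Proof. by rewrite /unitAct -lock. Qed.

Definition unitActV (m : X) : hom m (G (mone, m)) :=
  locked (bmor G v (idm m) ∘ alphaV (tt, m)).

Lemma unitActVE (m : X) : unitActV m = bmor G v (idm m) ∘ alphaV (tt, m).
Proof. by rewrite /unitActV -lock. Qed.

Lemma unitActK (m : X) : is_inverse (unitAct m) (unitActV m).
Proof.
rewrite unitActE unitActVE; apply: (inverse_cmp MX); last exact: (HalphaV (tt, m)).
case: Hv => E1 E2.
by split; rewrite (bmorM LG) (cmp1m MX) ?E1 ?E2 (bmor1 LG).
Qed.

Lemma unitAct_nat (m m' : X) (f : hom m m') :
  unitAct m' ∘ bmor G (idm mone) f = f ∘ unitAct m.
Proof.
rewrite !unitActE -(cmpA MX) (bmorM LG) (cmp1m MX) (cmpm1 MA).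
have E := monnat_nat Halpha (a := (tt, m)) (a' := (tt, m')) (tt, f).
rewrite /= in E.
rewrite (cmpA MX) -E -(cmpA MX); congr (_ ∘ _).
have -> : fmor u (a := tt) (a' := tt) tt = idm (u tt) by exact: (fmor1 Lu).
by rewrite (bmorM LG) (cmp1m MA) (cmpm1 MX).
Qed.

(** For a functor out of the terminal category the comparison [fmu u] is determined
    by [feps u]: it is the unitor, moved along [feps u]. *)
Lemma unit_fmu : fmu u tt tt ∘ (feps u ⊠ feps u) = feps u ∘ mlun mone.
Proof.
have E := lax_lun Lu tt.
have Eu : fmor u (a := tt) (a' := tt) tt = idm (u tt) by exact: (fmor1 Lu).
rewrite /= Eu (cmp1m MA) in E.
rewrite -(mon_lun_nat MA) -E -(cmpA MA) (tmorM MA).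
by rewrite (cmp1m MA) (cmpm1 MA).
Qed.

Lemma unitAct_mu (m n : X) :
  unitAct (m ⊗ n) ∘ (bmor G (mlun mone) (idm _) ∘ bmu G mone mone m n)
  = unitAct m ⊠ unitAct n.
Proof.
have E := monnat_mu Halpha (tt, m) (tt, n).
rewrite /= (cmp1m MX) in E.
have Eb : bmor G (feps u) (idm (m ⊗ n)) ∘ (bmor G (mlun mone) (idm _) ∘ bmu G mone mone m n)
  = bmor G (fmu u tt tt) (idm _) ∘ bmu G (u tt) (u tt) m n
    ∘ (bmor G (feps u) (idm m) ⊠ bmor G (feps u) (idm n)).
  rewrite -(cmpA MX) (bmu_nat LG) !(cmpA MX) !(bmorM LG) unit_fmu (tmor1 MX).
  by rewrite (cmp1m MX).
by rewrite !unitActE -(cmpA MX) Eb (cmpA MX) E (tmorM MX).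
Qed.

Lemma unitActV_nat (m m' : X) (f : hom m m') :
  unitActV m' ∘ f = bmor G (idm mone) f ∘ unitActV m.
Proof.
have [E1 E2] := unitActK m; have [E1' E2'] := unitActK m'.
rewrite -[LHS](cmpm1 MX) -E2 (cmpA MX) -(cmpA MX _ f) -unitAct_nat.
by rewrite !(cmpA MX) E1' (cmp1m MX).
Qed.

Lemma unitActV_mu (m n : X) :
  unitActV (m ⊗ n)
  = bmor G (mlun mone) (idm _) ∘ bmu G mone mone m n ∘ (unitActV m ⊠ unitActV n).
Proof.
have H := unitActK (m ⊗ n).
have [_ Ei] := inverse_tmor MX (unitActK m) (unitActK n).
apply: (iso_cancel_l MX (iso_inv H)).
by rewrite (proj2 H) !(cmpA MX) -(cmpA MX (unitAct _)) unitAct_mu Ei.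
Qed.

Lemma unitAct_eps : unitAct mone ∘ feps G = idm mone.
Proof.
have E := monnat_eps Halpha; rewrite /= in E.
by rewrite unitActE -{2}E (cmpA MX).
Qed.

(** The unit comparison of the action is thus determined by [alpha]. *)
Lemma feps_unitActV : feps G = unitActV mone.
Proof.
apply: (iso_cancel_l MX (iso_inv (unitActK mone))).
by rewrite unitAct_eps (proj2 (unitActK mone)).
Qed.

(** The functor [a ↦ G (a, 1)]. *)
Definition actOn1 : monFunData A X := compMonFun G (@insMonFun A X).

Lemma brfun_actOn1 : is_brfun actOn1.
Proof. apply: (brfun_comp MX); [exact: brfun_ins | exact: HG]. Qed.

(** The product of [(a, 1)] and [(1, m)], carried over by the action. *)
Definition rho (a : A) (m : X) : hom (G (a, mone) ⊗ m) (G (a, m)) :=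
  bmor G (mrun a) (mlun m) ∘ bmu G a mone mone m ∘ (idm (G (a, mone)) ⊠ unitActV m).

Lemma iso_rho (a : A) (m : X) : is_iso (rho a m).
Proof.
rewrite /rho.
apply: (iso_cmp MX).
  apply: (iso_tmor MX); first exact: iso_id.
  by exists (unitAct m); apply: inverse_sym; exact: unitActK.
apply: (iso_cmp MX); first exact: (strong_mu (brfun_strong HG)).
by apply: (iso_bmor LG); [exact: iso_mrun | exact: iso_mlun].
Qed.

Lemma rho_nat (a a' : A) (m m' : X) (f : hom a a') (g : hom m m') :
  rho a' m' ∘ (bmor G f (idm mone) ⊠ g) = bmor G f g ∘ rho a m.
Proof.
rewrite /rho -(cmpA MX) (tmorM MX) (cmp1m MX) unitActV_nat.
rewrite -(cmpm1 MX (bmor G f (idm mone))) -(tmorM MX) !(cmpA MX).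
rewrite (under_left MX _ (bmu_nat LG _ _ _ _)) !(cmpA MX); congr (_ ∘ _ ∘ _).
by rewrite !(bmorM LG) (mon_run_nat MA) (mon_lun_nat MX).
Qed.

(** [rho] is a composite of [unitActV], the comparison of [G] and unitors.  Each of
    these is monoidal, for the interchange on the side of the tensor product; the
    comparison of [G] is so by [fmu_midswap]. *)
Lemma rho_mu (a a' : A) (m m' : X) :
  rho (a ⊗ a') (m ⊗ m')
    ∘ (((bmor G (idm (a ⊗ a')) (mlun mone) ∘ bmu G a a' mone mone) ⊠ idm (m ⊗ m'))
       ∘ midswap (G (a, mone)) m (G (a', mone)) m')
  = bmu G a a' m m' ∘ (rho a m ⊠ rho a' m').
Proof.
have E : (idm (G (a ⊗ a', mone)) ⊠ unitActV (m ⊗ m'))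
       ∘ ((bmor G (idm (a ⊗ a')) (mlun mone) ∘ bmu G a a' mone mone) ⊠ idm (m ⊗ m'))
     = (bmor G (idm (a ⊗ a')) (mlun mone) ⊠ bmor G (mlun mone) (idm (m ⊗ m')))
       ∘ (bmu G a a' mone mone ⊠ bmu G mone mone m m')
       ∘ ((idm (G (a, mone)) ⊠ idm (G (a', mone))) ⊠ (unitActV m ⊠ unitActV m')).
  by rewrite unitActV_mu !(tmorM MX) (cmp1m MX) (cmpm1 MX) (tmor1 MX) (cmpm1 MX).
have E' : (idm (G (a ⊗ a', mone)) ⊠ unitActV (m ⊗ m'))
       ∘ (((bmor G (idm (a ⊗ a')) (mlun mone) ∘ bmu G a a' mone mone) ⊠ idm (m ⊗ m'))
          ∘ midswap (G (a, mone)) m (G (a', mone)) m')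
     = (bmor G (idm (a ⊗ a')) (mlun mone) ⊠ bmor G (mlun mone) (idm (m ⊗ m')))
       ∘ ((bmu G a a' mone mone ⊠ bmu G mone mone m m')
          ∘ midswap (G (a, mone)) (G (mone, m)) (G (a', mone)) (G (mone, m')))
       ∘ ((idm (G (a, mone)) ⊠ unitActV m) ⊠ (idm (G (a', mone)) ⊠ unitActV m')).
  rewrite (cmpA MX _ _ (midswap _ _ _ _)) E -(cmpA MX _ _ (midswap _ _ _ _)).
  by rewrite -(midswap_nat HX) (cmpA MX) -(cmpA MX (bmor _ _ _ ⊠ _)).
have F := fmu_midswap (braided_prod HA HX) HX HG (a, mone) (mone, m) (a', mone) (mone, m').
have F' : bmu G (a ⊗ a') (mone ⊗ mone) (mone ⊗ mone) (m ⊗ m')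
    ∘ ((bmu G a a' mone mone ⊠ bmu G mone mone m m')
       ∘ midswap (G (a, mone)) (G (mone, m)) (G (a', mone)) (G (mone, m')))
  = bmor G (midswap a mone a' mone) (midswap mone m mone m')
    ∘ bmu G (a ⊗ mone) (a' ⊗ mone) (mone ⊗ m) (mone ⊗ m')
    ∘ (bmu G a mone mone m ⊠ bmu G a' mone mone m') by exact: F.
rewrite {1}/rho -(cmpA MX (_ ∘ _) (idm _ ⊠ _)) E' (cmpA MX) (cmpA MX _ (bmor _ _ _ ⊠ _)).
rewrite (under_left MX _ (bmu_nat LG _ _ _ _)) -(cmpA MX (bmor _ _ _)).
rewrite -(cmpA MX (bmor _ _ _) (bmu _ _ _ _ _)) F' !(cmpA MX).
rewrite !(bmorM LG) -!(cmpA MA) -!(cmpA MX) (mrun_tmor HA) (mlun_tmor HX).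
by rewrite /rho -!(tmorM MX) !(cmpA MX) (bmu_nat LG).
Qed.

(** Over the unit of [A], [rho] is forced by the unit constraints. *)
Lemma rho_one (m : X) :
  rho mone m ∘ (unitActV mone ⊠ idm m) = unitActV m ∘ mlun m.
Proof.
rewrite unitActV_nat unitActV_mu /rho -(cmpA MX) (tmorM MX) (cmp1m MX) (cmpm1 MX).
rewrite !(cmpA MX); congr (_ ∘ _ ∘ _).
by rewrite (bmorM LG) (cmp1m MA) (cmpm1 MX) (mlun_mrun_one MA).
Qed.

Lemma rho_eps :
  rho mone mone ∘ ((feps actOn1 ⊠ idm mone) ∘ mlunV mone) = feps G.
Proof.
have -> : feps actOn1 = unitActV mone.
  by rewrite -feps_unitActV /= -/(bmor G _ _) (bmor1 LG) (cmp1m MX).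
by rewrite (cmpA MX) rho_one -(cmpA MX) (mlunVK MX) (cmpm1 MX) feps_unitActV.
Qed.

(** The unit law of the 1-morphism, moved along [feps u] to the statement [rho_one]
    over the unit of [A]. *)
Lemma rho_action (m : X) :
  alpha (tt, m) ∘ (rho (u tt) m ∘ (alphaV (tt, mone) ⊠ idm m)) = mlun m.
Proof.
have [Ev Ev'] := Hv.
have E : alphaV (tt, mone) = bmor G (feps u) (idm mone) ∘ unitActV mone.
  by rewrite unitActVE (cmpA MX) (bmorM LG) Ev' (cmp1m MX) (bmor1 LG) (cmp1m MX).
rewrite E -(cmp1m MX (idm m)) -(tmorM MX) (cmpA MX (rho _ _)) rho_nat.
rewrite -(cmpA MX (bmor _ _ _)) rho_one !(cmpA MX) -unitActE.
by rewrite (proj2 (unitActK m)) (cmp1m MX).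
Qed.

Definition rhoNat (x : prodMon A X) :
    hom (compMonFun (tensorMonFun X) (prodMonFun actOn1 (idMonFun X)) x) (G x) :=
  match x with (a, m) => rho a m end.

Lemma rho_monnat :
  is_monnat (compMonFun (tensorMonFun X) (prodMonFun actOn1 (idMonFun X))) G rhoNat.
Proof.
split.
- by move=> [a m] [a' m'] [f g]; exact: rho_nat.
- by move=> [a m] [a' m']; exact: rho_mu.
- exact: rho_eps.
Qed.

(** The transformation [sigma] of the canonical 1-morphism is the inverse of [alpha] at
    the unit of [X]. *)
Lemma alphaV_monnat :
  is_monnat (unitMonFun X) (compMonFun actOn1 u) (fun o => alphaV (o, mone)).
Proof.
have N := monnat_inv MX HalphaV Halpha.
have Eu : fmor u (a := tt) (a' := tt) tt = idm (u tt) by exact: (fmor1 Lu).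
split.
- move=> [] [] [].
  rewrite -[RHS]/(bmor G (fmor u (a := tt) (a' := tt) tt) (idm mone) ∘ alphaV (tt, mone)).
  by rewrite Eu (bmor1 LG) (cmp1m MX) (cmpm1 MX).
- move=> [] [].
  have E1 := monnat_nat N (a := (tt, mone ⊗ mone)) (a' := (tt, mone)) (tt, mlun mone).
  have E2 := monnat_mu N (tt, mone) (tt, mone).
  rewrite [LHS]E1 -[LHS](cmpm1 MX) -(cmpA MX).
  rewrite -[idm _]/(fmu (sndMonFun unitMon X) (tt, mone) (tt, mone)) E2.
  rewrite -[RHS]/(bmor G (fmu u tt tt) (idm mone)
    ∘ (bmor G (idm (u tt ⊗ u tt)) (mlun mone) ∘ bmu G (u tt) (u tt) mone mone)
    ∘ (alphaV (tt, mone) ⊠ alphaV (tt, mone))).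
  rewrite -[LHS]/(bmor G (fmor u (a := tt) (a' := tt) tt) (mlun mone)
    ∘ ((bmor G (fmu u tt tt) (idm (mone ⊗ mone)) ∘ bmu G (u tt) (u tt) mone mone)
    ∘ (alphaV (tt, mone) ⊠ alphaV (tt, mone)))).
  rewrite Eu !(cmpA MX) !(bmorM LG) (cmp1m MA) (cmp1m MX) (cmpm1 MA) (cmpm1 MX).
  by [].
- rewrite [LHS](monnat_eps N).
  rewrite -[RHS]/(bmor G (feps u) (idm mone) ∘ (bmor G (idm mone) (idm mone) ∘ feps G)).
  by rewrite (bmor1 LG) (cmp1m MX).
Qed.

(** [(a, 1)] and [(1, y)] have trivial double braiding, a braided functor preserves
    this, and [G (1, y)] is isomorphic to [y]. *)
Lemma transparent_actOn1 (a : A) : transparent X (G (a, mone)).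
Proof.
move=> y.
have LX := unitActK y.
have Hi : is_iso (idm (G (a, mone)) ⊠ unitAct y).
  by apply: (iso_tmor MX); [exact: iso_id | exists (unitActV y)].
apply: (iso_cancel_r MX Hi).
rewrite -(cmpA MX) (br_nat HX) (cmpA MX) (br_nat HX) -(cmpA MX) (cmp1m MX).
rewrite -[RHS](cmpm1 MX); congr (_ ∘ _).
have Hm : is_iso (bmu G a mone mone y) by exact: (strong_mu (brfun_strong HG)).
apply: (iso_cancel_l MX Hm); rewrite (cmpA MX) (cmpm1 MX).
have B1 := brfun_braid HG (a, mone) (mone, y).
have B2 := brfun_braid HG (mone, y) (a, mone).
rewrite -[bmu _ _ _ _ _]/(fmu G (a, mone) (mone, y)) -B2 -(cmpA MX) -B1 (cmpA MX).
rewrite (fmorM LG) /= (braid_one_l HA) (braid_one_r HA) (braid_one_l HX) (braid_one_r HX).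
rewrite (cmpA MA) (cmpA MX) -(cmpA MA _ (mlun _)) -(cmpA MX _ (mrun _)).
rewrite (mlunVK MA) (mrunVK MX) (cmpm1 MA) (cmpm1 MX) (mrunK MA) (mlunK MX).
by rewrite -[fmor _ _]/(bmor G (idm _) (idm _)) (bmor1 LG) (cmp1m MX).
Qed.

End Action.

Arguments actOn1 {A X} G.

(** * Ordinary 1-morphisms into the Müger center *)

Section Comparison.
Context {A X : brData} (HA : is_braided A) (HX : is_braided X).
Context {G : monFunData (prodBr A X) X} (HG : is_brfun G).
Context {u : monFunData unitMon A} (Hu : is_strong u).
Context {alpha : forall x : prodMon unitMon X,
  hom (compMonFun G (prodMonFun u (idMonFun X)) x) (sndMonFun unitMon X x)}.
Context (Halpha : is_monnat (compMonFun G (prodMonFun u (idMonFun X)))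
                            (sndMonFun unitMon X) alpha).
Context {alphaV : forall x : prodMon unitMon X,
  hom (sndMonFun unitMon X x) (compMonFun G (prodMonFun u (idMonFun X)) x)}.
Context (HalphaV : forall x, is_inverse (alpha x) (alphaV x)).
Context {v : hom (u tt) mone} (Hv : is_inverse (feps u) v).
Context {p : monFunData A X} (Lp : is_lax p).
Context {sigma : forall x : unitMon, hom (unitMonFun X x) (compMonFun p u x)}.
Context (Hsigma : is_monnat (unitMonFun X) (compMonFun p u) sigma).
Context {r : forall x : prodMon A X,
  hom (compMonFun (tensorMonFun X) (prodMonFun p (idMonFun X)) x) (G x)}.
Context (Hr : is_monnat (compMonFun (tensorMonFun X) (prodMonFun p (idMonFun X))) G r).
Context (Haction : forall m : X,
  alpha (tt, m) ∘ (r (u tt, m) ∘ (sigma tt ⊠ idm m)) = mlun m).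
Let MA := br_is_mon HA.
Let MX := br_is_mon HX.
Let LG := strong_lax (brfun_strong HG).
Local Notation unitActV := (@unitActV A X G u alphaV v).
Local Notation rho := (@rho A X G u alphaV v).

(** [r] at a pair whose components are displayed; the type of [r] involves
    projections of its argument. *)
Definition rhoAt (a : A) (m : X) : hom (p a ⊗ m) (G (a, m)) := r (a, m).

Lemma rhoAt_nat (a a' : A) (m m' : X) (f : hom a a') (g : hom m m') :
  rhoAt a' m' ∘ (fmor p f ⊠ g) = bmor G f g ∘ rhoAt a m.
Proof. exact: (monnat_nat Hr (a := (a, m)) (a' := (a', m')) (f, g)). Qed.

Lemma rhoAt_mu (a a' : A) (m m' : X) :
  rhoAt (a ⊗ a') (m ⊗ m') ∘ ((fmu p a a' ⊠ idm (m ⊗ m')) ∘ midswap (p a) m (p a') m')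
  = bmu G a a' m m' ∘ (rhoAt a m ⊠ rhoAt a' m').
Proof. exact: (monnat_mu Hr (a, m) (a', m')). Qed.

Lemma rhoAt_eps : rhoAt mone mone ∘ ((feps p ⊠ idm mone) ∘ mlunV mone) = feps G.
Proof. exact: (monnat_eps Hr). Qed.

(** The monoidal transformation [sigma] is determined by [p] and the units, so the
    law of a 1-morphism fixes [r] over the unit of [A]. *)
Lemma rhoAt_one (m : X) : rhoAt mone m ∘ (feps p ⊠ idm m) = unitActV m ∘ mlun m.
Proof.
have Hb := unitActK HX HG HalphaV Hv m.
apply: (iso_cancel_l MX (iso_inv Hb)).
rewrite !(cmpA MX) (proj2 Hb) (cmp1m MX) -(Haction m).
have -> : sigma tt = fmor p (feps u) ∘ feps p.
  by have := monnat_eps Hsigma; rewrite /= (cmpm1 MX).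
rewrite -{2}(cmp1m MX (idm m)) -(tmorM MX) (cmpA MX _ _ (feps p ⊠ _)).
rewrite -[r _]/(rhoAt (u tt) m) rhoAt_nat unitActE.
by rewrite !(cmpA MX).
Qed.

(** The comparison of [p] with the canonical functor. *)
Definition theta (a : A) : hom (p a) (G (a, mone)) := rhoAt a mone ∘ mrunV (p a).

Lemma theta_inverse (rV : forall x : prodMon A X,
    hom (G x) (compMonFun (tensorMonFun X) (prodMonFun p (idMonFun X)) x)) (a : A) :
  is_inverse (r (a, mone)) (rV (a, mone)) ->
  is_inverse (theta a) (mrun (p a) ∘ rV (a, mone)).
Proof.
move=> H; apply: (inverse_cmp MX); last exact: H.
apply: inverse_sym; exact: (mon_run_inv MX).
Qed.

Lemma theta_nat (a a' : A) (f : hom a a') :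
  theta a' ∘ fmor p f = bmor G f (idm mone) ∘ theta a.
Proof.
by rewrite /theta -(cmpA MX) (mrunV_nat MX) (cmpA MX) rhoAt_nat -(cmpA MX).
Qed.

Lemma theta_mu (a b : A) :
  theta (a ⊗ b) ∘ fmu p a b
  = bmor G (idm (a ⊗ b)) (mlun mone) ∘ bmu G a b mone mone ∘ (theta a ⊠ theta b).
Proof.
rewrite /theta -(tmorM MX) (cmpA MX _ (_ ⊠ _)) -(cmpA MX (bmor _ _ _)) -rhoAt_mu.
rewrite !(cmpA MX (bmor _ _ _)) -rhoAt_nat (fmor1 Lp).
have E : (idm (p (a ⊗ b)) ⊠ mlun mone) ∘ (fmu p a b ⊠ idm (mone ⊗ mone))
       = (fmu p a b ⊠ idm mone) ∘ (idm (p a ⊗ p b) ⊠ mlun mone).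
  by rewrite !(tmorM MX) !(cmp1m MX) !(cmpm1 MX).
rewrite (cmpA MX _ (_ ⊠ _) (midswap _ _ _ _)) (under_left MX _ E).
have Hi := iso_tmor MX (iso_mrun MX (p a)) (iso_mrun MX (p b)).
apply: (iso_cancel_r MX Hi).
rewrite -(cmpA MX _ (mrunV _ ⊠ _)) (tmorM MX (mrunV _)) !(mrunK MX) (tmor1 MX) (cmpm1 MX).
rewrite -(cmpA MX (rhoAt _ _) (mrunV _)) (mrunV_nat MX) -(mrun_tmor HX).
(* The interchange is generalized, so that associativity does not rewrite inside it. *)
move: (midswap _ _ _ _) => ms.
by rewrite -!(cmpA MX) (cmpA MX (mrunV _)) (mrunK MX) (cmp1m MX).
Qed.

Lemma theta_eps : theta mone ∘ feps p = feps G.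
Proof.
rewrite -rhoAt_eps /theta -(cmpA MX) (mrunV_nat MX); congr (_ ∘ (_ ∘ _)).
apply: (iso_cancel_l MX (iso_mrun MX mone)).
by rewrite (mrunVK MX) -(mlun_mrun_one MX) (mlunVK MX).
Qed.

Lemma theta_monnat : is_monnat p (actOn1 G) theta.
Proof.
split.
- exact: theta_nat.
- exact: theta_mu.
- by rewrite theta_eps /= -[fmor _ _]/(bmor G (idm mone) (idm mone)) (bmor1 LG) (cmp1m MX).
Qed.

(** [r] at [(a, m)] is computed from its values at [(a, 1)] and [(1, m)], because it
    is monoidal and the interchange that occurs moves the unit past the unit
    ([midswap_one]). *)
Lemma theta_rho (a : A) (m : X) : rho a m ∘ (theta a ⊠ idm m) = rhoAt a m.
Proof.
have Hi := iso_tmor MX (iso_mrun MX (p a)) (iso_mlun MX m).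
apply: (iso_cancel_r MX Hi).
have E : fmor p (mrun a) ∘ fmu p a mone ∘ (idm _ ⊠ feps p) = mrun (p a).
  exact: (lax_run Lp).
have Em : midswap (p a) mone (p mone) m ∘ ((idm _ ⊠ idm _) ⊠ (feps p ⊠ idm m))
  = (idm (p a) ⊠ feps p) ⊠ (idm mone ⊠ idm m).
  by rewrite (midswap_nat HX) (midswap_one HX) (cmpm1 MX).
have Er : mrun (p a) ⊠ mlun m
  = (fmor p (mrun a) ⊠ mlun m) ∘ ((fmu p a mone ⊠ idm _)
     ∘ ((idm (p a) ⊠ feps p) ⊠ (idm mone ⊠ idm m))).
  by rewrite (tmor1 MX) !(tmorM MX) (cmp1m MX) (cmpm1 MX) (cmpA MX) E.
rewrite {2}Er -Em (cmpA MX (rhoAt _ _)) rhoAt_nat -(cmpA MX (bmor _ _ _)).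
rewrite (cmpA MX (fmu _ _ _ ⊠ _)) (cmpA MX (rhoAt _ _)) rhoAt_mu.
rewrite -(cmpA MX (bmu _ _ _ _ _)) (tmorM MX) rhoAt_one (tmor1 MX) (cmpm1 MX).
rewrite /rho /theta -(cmpA MX _ (_ ⊠ idm m)) (tmorM MX) (cmp1m MX).
rewrite -(cmpA MX (rhoAt _ _)) (mrunK MX) (cmpm1 MX) -(cmpA MX _ (idm _ ⊠ _)).
by rewrite (tmorM MX) (cmp1m MX) -!(cmpA MX).
Qed.

Lemma theta_sigma : theta (u tt) ∘ sigma tt = alphaV (tt, mone).
Proof.
apply: (iso_cancel_l MX (iso_inv (HalphaV (tt, mone)))).
rewrite (proj2 (HalphaV (tt, mone))) /theta -(cmpA MX (rhoAt _ _)) (mrunV_nat MX).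
rewrite (cmpA MX (rhoAt _ _)) (cmpA MX) Haction (mlun_mrun_one MX).
exact: mrunVK.
Qed.

End Comparison.

(** * The canonical 1-morphism *)

(** The outer background functor is applied to a composite on the right, and to its
    factors on the left. *)
Lemma under_mor_comp (A B C : monData) (HC : is_monoidal C) (L : ecatData A)
    (M : ecatData B) (N : ecatData C) (G : efunData M N) (F : efunData L M)
    (x y : underCat L) (f : hom x y) :
  is_lax (ef_bg G) -> under_mor (compEfun G F) f = under_mor G (under_mor F f).
Proof.
move=> LG; rewrite /under_mor /=; rewrite -!(fmorM LG) !(cmpA HC); by [].
Qed.

Lemma under_mor_id (A : monData) (HA : is_monoidal A) (L : ecatData A)
    (x y : underCat L) (f : hom x y) :
  under_mor (idEfun L) f = f.
Proof. by rewrite /under_mor /= (cmp1m HA) (cmpm1 HA). Qed.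

Lemma wapp_comp (A B C : monData) (HC : is_monoidal C) (L : ecatData A)
    (M : ecatData B) (N : ecatData C) (G : efunData M N) (F : efunData L M)
    (x y : L) (a : A) (f : hom a (ehom x y)) :
  is_lax (ef_bg G) -> wapp (compEfun G F) f = wapp G (wapp F f).
Proof. by move=> LG; rewrite /wapp /= -(cmpA HC) (fmorM LG). Qed.

Section Action.
Context {M : ebrData} (HM : is_ebr M) {A : ebrData} (HA : is_ebr A).
Context {u : emonFunData unitEbr A} (Hu : is_ebrfun u).
Context {g : emonFunData (prodEbr A M) M} (Hg : is_ebrfun g).
Context {alpha : enatData (compEmonFun g (prodEmonFun u (idEmonFun M))) (lunitor M)}.
Context (Halpha : is_emonnat (compEmonFun g (prodEmonFun u (idEmonFun M))) (lunitor M) alpha).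
Context {alphaV : enatData (lunitor M) (compEmonFun g (prodEmonFun u (idEmonFun M)))}.
Context (HVb : forall x, is_inverse (en_bg alpha x) (en_bg alphaV x)).
Context (HVc : forall x, is_inverse (en_cmp alpha x) (en_cmp alphaV x)).
Local Notation Z := (mugerCenter HM).
Local Notation C := (ebr_bg M).
Local Notation U := (underBr M).
Local Notation K := (ebr_bg A).
Local Notation V := (underBr A).
Context {vb : hom (ef_bg u tt) (mone : K)}.
Context (Hvb : is_inverse (feps (ef_bg u)) vb).
Context {vu : hom (u tt : V) (mone : V)}.
Context (Hvu : is_inverse (emf_zero u : hom (mone : V) (u tt)) vu).
Let EM := ebr_is_emon HM.
Let BC := emon_bg EM.
Let HC := br_is_mon BC.
Let HL := emon_ecat EM.
Let HU := ebr_under HM.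
Let HUM := br_is_mon HU.
Let EA := ebr_is_emon HA.
Let BK := emon_bg EA.
Let HK := br_is_mon BK.
Let HV := ebr_under HA.
Let HVM := br_is_mon HV.

(** The functors and transformations of the action, on background categories (b) and
    on underlying categories (u); each has the type that the ordinary case expects. *)
Local Notation Gb := (ef_bg g : monFunData (prodBr K C) C).
Local Notation Gu := (underMonFun g : monFunData (prodBr V U) U).
Local Notation ub := (ef_bg u : monFunData unitMon K).
Local Notation uu := (underMonFun u : monFunData unitMon V).
Local Notation ab := (en_bg alpha : forall x : prodMon unitMon C,
  hom (compMonFun Gb (prodMonFun ub (idMonFun C)) x) (sndMonFun unitMon C x)).
Local Notation au := (en_cmp alpha : forall x : prodMon unitMon U,
  hom (compMonFun Gu (prodMonFun uu (idMonFun U)) x) (sndMonFun unitMon U x)).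
Local Notation abV := (en_bg alphaV : forall x : prodMon unitMon C,
  hom (sndMonFun unitMon C x) (compMonFun Gb (prodMonFun ub (idMonFun C)) x)).
Local Notation auV := (en_cmp alphaV : forall x : prodMon unitMon U,
  hom (sndMonFun unitMon U x) (compMonFun Gu (prodMonFun uu (idMonFun U)) x)).

Lemma brfun_Gb : is_brfun Gb.
Proof. exact: (emonfun_bg (ebrfun_emon Hg)). Qed.
Lemma brfun_Gu : is_brfun Gu.
Proof. exact: (ebrfun_under Hg). Qed.
Lemma strong_ub : is_strong ub.
Proof. exact: (brfun_strong (emonfun_bg (ebrfun_emon Hu))). Qed.
Lemma strong_uu : is_strong uu.
Proof. exact: (emonfun_under (ebrfun_emon Hu)). Qed.

Lemma monnat_ab : is_monnat (compMonFun Gb (prodMonFun ub (idMonFun C)))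
  (sndMonFun unitMon C) ab.
Proof. exact: (enat_monnat (emonnat_enat Halpha)). Qed.

Lemma monnat_au : is_monnat (compMonFun Gu (prodMonFun uu (idMonFun U)))
  (sndMonFun unitMon U) au.
Proof.
have H := emonnat_under Halpha; split.
- move=> [[] m] [[] m'] [f h].
  have := monnat_nat H (a := (tt, m)) (a' := (tt, m')) (f, h).
  have Ls : under_mor (lunitor M) (x := (tt, m)) (y := (tt, m')) (f, h) = h.
    exact: under_mor_id.
  rewrite /= Ls (@under_mor_comp _ _ _ HC _ _ _ _ _ _ _ _ (strong_lax (brfun_strong brfun_Gb))).
  have E : under_mor (prodEmonFun u (idEmonFun M)) (x := (tt, m)) (y := (tt, m')) (f, h)
    = (under_mor u (x := tt) (y := tt) f, h).
    by rewrite -{2}(under_mor_id HC (L := M) h).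
  by rewrite E.
- exact: (monnat_mu H).
- exact: (monnat_eps H).
Qed.

Definition wact (a a' : A) (m m' : M) (c : K) (d : C) (f : hom c (ehom a a'))
    (h : hom d (ehom m m')) : hom (Gb (c, d)) (ehom (g (a, m)) (g (a', m'))) :=
  wapp g (x := (a, m)) (y := (a', m')) (a := (c, d)) (f, h).

Lemma wact_cmp (a a' : A) (m m' : M) (c c' : K) (d d' : C) (f : hom c (ehom a a'))
    (h : hom d (ehom m m')) (k : hom c' c) (l : hom d' d) :
  wact (f ∘ k) (h ∘ l) = wact f h ∘ bmor Gb k l.
Proof.
exact: (@wapp_cmp _ _ HC _ _ g (emonfun_efun (ebrfun_emon Hg)) (a, m) (a', m')
  (c, d) (c', d') (f, h) (k, l)).
Qed.

Lemma wsquare_wact (a a' b b' : V) (m m' n n' : U) (s : hom a b) (t : hom a' b')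
    (k : hom m n) (l : hom m' n') (c : K) (d : C) (f : hom c (ehom (e := A) a a'))
    (f' : hom c (ehom (e := A) b b')) (h : hom d (ehom (e := M) m m'))
    (h' : hom d (ehom (e := M) n n')) :
  wsquare (L := A) s t f f' -> wsquare (L := M) k l h h' ->
  wsquare (L := M) (bmor Gu s k) (bmor Gu t l) (wact f h) (wact f' h').
Proof.
move=> Hf Hh.
have Hp : wsquare (L := prodEcat A M) (x := (a, m)) (x' := (b, n)) (y := (a', m'))
    (y' := (b', n')) (s, k) (t, l) (a := (c, d)) (f, h) (f', h').
  by rewrite /wsquare /= -[_ ∘ f]/(postcomp (L := A) a t ∘ f) Hf; congr pair; exact: Hh.
exact: (@wsquare_wapp _ _ (monoidal_prod HK HC) HC _ _ _ (emonfun_efun (ebrfun_emon Hg))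
  (a, m) (b, n) (a', m') (b', n') (s, k) (t, l) (c, d) (f, h) (f', h') Hp).
Qed.

Lemma wsquare_bmu (a a' b b' : V) (m m' n n' : U) (c c' : K) (d d' : C)
    (f : hom c (ehom (e := A) a a')) (f' : hom c' (ehom (e := A) b b'))
    (h : hom d (ehom (e := M) m m')) (h' : hom d' (ehom (e := M) n n')) :
  wsquare (L := M) (bmu Gu a b m n) (bmu Gu a' b' m' n')
    (wtensor (wact f h) (wact f' h')) (wact (wtensor f f') (wtensor h h') ∘ bmu Gb c c' d d').
Proof.
have := @wsquare_enat _ _ HC _ _ _ _ (twoEnat g) ((a, m), (b, n)) ((a', m'), (b', n'))
  ((c, d), (c', d')) ((f, h), (f', h')) (proj1 (emonfun_two (ebrfun_emon Hg))).
rewrite (@wapp_comp _ _ _ HC _ _ _ (tensorEfun M) _ _ _ _ _ (lax_tensor BC)).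
rewrite (@wapp_comp _ _ _ HC _ _ _ g _ _ _ _ _ (strong_lax (brfun_strong brfun_Gb))).
have -> : wapp (tensorEfun M) (wapp (prodEfun g g) (x := ((a, m), (b, n)))
   (y := ((a', m'), (b', n'))) (a := ((c, d), (c', d'))) ((f, h), (f', h')))
   = wtensor (wact f h) (wact f' h') by rewrite wtensorE.
have -> : wapp (tensorEfun (prodEbr A M)) (x := ((a, m), (b, n)))
   (y := ((a', m'), (b', n'))) (a := ((c, d), (c', d'))) ((f, h), (f', h'))
  = (wtensor f f', wtensor h h') by rewrite !wtensorE.
by [].
Qed.

Local Notation unitActB := (@unitAct K C Gb ub ab).
Local Notation unitActU := (@unitAct V U Gu uu au).
Local Notation unitActVB := (@unitActV K C Gb ub abV vb).
Local Notation unitActVU := (@unitActV V U Gu uu auV vu).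
Local Notation rhoB := (@rho K C Gb ub abV vb).
Local Notation rhoU := (@rho V U Gu uu auV vu).

(** The squares of [feps u] and of [alpha] are pasted.  The weights match because
    [u] preserves identities. *)
Lemma wsquare_unitAct (m m' : U) (d : C) (h : hom d (ehom (e := M) m m')) :
  wsquare (L := M) (unitActU m) (unitActU m') (wact (eid em_one) h) (h ∘ unitActB d).
Proof.
have S1 := wsquare_wact (wsquare_eid HK (emon_ecat EA) (emf_zero u : hom (mone : V) (u tt)))
  (wsquare_id HC HL h).
have S2 := @wsquare_enat _ _ HC _ _ _ _ alpha (tt, m) (tt, m') (tt, d) (tt, h)
  (emonnat_enat Halpha).
have LG := strong_lax (brfun_strong brfun_Gb).
have S3 := wsquare_precmp HC (bmor Gb (feps ub) (idm d)) S2.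
have E : wapp (compEmonFun g (prodEmonFun u (idEmonFun M))) (x := (tt, m)) (y := (tt, m'))
    (a := (tt, d)) (tt, h) ∘ bmor Gb (feps ub) (idm d) = wact (eid (e := A) (u tt)) h.
  rewrite (@wapp_comp _ _ _ HC _ _ _ g _ _ _ _ _ LG).
  rewrite -(efun_id (emonfun_efun (ebrfun_emon Hu)) tt).
  have -> : wapp (prodEmonFun u (idEmonFun M)) (x := (tt, m)) (y := (tt, m'))
    (a := (tt, d)) (tt, h) = (ef_hom u tt tt ∘ fmor ub (a := tt) (a' := tt) tt, h).
    by rewrite -{2}(cmp1m HC h).
  by rewrite -[wapp g _]/(wact _ h) -wact_cmp (cmpm1 HC).
rewrite E in S3.
have E' : wapp (lunitor M) (x := (tt, m)) (y := (tt, m')) (a := (tt, d)) (tt, h) = h.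
  exact: (cmp1m HC).
rewrite E' -(cmpA HC) in S3.
rewrite !unitActE; have S31 := wsquare_vert HC HL S1 S3; exact: S31.
Qed.

Lemma wsquare_unitActV (m m' : U) (d : C) (h : hom d (ehom (e := M) m m')) :
  wsquare (L := M) (unitActVU m) (unitActVU m') h (wact (eid em_one) h ∘ unitActVB d).
Proof.
have Ib := unitActK BC brfun_Gb (alpha := ab) HVb Hvb d.
have Iu m0 := unitActK HU brfun_Gu (alpha := au) HVc Hvu m0.
have := wsquare_precmp HC (unitActVB d) (wsquare_inv HC HL (Iu m) (Iu m') (wsquare_unitAct h)).
by rewrite -(cmpA HC) (proj2 Ib) (cmpm1 HC).
Qed.

(** The effect of [g (-, 1)] on weighted morphisms. *)
Definition wact_one (a a' : A) (c : K) (f : hom c (ehom a a')) :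
    hom (Gb (c, mone)) (ehom (g (a, em_one)) (g (a', em_one))) :=
  wact f (eid (e := M) em_one).

(** The squares of the three factors of [rho] are pasted. *)
Lemma wsquare_rho (a a' : V) (m m' : U) (c : K) (d : C) (f : hom c (ehom (e := A) a a'))
    (h : hom d (ehom (e := M) m m')) :
  wsquare (L := M) (rhoU a m) (rhoU a' m') (wtensor (wact_one f) h) (wact f h ∘ rhoB c d).
Proof.
have S1 := wsquare_wtensor HM (wsquare_id HC HL (wact_one f)) (wsquare_unitActV h).
rewrite (wtensor_cmpr HM) in S1.
have S2 := wsquare_bmu f (eid (e := A) em_one) (eid (e := M) em_one) h.
have S3 := wsquare_wact (wsquare_mrun HA f) (wsquare_mlun HM h).
rewrite wact_cmp in S3.
have S32 := wsquare_vert HC HL S2 (wsquare_precmp HC _ S3).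
have S321 := wsquare_vert HC HL S1 (wsquare_precmp HC _ S32).
by rewrite /rho !(cmpA HC).
Qed.

Lemma wact1 (a a' : A) (m m' : M) :
  wact (idm (ehom a a')) (idm (ehom m m')) = ef_hom g (a, m) (a', m').
Proof.
have LG := strong_lax (brfun_strong brfun_Gb).
rewrite /wact /wapp -[fmor _ _]/(bmor Gb (idm (ehom a a')) (idm (ehom m m'))) (bmor1 LG).
exact: cmpm1.
Qed.

Lemma transparent_act (a : A) : transparent U (g (a, em_one)).
Proof. exact: (transparent_actOn1 HV HU brfun_Gu (alpha := au) HVc Hvu a). Qed.

(** [actOn1] for the enriched action, with values in the transparent objects. *)
Definition canonEfun : efunData A Z :=
  @EfunData K C A Z (actOn1 Gb) (fun a => exist _ (g (a, em_one)) (transparent_act a))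
    (fun a a' => wact_one (idm (ehom a a'))).

Definition canonFun : emonFunData A Z :=
  @EmonFunData K C A Z canonEfun (fmu (actOn1 Gu)) (feps (actOn1 Gu)).

Lemma wact_one_cmp (a a' : A) (c c' : K) (f : hom c (ehom a a')) (k : hom c' c) :
  wact_one (f ∘ k) = wact_one f ∘ bmor Gb k (idm mone).
Proof. by rewrite /wact_one -wact_cmp (cmpm1 HC). Qed.

Lemma efun_canon : is_efun canonEfun.
Proof.
have HG := emonfun_efun (ebrfun_emon Hg).
have LG := strong_lax (brfun_strong brfun_Gb).
split.
- exact: strong_lax (brfun_strong (brfun_actOn1 BK BC brfun_Gb)).
- move=> a.
  rewrite -[LHS]/(wact_one (idm (ehom a a)) ∘ bmor Gb (eid a) (idm mone)
    ∘ (bmor Gb (idm mone) (idm mone) ∘ feps Gb)).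
  rewrite (bmor1 LG) (cmp1m HC) -wact_one_cmp (cmp1m HK).
  exact: (efun_id HG (a, em_one)).
- move=> a a' a''.
  rewrite -[LHS]/(wact_one (idm (ehom a a'')) ∘ bmor Gb (ecmp a a' a'') (idm mone)
    ∘ (bmor Gb (idm (ehom a' a'' ⊗ ehom a a')) (mlun mone)
       ∘ bmu Gb (ehom a' a'') (ehom a a') mone mone)).
  rewrite (cmpA HC) -wact_one_cmp (cmp1m HK) -wact_cmp (cmpm1 HK) -[RHS]wcmpE.
  have E : ecmp a a' a'' = wcmp (idm (ehom a' a'')) (idm (ehom a a')).
    by rewrite wcmpE (tmor1 HK) (cmpm1 HK).
  have E' : eid em_one ∘ mlun mone = wcmp (eid (e := M) em_one) (eid em_one).
    by rewrite (wcmp_idl HC HL).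
  rewrite E E'.
  have := @wapp_wcmp _ _ HC _ _ g HG (a, em_one) (a', em_one) (a'', em_one)
    (ehom a a', mone) (ehom a' a'', mone) (idm (ehom a' a''), eid em_one)
    (idm (ehom a a'), eid em_one).
  by rewrite !wcmpE; apply.
Qed.

Lemma under_canon (a a' : V) (f : hom a a') :
  under_mor canonEfun f = fmor (actOn1 Gu) f.
Proof.
have LG := strong_lax (brfun_strong brfun_Gb).
rewrite -[LHS]/(wact_one (idm (ehom (e := A) a a')) ∘ bmor Gb f (idm mone)
    ∘ (bmor Gb (idm mone) (idm mone) ∘ feps Gb)).
by rewrite (bmor1 LG) (cmp1m HC) -wact_one_cmp (cmp1m HK).
Qed.

Lemma ebrfun_canon : is_ebrfun canonFun.
Proof.
have Hz := ebr_muger HM.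
have LG := strong_lax (brfun_strong brfun_Gb).
apply: (ebrfun_intro BK Hz).
- exact: efun_canon.
- exact: (brfun_actOn1 BK BC brfun_Gb).
- apply: (@brfun_corestrict M HM V (underMonFun canonFun)).
  exact: (brfun_mor_ext (A := V) (B := U) (F := actOn1 Gu)
    (m := fun a a' f => under_mor canonEfun f) under_canon (brfun_actOn1 HV HU brfun_Gu)).
- move=> [a b] [a' b'].
  have S1 := wsquare_bmu (idm (ehom (e := A) a a')) (idm (ehom (e := A) b b'))
    (eid (e := M) em_one) (eid (e := M) em_one).
  have S2 := wsquare_wact (wsquare_id HK (emon_ecat EA) (em_thom (e := A) a a' b b'))
    (wsquare_mlun HM (eid (e := M) em_one)).
  rewrite (wtensor1 HA) in S1; rewrite -(cmpm1 HK (em_thom _ _ _ _)) wact_cmp in S2.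
  rewrite (cmpm1 HK) in S2.
  have S21 := wsquare_vert HC HL S1 (wsquare_precmp HC _ S2).
  have Es : ef_hom (compEfun (tensorEfun Z) (prodEfun canonEfun canonEfun)) (a, b) (a', b')
    = wtensor (wact_one (idm (ehom a a'))) (wact_one (idm (ehom b b'))) by rewrite wtensorE.
  have Et : ef_hom (compEfun canonEfun (tensorEfun A)) (a, b) (a', b')
    = wact (em_thom a a' b b') (eid em_one).
    rewrite -[LHS]/(wact_one (idm _) ∘ bmor Gb (em_thom a a' b b') (idm mone)) -wact_one_cmp.
    by rewrite (cmp1m HK).
  rewrite Es Et -(cmpA HC) in S21 *; exact: S21.
Qed.

Definition canonRho : enatData
    (compEmonFun (mugerTensor HM) (prodEmonFun canonFun (idEmonFun M))) g :=
  EnatData (compEmonFun (mugerTensor HM) (prodEmonFun canonFun (idEmonFun M))) g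
    (fun x : prodMon K C => rhoNat (alphaV := abV) (v := vb) x)
    (fun x : prodMon V U => rhoNat (alphaV := auV) (v := vu) x).

Definition canonSigma : enatData (unitEmonFun Z) (compEmonFun canonFun u) :=
  EnatData (unitEmonFun Z) (compEmonFun canonFun u)
    (fun o => en_bg alphaV (o, mone)) (fun o => en_cmp alphaV (o, em_one)).

Definition canonAct1 :
    act1Data (@ActData M A u g alpha) (mugerAction HM) :=
  @Act1Data M (@ActData M A u g alpha) (mugerAction HM) canonFun canonSigma canonRho.

Lemma emonnatiso_canonRho :
  is_emonnatiso (compEmonFun (mugerTensor HM) (prodEmonFun canonFun (idEmonFun M))) g
    canonRho.
Proof.
have Rb := rho_monnat BK BC brfun_Gb strong_ub monnat_ab HVb Hvb.
have Ru := rho_monnat HV HU brfun_Gu strong_uu monnat_au HVc Hvu.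
apply: (emonnatiso_intro BC EM).
- apply: (emonnat_intro EM).
  + exact: Rb.
  + move=> [a m] [a' m'].
    have S := wsquare_rho (idm (ehom (e := A) a a')) (idm (ehom m m')).
    rewrite wact1 in S.
    have Es : ef_hom (compEmonFun (mugerTensor HM) (prodEmonFun canonFun (idEmonFun M)))
       (a, m) (a', m') = wtensor (wact_one (idm (ehom a a'))) (idm (ehom m m')) by rewrite wtensorE.
    by rewrite Es.
  + move=> [a m] [a' m'].
    exact: (monnat_mu Ru (a, m) (a', m')).
  + exact: (monnat_eps Ru).
- by move=> [a m]; exact: (iso_rho BK BC brfun_Gb HVb Hvb).
- by move=> [a m]; exact: (iso_rho HV HU brfun_Gu (alpha := au) HVc Hvu a m).
Qed.

Lemma emonnatiso_canonSigma :
  is_emonnatiso (unitEmonFun Z) (compEmonFun canonFun u) canonSigma.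
Proof.
have Hz := ebr_muger HM; have EZ := ebr_is_emon Hz.
have Sb := alphaV_monnat BK BC brfun_Gb strong_ub monnat_ab HVb.
have Su := alphaV_monnat HV HU brfun_Gu strong_uu monnat_au (alphaV := auV) HVc.
apply: (emonnatiso_intro BC EZ).
- apply: (emonnat_intro EZ).
  + exact: Sb.
  + move=> [] [].
    have S := @wsquare_enat _ _ HC _ _ _ _ alphaV (tt, em_one) (tt, em_one) (tt, mone)
      (tt, eid em_one) (enat_inv HC HL HVb HVc (emonnat_enat Halpha)).
    have Es : wapp (lunitor M) (x := (tt, em_one)) (y := (tt, em_one))
      (a := (tt, mone)) (tt, eid em_one) = eid (em_one : M) by exact: (cmp1m HC).
    rewrite Es (@wapp_comp _ _ _ HC _ _ _ g _ _ _ _ _ (strong_lax (brfun_strong brfun_Gb))) in S.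
    have Eu : fmor ub (a := tt) (a' := tt) tt = idm _.
      by exact: (fmor1 (strong_lax strong_ub)).
    have Ep : wapp (prodEmonFun u (idEmonFun M)) (x := (tt, em_one)) (y := (tt, em_one))
        (a := (tt, mone)) (tt, eid em_one) = (ef_hom u tt tt, eid em_one).
      rewrite -[LHS]/(ef_hom u tt tt ∘ fmor ub (a := tt) (a' := tt) tt, idm _ ∘ eid em_one).
      by rewrite Eu (cmpm1 HK) (cmp1m HC).
    have Et : ef_hom (compEmonFun canonFun u) tt tt = wact_one (ef_hom u tt tt).
      rewrite -[LHS]/(wact_one (idm _) ∘ bmor Gb (ef_hom u tt tt) (idm mone)) -wact_one_cmp.
      by rewrite (cmp1m HK).
    by rewrite Ep in S; rewrite Et; exact: S.
  + move=> [] []; have S := monnat_mu Su tt tt.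
    rewrite -[fmu (compMonFun _ _) _ _]/(cmp (c := underCat M)
      (fmor (actOn1 Gu) (emf_two u tt tt)) (fmu (actOn1 Gu) (u tt) (u tt))) in S.
    by rewrite -under_canon in S; exact: S.
  + have S := monnat_eps Su.
    rewrite -[feps (compMonFun _ _)]/(cmp (c := underCat M)
      (fmor (actOn1 Gu) (emf_zero u)) (feps (actOn1 Gu))) in S.
    by rewrite -under_canon in S; exact: S.
- by move=> []; exists (en_bg alpha (tt, mone)); apply: inverse_sym; exact: (HVb (tt, mone)).
- by move=> []; exists (en_cmp alpha (tt, em_one));
    have [E1 E2] := HVc (tt, em_one); split; [exact: E2 | exact: E1].
Qed.

Lemma act1_canon : is_act1 canonAct1.
Proof.
split.
- exact: ebrfun_canon.
- exact: emonnatiso_canonSigma.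
- exact: emonnatiso_canonRho.
- split.
  + move=> [[] m].
    rewrite -[RHS](rho_action BK BC brfun_Gb strong_ub monnat_ab HVb Hvb m).
    (* The identity is the component of [act_coh]. *)
    rewrite -[LHS]/(en_bg alpha (tt, m)
      ∘ (rhoB (ub tt) m ∘ (idm _ ∘ (en_bg alphaV (tt, mone) ⊠ idm m)))).
    by rewrite (cmp1m HC).
  + move=> [[] m].
    rewrite -[RHS](rho_action HV HU brfun_Gu strong_uu monnat_au (alphaV := auV) HVc Hvu m).
    rewrite -[LHS]/(au (tt, m)
      ∘ (rhoU (uu tt) m ∘ (idm _ ∘ (auV (tt, mone) ⊠ idm (m : U))))).
    by rewrite (cmp1m HUM).
Qed.

(** * Contractibility of the categories of 1-morphisms *)

Let EZ := ebr_is_emon (ebr_muger HM).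

Local Notation S := (@ActData M A u g alpha).
Local Notation T := (mugerAction HM).

(** For a 1-morphism to the Müger center, its data on background categories (suffix
    B) and on underlying categories (suffix U), the latter with values in [M]. *)
Definition pB (f : act1Data S T) : monFunData K C := ef_bg (act1_p f).
Definition pU (f : act1Data S T) : monFunData V U :=
  @MonFunData V U (fun a => proj1_sig (act1_p f a)) (fun a a' k => under_mor (act1_p f) k)
    (emf_two (act1_p f)) (emf_zero (act1_p f)).
Definition rB (f : act1Data S T) : forall x : prodMon K C,
    hom (compMonFun (tensorMonFun C) (prodMonFun (pB f) (idMonFun C)) x) (Gb x) :=
  en_bg (act1_rho f).
Definition rU (f : act1Data S T) : forall x : prodMon V U,
    hom (compMonFun (tensorMonFun U) (prodMonFun (pU f) (idMonFun U)) x) (Gu x) :=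
  en_cmp (act1_rho f).
Definition sB (f : act1Data S T) : forall x : unitMon,
    hom (unitMonFun C x) (compMonFun (pB f) ub x) := en_bg (act1_sigma f).
Definition sU (f : act1Data S T) : forall x : unitMon,
    hom (unitMonFun U x) (compMonFun (pU f) uu x) := en_cmp (act1_sigma f).

Section One.
Context {f : act1Data S T} (Hf : is_act1 f).

Lemma lax_pB : is_lax (pB f).
Proof. exact: (efun_lax (emonfun_efun (ebrfun_emon (act1_p_ebr Hf)))). Qed.

Lemma lax_pU : is_lax (pU f).
Proof.
have HP := strong_lax (emonfun_under (ebrfun_emon (act1_p_ebr Hf))).
split.
- exact: (lax_id HP).
- exact: (lax_cmp HP).
- exact: (lax_mu_nat HP).
- exact: (lax_assoc HP).
- exact: (lax_lun HP).
- exact: (lax_run HP).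
Qed.

Lemma monnat_rB :
  is_monnat (compMonFun (tensorMonFun C) (prodMonFun (pB f) (idMonFun C))) Gb (rB f).
Proof. exact: (enat_monnat (emonnat_enat (proj1 (act1_rho_iso Hf)))). Qed.

Lemma monnat_rU :
  is_monnat (compMonFun (tensorMonFun U) (prodMonFun (pU f) (idMonFun U))) Gu (rU f).
Proof.
have H := emonnat_under (proj1 (act1_rho_iso Hf)); split.
- move=> [a m] [a' m'] [k h].
  have N := @monnat_nat _ _ _ _ _ H (a, m) (a', m') (k, h).
  rewrite -[fmor (underMonFun (compEmonFun _ _)) _]/(under_mor
    (compEfun (mugerTensor HM) (prodEfun (act1_p f) (idEfun M)))
    (x := (a, m)) (y := (a', m')) (k, h)) in N.
  rewrite (@under_mor_comp _ _ _ HC _ _ _ (mugerTensor HM) _ _ _ _ (lax_tensor BC)) in N.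
  have E : under_mor (prodEfun (act1_p f) (idEfun M)) (x := (a, m)) (y := (a', m')) (k, h)
    = (under_mor (act1_p f) k, h).
    by rewrite -{2}(under_mor_id HC (L := M) h).
  by rewrite E in N; exact: N.
- exact: (monnat_mu H).
- exact: (monnat_eps H).
Qed.

Lemma monnat_sB : is_monnat (unitMonFun C) (compMonFun (pB f) ub) (sB f).
Proof. exact: (enat_monnat (emonnat_enat (proj1 (act1_sigma_iso Hf)))). Qed.

Lemma monnat_sU : is_monnat (unitMonFun U) (compMonFun (pU f) uu) (sU f).
Proof.
have H := emonnat_under (proj1 (act1_sigma_iso Hf)); split.
- move=> [] [] [].
  have Eu : fmor uu (a := tt) (a' := tt) tt = idm _ by exact: (fmor1 (strong_lax strong_uu)).
  rewrite -[RHS]/(fmor (pU f) (fmor uu (a := tt) (a' := tt) tt) ∘ sU f tt) Eu.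
  by rewrite (fmor1 lax_pU) (cmp1m HUM) (cmpm1 HUM).
- exact: (monnat_mu H).
- exact: (monnat_eps H).
Qed.

Lemma action_B (m : C) : ab (tt, m) ∘ (rB f (ub tt, m) ∘ (sB f tt ⊠ idm m)) = mlun m.
Proof.
rewrite -[RHS](proj1 (act1_law Hf) (tt, m)).
rewrite -[RHS]/(ab (tt, m) ∘ (rB f (ub tt, m) ∘ (idm _ ∘ (sB f tt ⊠ idm m)))).
by rewrite (cmp1m HC).
Qed.

Lemma action_U (m : U) : au (tt, m) ∘ (rU f (uu tt, m) ∘ (sU f tt ⊠ idm m)) = mlun m.
Proof.
rewrite -[RHS](proj2 (act1_law Hf) (tt, m)).
rewrite -[RHS]/(au (tt, m) ∘ (rU f (uu tt, m) ∘ (idm _ ∘ (sU f tt ⊠ idm m)))).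
by rewrite (cmp1m HUM).
Qed.

Lemma wsquare_theta (a a' : V) :
  wsquare (L := M) (theta (r := rU f) a) (theta (r := rU f) a') (ef_hom (act1_p f) a a')
    (wact_one (idm (ehom (e := A) a a')) ∘ theta (r := rB f) (ehom a a')).
Proof.
have S1 := wsquare_precmp HC (mrunV _) (wsquare_inv HC HL (mon_run_inv HUM _) (mon_run_inv HUM _)
   (wsquare_mrun HM (ef_hom (act1_p f) a a'))).
rewrite -(cmpA HC) (mrunVK HC) (cmpm1 HC) in S1.
have S2 := @wsquare_enat _ _ HC _ _ _ _ (act1_rho f) (a, em_one) (a', em_one)
  (ehom a a', mone) (idm _, eid em_one) (emonnat_enat (proj1 (act1_rho_iso Hf))).
have Ep : wapp (prodEfun (act1_p f) (idEfun M)) (x := (a, em_one)) (y := (a', em_one))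
    (a := (ehom a a', mone)) (idm _, eid em_one) = (ef_hom (act1_p f) a a', eid em_one).
  rewrite -[LHS]/(ef_hom (act1_p f) a a' ∘ fmor (pB f) (idm _), idm _ ∘ eid em_one).
  by rewrite (fmor1 lax_pB) (cmpm1 HC) (cmp1m HC).
have Es : wapp (compEmonFun (mugerTensor HM) (prodEmonFun (act1_p f) (idEmonFun M)))
    (x := (a, em_one)) (y := (a', em_one)) (a := (ehom a a', mone)) (idm _, eid em_one)
  = wtensor (ef_hom (act1_p f) a a') (eid em_one).
  by rewrite (@wapp_comp _ _ _ HC _ _ _ (mugerTensor HM) _ _ _ _ _ (lax_tensor BC)) Ep wtensorE.
rewrite Es in S2.
have S21 := wsquare_vert HC HL S1 (wsquare_precmp HC _ S2).
by rewrite -(cmpA HC) in S21; exact: S21.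
Qed.

End One.

Section Two.
Context {f h : act1Data S T} (Hf : is_act1 f) (Hh : is_act1 h).
Context {rV : enatData g (compEmonFun (mugerTensor HM) (prodEmonFun (act1_p h) (idEmonFun M)))}.
Context (HrVb : forall x, is_inverse (en_bg (act1_rho h) x) (en_bg rV x)).
Context (HrVc : forall x, is_inverse (en_cmp (act1_rho h) x) (en_cmp rV x)).

Definition rVB : forall x : prodMon K C,
    hom (Gb x) (compMonFun (tensorMonFun C) (prodMonFun (pB h) (idMonFun C)) x) := en_bg rV.
Definition rVU : forall x : prodMon V U,
    hom (Gu x) (compMonFun (tensorMonFun U) (prodMonFun (pU h) (idMonFun U)) x) := en_cmp rV.

(** Inverse of [theta] on backgrounds, built from an inverse of the 2-morphism of [h]. *)
Definition thetaVB (a : K) : hom (Gb (a, mone)) (pB h a) :=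
  mrun (pB h a) ∘ rVB (a, mone).
Definition thetaVU (a : V) : hom (Gu (a, mone)) (pU h a) :=
  mrun (pU h a) ∘ rVU (a, mone).

Lemma thetaVB_inverse (a : K) : is_inverse (theta (r := rB h) a) (thetaVB a).
Proof. exact: (theta_inverse BC (r := rB h) (rV := rVB) (HrVb (a, mone))). Qed.
Lemma thetaVU_inverse (a : V) : is_inverse (theta (r := rU h) a) (thetaVU a).
Proof. by apply: (@theta_inverse _ _ HU _ _ (rU h) rVU a); exact: (HrVc (a, em_one)). Qed.

(** Both 1-morphisms are compared with the canonical one by [theta]. *)
Definition compare : enatData (act1_p f) (act1_p h) :=
  EnatData (act1_p f) (act1_p h)
    (fun a => thetaVB a ∘ theta (r := rB f) a)
    (fun a => cmp (c := underMon M) (thetaVU a) (theta (r := rU f) a)).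

Lemma emonnat_compare : is_emonnat (act1_p f) (act1_p h) compare.
Proof.
have NBf := theta_monnat BC brfun_Gb (lax_pB Hf) (monnat_rB Hf).
have NBh := theta_monnat BC brfun_Gb (lax_pB Hh) (monnat_rB Hh).
have NUf := @theta_monnat V U HU Gu brfun_Gu (pU f) (lax_pU Hf) (rU f) (monnat_rU Hf).
have NUh := @theta_monnat V U HU Gu brfun_Gu (pU h) (lax_pU Hh) (rU h) (monnat_rU Hh).
have NB := monnat_cmp HC NBf (@monnat_inv K C HC (pB h) (actOn1 Gb) _ _ thetaVB_inverse NBh).
have NU := monnat_cmp HUM NUf (@monnat_inv V U HUM (pU h) (actOn1 Gu) _ _ thetaVU_inverse NUh).
apply: (emonnat_intro EZ).
- exact: NB.
- move=> a a'.
  have Sh := wsquare_inv HC HL (thetaVU_inverse a) (thetaVU_inverse a') (wsquare_theta Hh a a').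
  have Sh' := wsquare_precmp HC (thetaVB (ehom a a')) Sh.
  rewrite -(cmpA HC) (proj2 (thetaVB_inverse _)) (cmpm1 HC) in Sh'.
  have S := wsquare_vert HC HL (wsquare_theta Hf a a')
    (wsquare_precmp HC (theta (r := rB f) (ehom a a')) Sh').
  by rewrite -(cmpA HC) in S; exact: S.
- exact: (monnat_mu NU).
- exact: (monnat_eps NU).
Qed.

Lemma act2_compare : is_act2 f h compare.
Proof.
split.
- exact: emonnat_compare.
- split.
  + move=> [].
    rewrite -[LHS]/(thetaVB (ub tt) ∘ theta (r := rB f) (ub tt) ∘ sB f tt).
    rewrite -(cmpA HC) (theta_sigma BC (alpha := ab) HVb (action_B Hf)).
    rewrite -(theta_sigma BC (alpha := ab) HVb (action_B Hh)) (cmpA HC).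
    by rewrite (proj1 (thetaVB_inverse _)) (cmp1m HC).
  + move=> [].
    rewrite -[LHS]/(thetaVU (uu tt) ∘ theta (r := rU f) (uu tt) ∘ sU f tt).
    rewrite -(cmpA HUM) (theta_sigma HU (alpha := au) (alphaV := auV) HVc (action_U Hf)).
    rewrite -(theta_sigma HU (alpha := au) (alphaV := auV) HVc (action_U Hh)) (cmpA HUM).
    by rewrite (proj1 (thetaVU_inverse _)) (cmp1m HUM).
- split.
  + move=> [a m].
    rewrite -[LHS]/(rhoAt (r := rB h) a m
      ∘ ((thetaVB a ∘ theta (r := rB f) a) ⊠ idm m)).
    rewrite -(theta_rho BC brfun_Gb HVb Hvb (lax_pB Hh) (monnat_sB Hh) (monnat_rB Hh)
      (action_B Hh)).
    rewrite -[RHS](theta_rho BC brfun_Gb HVb Hvb (lax_pB Hf) (monnat_sB Hf)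
      (monnat_rB Hf) (action_B Hf) a m).
    rewrite -(cmpA HC) (tmorM HC) (cmp1m HC) (cmpA HC) (proj2 (thetaVB_inverse _)).
    by rewrite (cmp1m HC).
  + move=> [a m].
    rewrite -[LHS]/(rhoAt (r := rU h) a m
      ∘ ((thetaVU a ∘ theta (r := rU f) a) ⊠ idm (m : U))).
    rewrite -(theta_rho (A := V) (X := U) HU (G := Gu) brfun_Gu (alpha := au)
      (alphaV := auV) HVc Hvu (lax_pU Hh)
      (monnat_sU Hh) (monnat_rU Hh) (action_U Hh)).
    rewrite -[RHS](theta_rho (A := V) (X := U) HU (G := Gu) brfun_Gu (alpha := au)
      (alphaV := auV) HVc Hvu
      (lax_pU Hf) (monnat_sU Hf) (monnat_rU Hf) (action_U Hf) a m).
    rewrite -(cmpA HUM) (tmorM HUM) (cmp1m HUM) (cmpA HUM) (proj2 (thetaVU_inverse _)).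
    by rewrite (cmp1m HUM).
Qed.

(** The law of a 2-morphism at [(a, 1)] determines [xi ⊠ idm mone]. *)
Lemma act2_unique (xi zeta : enatData (act1_p f) (act1_p h)) :
  is_act2 f h xi -> is_act2 f h zeta -> enat_eq xi zeta.
Proof.
move=> Hx Hz'; split=> a.
- apply: (run_cancel HC).
  have I : is_iso (rB h (a, mone)) by exists (rVB (a, mone)); exact: (HrVb (a, mone)).
  apply: (iso_cancel_l HC I).
  have Ex := proj1 (act2_rho Hx) (a, mone).
  rewrite -(proj1 (act2_rho Hz') (a, mone)) in Ex; exact: Ex.
- apply: (run_cancel HUM).
  have I : is_iso (rU h (a, mone)).
    by exists (rVU (a, mone)); have [E1 E2] := HrVc (a, em_one); split; [exact: E1 | exact: E2].
  apply: (iso_cancel_l HUM I).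
  have Ex := proj2 (act2_rho Hx) (a, em_one).
  rewrite -(proj2 (act2_rho Hz') (a, em_one)) in Ex; exact: Ex.
Qed.

End Two.
End Action.

Theorem theorem6p10 (M : ebrData) (HM : is_ebr M) :
  is_E2_center (mugerAction HM).
Proof.
split; first exact: act_muger.
move=> [A u g alpha] [/= HA Hu Hg [Halpha [alphaV [_ [EV EV']]]]].
have HVb x : is_inverse (en_bg alpha x) (en_bg alphaV x).
  by split; [exact: (proj1 EV) | exact: (proj1 EV')].
have HVc x : is_inverse (en_cmp alpha x) (en_cmp alphaV x).
  by split; [exact: (proj2 EV) | exact: (proj2 EV')].
have [vb Hvb] := strong_eps (strong_ub Hu).
have [vu Hvu] := strong_eps (strong_uu Hu).
split.
  by eexists; exact: (act1_canon HM HA Hu Hg Halpha HVb HVc Hvb Hvu).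
move=> f h Hf Hh.
have [_ [rV [_ [ErV ErV']]]] := act1_rho_iso Hh.
have HrVb x : is_inverse (en_bg (act1_rho h) x) (en_bg rV x).
  by split; [exact: (proj1 ErV) | exact: (proj1 ErV')].
have HrVc x : is_inverse (en_cmp (act1_rho h) x) (en_cmp rV x).
  by split; [exact: (proj2 ErV) | exact: (proj2 ErV')].
split.
  by eexists; exact: (act2_compare Hu Hg HVb HVc Hvb Hvu Hf Hh HrVb HrVc).
by move=> xi zeta; exact: (act2_unique HrVb HrVc).
Qed.
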